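(* Let $(\beta_n,h_n)_{n\ge1}$ be a sequence of pairs of real numbers with $(\beta_n,h_n)\to(\beta,h)$, where $\beta,h\ge0$. Assume that the free energy $f_{\beta,h}$ has multiple global minimizers $\boldsymbol{x},\boldsymbol{x}',\ldots$ in $\Omega$ and let $\varepsilon>0$ be smaller than the distance between any two global minimizers of $f_{\beta,h}$. Let $\boldsymbol{d}_n$ be the smallest (in norm) $\boldsymbol{d}\in\mathcal{H}$ such that $\boldsymbol{x}+\boldsymbol{d}\in\Omega$ is a local minimizer of $f_{\beta_n,h_n}$. Then, under the conditional measure $$\mu_{\beta_n,h_n,n}\left(\,\cdot\,\Big|\,\frac{\boldsymbol{N}}{n}\in B(\boldsymbol{x},\varepsilon)\right),$$ the variable $\boldsymbol{W}$ defined by $\boldsymbol{N}=n\boldsymbol{x}+n\boldsymbol{d}_n+n^{1/2}\boldsymbol{W}$ converges in law, as $n\to\infty$, to the centered Gaussian vector with covariance matrix $K(\boldsymbol{x})$.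
   Context: $q\ge 2$ is a fixed integer. The Curie-Weiss Potts model: for $n\ge1$ and real $\beta,h$, $\mu_{\beta,h,n}$ is the probability measure on $\{1,\ldots,q\}^n$ given by $$\mu_{\beta,h,n}(\sigma)=\frac1{Z_{\beta,h,n}}\exp\Big(\frac{\beta}{n}\sum_{1\le i<j\le n}\delta_{\sigma_i,\sigma_j}+h\sum_{i=1}^n\delta_{\sigma_i,1}\Big),$$ with $\delta$ the Kronecker symbol and $Z_{\beta,h,n}$ the normalizing constant. The empirical vector is $\boldsymbol{N}=(N_1,\ldots,N_q)$ with $N_k=\sum_{i=1}^n\delta_{\sigma_i,k}$. $\Omega=\{\boldsymbol{x}\in\mathbb{R}^q: x_1+\cdots+x_q=1,\ x_i\ge0\ \forall i\}$. The free energy is $f_{\beta,h}(\boldsymbol{x})=\sum_{i=1}^q x_i\log x_i-\frac{\beta}{2}\sum_{i=1}^q x_i^2-hx_1$ for $\boldsymbol{x}\in\Omega$, with $0\log0=0$; its (global or local) minimizers are understood in $\Omega$. $\mathcal{H}=\{\boldsymbol{w}\in\mathbb{R}^q:\sum_{i=1}^q w_i=0\}$, and $B(\boldsymbol{x},\varepsilon)$ is the Euclidean ball. The matrix $K(\boldsymbol{x})$ is the $q\times q$ matrix $$K(\boldsymbol{x})=\left(\frac{1}{\min_i(x_i)\max_i(x_i)}-q\beta\right)^{-1}M,$$ with $M_{ii}=1+(q-2)\alpha(x_i,x_i)$ and $M_{ij}=-\alpha(x_i,x_j)$ for $i\neq j$, where $$\alpha(x,y)=\frac{\max_i(x_i)^{-1}-\beta}{\max(x,y)^{-1}-\beta},$$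 with the convention that $\alpha(x,y)=1$ whenever $\max(x,y)=\max_i(x_i)$ (including when $\max_i(x_i)^{-1}=\beta$). *)

(* Defs.v *)
From mathcomp Require Import all_boot all_order all_algebra.
From mathcomp Require Import all_classical all_reals all_analysis.

Set Implicit Arguments.
Unset Strict Implicit.
Unset Printing Implicit Defensive.

Import Order.TTheory GRing.Theory Num.Theory.
Import numFieldNormedType.Exports.

Local Open Scope classical_set_scope.
Local Open Scope ring_scope.

(* Vectors of R^q are 'rV[R]_q and the colours 1, ..., q are the elements of
   'I_q, so that the distinguished colour 1 is the ordinal of value 0%N. *)

(* R^q with its Borel sigma-algebra *)
Notation borel_rV R q := (g_sigma_algebraType (@open 'rV[R]_q)).

Section Potts.
Variables (R : realType) (q : nat).
Implicit Types (beta h : R) (x y d w : 'rV[R]_q).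

(* The library norm on 'rV[R]_q is the sup norm. *)
Definition enorm w : R := Num.sqrt (\sum_(i < q) w 0 i ^+ 2).

Definition eball x (eps : R) : set 'rV[R]_q := [set y | enorm (y - x) < eps].

Definition simplex : set 'rV[R]_q :=
  [set x | \sum_(i < q) x 0 i = 1 /\ forall i, 0 <= x 0 i].

Definition zero_sum : set 'rV[R]_q := [set w | \sum_(i < q) w 0 i = 0].

(* 0 * ln 0 = 0 *)
Definition free_energy beta h x : R :=
  \sum_(i < q) x 0 i * ln (x 0 i)
  - beta / 2 * \sum_(i < q) x 0 i ^+ 2
  - h * \sum_(i < q | i == 0%N :> nat) x 0 i.

Definition global_minimizer beta h x : Prop :=
  simplex x /\ forall y, simplex y -> free_energy beta h x <= free_energy beta h y.

Definition local_minimizer beta h x : Prop :=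
  simplex x /\ exists2 r : R, 0 < r &
    forall y, simplex y -> eball x r y ->
      free_energy beta h x <= free_energy beta h y.

Definition smallest_shift beta h x d : Prop :=
  [/\ zero_sum d, local_minimizer beta h (x + d) &
    forall d', zero_sum d' -> local_minimizer beta h (x + d') ->
      enorm d <= enorm d'].

Definition configuration (n : nat) := {ffun 'I_n -> 'I_q}.

Definition gibbs_weight n beta h (s : configuration n) : R :=
  expR (beta / n%:R * \sum_(i < n) \sum_(j < n | (i < j)%N) (s i == s j)%:R
        + h * \sum_(i < n) (s i == 0%N :> nat)%:R).

Definition partition_function n beta h : R :=
  \sum_(s : configuration n) gibbs_weight beta h s.

Definition gibbs n beta h (s : configuration n) : R :=
  gibbs_weight beta h s / partition_function n beta h.

Definition gibbs_cond_expectation n beta h (A : set (configuration n))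
    (F : configuration n -> R) : R :=
  (\sum_(s : configuration n | s \in A) gibbs beta h s * F s)
  / \sum_(s : configuration n | s \in A) gibbs beta h s.

Definition empirical n (s : configuration n) : 'rV[R]_q :=
  \row_k \sum_(i < n) (s i == k)%:R.

(* The vector W with N = n x + n d + sqrt n W, for n >= 1. *)
Definition fluctuation n x d (s : configuration n) : 'rV[R]_q :=
  (Num.sqrt n%:R)^-1 *: (empirical s - n%:R *: x - n%:R *: d).

(* On the simplex all coordinates lie in [0, 1], so the default values of the
   iterated extrema are harmless. *)
Definition max_coord x : R := \big[Num.max/0]_(i < q) x 0 i.
Definition min_coord x : R := \big[Num.min/1]_(i < q) x 0 i.

Definition alpha beta x (a b : R) : R :=
  if Num.max a b == max_coord x then 1
  else ((max_coord x)^-1 - beta) / ((Num.max a b)^-1 - beta).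

Definition covariance_matrix beta x : 'M[R]_q :=
  ((min_coord x * max_coord x)^-1 - q%:R * beta)^-1 *:
  \matrix_(i, j)
    if i == j then 1 + (q%:R - 2) * alpha beta x (x 0 i) (x 0 i)
    else - alpha beta x (x 0 i) (x 0 j).

(* Mean m and standard deviation s; [normal_prob m 0] is not the Dirac mass. *)
Definition normal_law (m s : R) (A : set R) : \bar R :=
  if s == 0 then \d_m A else normal_prob m s A.

Definition gaussian_vector_law (P : probability (borel_rV R q) R) : Prop :=
  forall t : 'rV[R]_q, exists m s : R, forall A : set R, measurable A ->
    P [set w | A (\sum_(i < q) t 0 i * w 0 i)] = normal_law m s A.

Definition centered_gaussian (K : 'M[R]_q) (P : probability (borel_rV R q) R) : Prop :=
  [/\ gaussian_vector_law P,
    forall i : 'I_q, expectation P (fun w : borel_rV R q => w 0 i) = 0%E &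
    forall i j : 'I_q, covariance P (fun w : borel_rV R q => w 0 i)
      (fun w : borel_rV R q => w 0 j) = (K i j)%:E].

(* Convergence in law to P of a sequence of random vectors whose expectations
   are given by E: E n g is the expectation of g at the n-th vector. *)
Definition cvg_in_law (E : nat -> ('rV[R]_q -> R) -> R)
    (P : probability (borel_rV R q) R) : Prop :=
  forall g : 'rV[R]_q -> R, continuous g ->
    (exists M : R, forall w, `|g w| <= M) ->
    (E n g)%:E @[n --> \oo] --> expectation P (g : borel_rV R q -> R).

End Potts.

Arguments gibbs_cond_expectation {R q} n beta h A F.
Arguments fluctuation {R q} n x d s.

(* Main.v *)
From HB Require Import structures.
Require Import Defs.
From mathcomp Require Import all_boot all_order all_algebra.
From mathcomp Require Import all_classical all_reals all_analysis.
From mathcomp Require Import measurable_realfun.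
From mathcomp Require Import ring lra zify.

Set Implicit Arguments.
Unset Strict Implicit.
Unset Printing Implicit Defensive.

Import Order.TTheory GRing.Theory Num.Theory.
Import numFieldNormedType.Exports.

Local Open Scope classical_set_scope.
Local Open Scope ring_scope.

(** The weight of a configuration depends on it only through the colour
frequencies y = N/n. There are n! / prod_k N_k! configurations with the same
counts N, and by Stirling's formula their total weight is
exp (- n (f_n (y) - f_n (p_n))), up to a factor common to all N and a factor
that converges near x; here f_n is the free energy at (beta_n, h_n) and
p_n = x + d_n. With y = p_n + w / sqrt n, the exponent converges to minus half
the Hessian form of f at x, evaluated at w. The sums over the lattice of the
possible values of w, divided by the volume of a cell, thus converge to
Gaussian integrals over the zero-sum hyperplane; the constants cancel in the
conditional expectation, which is a quotient of two such sums.

The Hessian form is positive definite at x ([minimizer_structure],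
[hess_coercive]). A global minimizer has one coordinate a and all the others
equal to some b <= a. On vectors of this shape the free energy is a function of
s = a - b, and the existence of two global minimizers provides a second critical
point of this function. Its second derivative has the sign of q - beta D for a
strictly concave quadratic function D of s, so that by Rolle's theorem a minimum
among several critical points is nondegenerate ([branch_nondegenerate]).

The perturbed minimizer p_n behaves like x. In the closed ball of radius eps
around x the limit free energy has no other global minimizer, hence f_n has a
local minimizer close to x and d_n tends to 0 ([near_shift]). As p_n is a
critical point of f_n, the excess f_n (y) - f_n (p_n) has no linear part: it is
bounded below by a multiple of |y - p_n|^2 on the whole ball
([free_energy_lower_bound]), which dominates all the masses by one Gaussian
weight ([window_mass_bound]), and it has the expected quadratic limit
([cvg_scaled_excess]), which gives the limits of the masses
([window_mass_cvg]).

Sums are compared with integrals one coordinate at a time. The lattice sum is an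
iterated integral of a step function along the directions e_j - e_i0
([iter_int_point_masses]), dominated convergence applies to each of these
integrals in turn ([iter_int_cvg]), and the limit is computed by completing a
square at each step ([iter_int_gaussian]). This recursion presents the limit law
as that of a sum of independent standard normal multiples of explicit vectors
([gaussian_sum]); such a law is Gaussian because a sum of two independent
centered normal variables is normal ([normal_law_add]), and its covariance is
that of the theorem ([gvecs_cov], [covariance_matrixE]). *)

(** * Affine substitutions and moments of normal laws *)

Section affine.
Variable R : realType.
Notation mu := (@lebesgue_measure R).

(** Pulling back along x |-> a * x + b and multiplying by |a| preserves the
length of half-open intervals, which determines Lebesgue measure. *)
Lemma lebesgue_measure_affine (a b : R) (A : set R) : a != 0 -> measurable A ->
  mu ((fun x : R => a * x + b) @^-1` A) = (`|a|^-1%:E * mu A)%E.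
Proof.
move=> a0 mA.
pose phi : measurableTypeR R -> measurableTypeR R := fun x => a * x + b.
have mphi : measurable_fun setT phi.
  by apply: measurable_funD => //; exact: measurable_funM.
have an0 : 0 < `|a| by rewrite normr_gt0.
pose M : {measure set (measurableTypeR R) -> \bar R} :=
  measure_function_pushforward__canonical__measure_function_Measure
    (@lebesgue_measure R) mphi.
pose N : {measure set (measurableTypeR R) -> \bar R} :=
  mscale (NngNum (normr_ge0 a)) M.
have -> : mu A = N A.
  apply: lebesgue_measure_unique => // _ [[u v] _ <-] /=.
  rewrite /N/= /mscale/= /pushforward/=.
  have [a1|a1] := ltP 0 a.
    rewrite (_ : _ @^-1` _ = [set` `]((u - b) / a), ((v - b) / a)]]); last first.
      apply/seteqP; split => x; rewrite /phi/= !in_itv/= ltr_pdivrMr// ler_pdivlMr//; lra.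
    rewrite !lebesgue_measure_itv/= !lte_fin ltr_pM2r ?invr_gt0// ltrD2r.
    case: ifPn => _; last by rewrite mule0.
    by rewrite -!EFinD -EFinM gtr0_norm//; congr EFin; field; rewrite gt_eqF.
  have {}a1 : a < 0 by rewrite lt_neqAle a0.
  rewrite (_ : _ @^-1` _ = [set` `[((v - b) / a), ((u - b) / a)[]); last first.
    apply/seteqP; split => x; rewrite /phi/= !in_itv/= ltr_ndivlMr// ler_ndivrMr//; lra.
  rewrite !lebesgue_measure_itv/= !lte_fin ltr_nM2r ?invr_lt0// ltrD2r.
  case: ifPn => _; last by rewrite mule0.
  by rewrite -!EFinD -EFinM ltr0_norm//; congr EFin; field; rewrite lt_eqF.
by rewrite /N/= /mscale/= muleA -EFinM mulVf ?mul1e// gt_eqF.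
Qed.

Lemma ge0_integral_affine (a b : R) (f : R -> \bar R) : a != 0 ->
  measurable_fun setT f -> (forall x, 0 <= f x)%E ->
  (\int[mu]_x f (a * x + b)%R = `|a|^-1%:E * \int[mu]_x f x)%E.
Proof.
move=> a0 mf f0.
pose phi : measurableTypeR R -> measurableTypeR R := fun x => a * x + b.
have mphi : measurable_fun setT phi.
  by apply: measurable_funD => //; exact: measurable_funM.
rewrite -(@ge0_integral_pushforward _ _ _ _ _ _ mphi (@lebesgue_measure R) setT f)//.
have a1 : 0 <= `|a|^-1 by rewrite invr_ge0.
rewrite -(@ge0_integral_mscale _ _ _ (@lebesgue_measure R) setT measurableT (NngNum a1))//.
apply: eq_measure_integral => A mA _; exact: lebesgue_measure_affine.
Qed.

End affine.

Section normal.
Variable R : realType.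
Notation mu := (@lebesgue_measure R).

Lemma ge0_integral_normal_prob (m s : R) (f : R -> \bar R) :
  measurable_fun setT f -> (forall x, 0 <= f x)%E ->
  (\int[normal_prob m s]_x f x = \int[mu]_x (f x * (normal_pdf m s x)%:E))%E.
Proof.
move=> mf f0; have dom := normal_prob_dominates m s.
rewrite -(Radon_Nikodym_SigmaFinite.change_of_variables dom)//.
apply: ae_eq_integral => //=.
- apply: emeasurable_funM => //.
  exact: measurable_int (Radon_Nikodym_SigmaFinite.f_integrable dom).
- by apply: emeasurable_funM => //; apply/measurable_EFinP; exact: measurable_normal_pdf.
have : ae_eq (@lebesgue_measure R) setT (Radon_Nikodym_SigmaFinite.f (normal_prob m s) (@lebesgue_measure R))
   (fun x => (normal_pdf m s x)%:E).
  apply: integral_ae_eq => //.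
  - exact: Radon_Nikodym_SigmaFinite.f_integrable.
  - by apply/measurable_EFinP; exact: measurable_normal_pdf.
  by move=> E _ mE; rewrite -Radon_Nikodym_SigmaFinite.f_integral.
by apply: filterS => x /= h _; rewrite h.
Qed.

Lemma normal_pdf01E (x : R) :
  normal_pdf 0 1 x = normal_peak 1 * expR (- (x ^+ 2 / 2)).
Proof.
by rewrite normal_pdfE ?oner_neq0// /normal_fun subr0 expr1n mulNr.
Qed.

(** For the standard density p, x^2 p(x) - p(x) is the derivative of - x p(x):
on [-n, n] the second moment and the total mass differ by a boundary term that
tends to 0. *)
Lemma normal_second_moment :
  (\int[normal_prob 0 1]_x ((x : R) ^+ 2)%:E = 1)%E.
Proof.
rewrite ge0_integral_normal_prob//; last first.
  by move=> x; rewrite lee_fin sqr_ge0.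
  by apply/measurable_EFinP; apply: measurable_funX.
pose F (x : R) : R := - (x * (normal_peak 1 * expR (- (x ^+ 2 / 2)))).
pose f (x : R) : R := x ^+ 2 * normal_pdf 0 1 x - normal_pdf 0 1 x.
have dF (x : R) : is_derive x 1 F (f x).
  rewrite /F /f !normal_pdf01E.
  apply: is_derive_eq.
  by rewrite /GRing.scale/= !mulr1; field.
have cf : continuous f.
  move=> x; have cp : {for x, continuous (@normal_pdf R 0 1)}.
    by apply: continuous_normal_pdf; rewrite oner_neq0.
  apply: cvgB => //; apply: cvgM => //; exact: exprn_continuous.
pose J (n : nat) : set R := [set` `[- n%:R, n%:R]].
have ndJ : {homo J : n m / (n <= m)%N >-> (n <= m)%O}.
  move=> n m nm; apply/subsetPset => x; rewrite /J/= !in_itv/=.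
  have : n%:R <= m%:R :> R by rewrite ler_nat.
  lra.
have mJ i : measurable (J i) by exact: measurable_itv.
have UJ : \bigcup_n J n = setT.
  apply/seteqP; split => // x _; exists (Num.truncn `|x|).+1 => //.
  rewrite /J/= in_itv/= -ler_norml ltW//.
  by have /andP[] := truncn_itv (normr_ge0 x).
have cvJ (g : R -> R) : measurable_fun setT g -> (forall x, 0 <= g x) ->
   ((\int[mu]_(x in J n) (g x)%:E) @[n --> \oo] --> \int[mu]_x (g x)%:E)%E.
  move=> mg g0; rewrite -[in X in _ --> X]UJ.
  apply: ge0_nondecreasing_set_cvg_integral => //.
  - by move=> i; apply: measurable_funTS; exact/measurable_EFinP.
  - by move=> i x _; rewrite lee_fin.
have m2 : measurable_fun setT (fun x : R => x ^+ 2 * normal_pdf 0 1 x).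
  by apply: measurable_funM; [apply: measurable_funX|exact: measurable_normal_pdf].
have p2 (x : R) : 0 <= x ^+ 2 * normal_pdf 0 1 x.
  by rewrite mulr_ge0 ?sqr_ge0 ?normal_pdf_ge0.
have c1 := cvJ _ (measurable_normal_pdf 0 1) (normal_pdf_ge0 0 1).
rewrite integral_normal_pdf in c1.
have c2 := cvJ _ m2 p2.
have key n : (0 < n)%N -> (\int[mu]_(x in J n) (x ^+ 2 * normal_pdf 0 1 x)%:E =
   \int[mu]_(x in J n) (normal_pdf 0 1 x)%:E + (F n%:R - F (- n%:R))%R%:E)%E.
  move=> n0; have nn : - n%:R < n%:R :> R.
    have : 0 < n%:R :> R by rewrite ltr0n.
    lra.
  rewrite EFinB -(@continuous_FTC2 _ f F _ _ nn).
  - rewrite -integralD//=.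
    + apply: eq_integral => x _; rewrite -EFinD /f; congr EFin; lra.
    + exact: measurable_itv.
    + apply: (integrableS measurableT) => //; first exact: measurable_itv.
      exact: integrable_normal_pdf.
    + apply: continuous_compact_integrable; first exact: segment_compact.
      exact: continuous_subspaceT.
  - exact: continuous_subspaceT.
  - split; first by move=> x _; exact: ex_derive.
      apply: cvg_at_right_filter; apply/differentiable_continuous/derivable1_diffP; exact: ex_derive.
    apply: cvg_at_left_filter; apply/differentiable_continuous/derivable1_diffP; exact: ex_derive.
  by move=> x _; rewrite derive1E; apply: derive_val.
have F0 : (F n%:R - F (- n%:R)) @[n --> \oo] --> (0 : R).
  have -> : (fun n : nat => F n%:R - F (- n%:R)) =
    fun n : nat => - (2 * normal_peak 1) * (n%:R * expR (- (n%:R ^+ 2 / 2))).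
    apply/funext => n; rewrite /F sqrrN; ring.
  rewrite -(mulr0 (- (2 * normal_peak 1))); apply: cvgMr.
  apply: (@squeeze_cvgr _ _ _ _ (cst 0) (fun n => 2 * n%:R^-1)).
  - near=> n.
    have n0 : 0 < n%:R :> R by rewrite ltr0n; near: n; exists 1%N.
    rewrite mulr_ge0 ?ler0n ?expR_ge0//= expRN ler_pdivrMr ?expR_gt0//.
    have := expR_ge1Dx (n%:R ^+ 2 / 2 : R).
    set e := expR _ => he.
    have : n%:R <= 2 / n%:R * (1 + n%:R ^+ 2 / 2) :> R.
      rewrite (_ : 2 / n%:R * (1 + n%:R ^+ 2 / 2) = 2 / n%:R + n%:R).
        by rewrite lerDr divr_ge0// ltW.
      by field; rewrite gt_eqF.
    move/le_trans; apply; rewrite ler_wpM2l// divr_ge0// ltW//.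
  - exact: cvg_cst.
  - rewrite -(mulr0 2); apply: cvgMr.
    by apply/(gtr0_cvgV0 _).2; [exact: nbhs_infty_gtr|exact: cvgr_idn].
have c3 : (\int[mu]_(x in J n) (x ^+ 2 * normal_pdf 0 1 x)%:E @[n --> \oo] --> 1 + 0%:E)%E.
  have : (\int[mu]_(x in J n) (normal_pdf 0 1 x)%:E + (F n%:R - F (- n%:R))%R%:E @[n --> \oo] --> 1 + 0%:E)%E.
    apply: cvgeD => //; first by apply: cvg_EFin; [exact: nearW|exact: F0].
  apply: cvg_trans; apply: near_eq_cvg; near=> n; rewrite key//; near: n; by exists 1%N.
rewrite adde0 in c3.
have -> : (\int[mu]_x ((x ^+ 2)%:E * (normal_pdf 0 1 x)%:E) = \int[mu]_x (x ^+ 2 * normal_pdf 0 1 x)%R%:E)%E by [].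
exact: (cvg_unique _ c2 c3).
Unshelve. all: end_near. Qed.

Lemma pushforward_normal (s r : R) (A : set R) : s != 0 -> r != 0 -> measurable A ->
  normal_prob 0 s ((fun z => z * r) @^-1` A) = normal_prob 0 (`|s * r|) A.
Proof.
move=> s0 r0 mA; have sr0 : `|s * r| != 0 by rewrite normr_eq0 mulf_neq0.
have mB : measurable ((fun z : R => z * r) @^-1` A).
  have mf : measurable_fun setT (fun z : R => z * r) by exact: measurable_funM.
  by rewrite -[X in measurable X]setTI; exact: mf.
rewrite /normal_prob integral_mkcond [RHS]integral_mkcond.
pose g (x : R) := (((fun u => (normal_pdf 0 `|s * r| u)%:E) \_ A) x * `|r|%:E)%E.
have -> : ((fun x : R => (normal_pdf 0 s x)%:E) \_ ((fun z => z * r) @^-1` A)) = fun x => g (r * x + 0).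
  apply/funext => x; rewrite /g !patchE addr0 mulrC.
  have -> : (x \in (fun z => z * r) @^-1` A) = ((x * r) \in A).
    by apply/idP/idP; rewrite !inE.
  case: ifP => _; last by rewrite mul0e.
  rewrite !normal_pdfE// -EFinM; congr EFin.
  rewrite /normal_fun /normal_peak !subr0 real_normK ?num_real// !exprMn.
  rewrite [RHS]mulrAC; congr (_ * _); last first.
    by congr expR; field; rewrite s0 r0.
  rewrite (_ : s ^+ 2 * r ^+ 2 * pi *+ 2 = r ^+ 2 * (s ^+ 2 * pi *+ 2)); last ring.
  rewrite [in RHS]sqrtrM ?sqr_ge0// sqrtr_sqr [in RHS]invfM.
  by rewrite [RHS]mulrAC mulVf ?mul1r// normr_eq0.
have mg : measurable_fun setT ((fun u => (normal_pdf 0 `|s * r| u)%:E) \_ A).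
  apply/(measurable_restrictT _ _).1 => //; apply: measurable_funTS.
  by apply: measurableT_comp => //; exact: measurable_normal_pdf.
have g0 (x : R) : (0 <= ((fun u => (normal_pdf 0 `|s * r| u)%:E) \_ A) x)%E.
  by rewrite patchE; case: ifP => // _; rewrite lee_fin normal_pdf_ge0.
rewrite (@ge0_integral_affine _ r 0 g)//.
- rewrite /g ge0_integralZr// muleC -muleA -EFinM divff ?mule1// normr_eq0//.
- by apply: emeasurable_funM.
- by move=> x; rewrite mule_ge0// lee_fin.
Qed.
End normal.

Section stability.
Variable R : realType.
Notation mu := (@lebesgue_measure R).

(** Completing the square in z: given the value u of the sum, z is again normal,
with mean u r / sig^2 and standard deviation s / sig. *)
Lemma normal_pdf_convolution (s r u z : R) : s != 0 -> r != 0 ->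
  let sig := Num.sqrt (s ^+ 2 + r ^+ 2) in
  normal_pdf 0 s (u - z * r) * normal_pdf 0 1 z =
  normal_pdf 0 sig u * normal_pdf (u * r / sig ^+ 2) (s / sig) z.
Proof.
move=> s0 r0 sig.
have sig2 : sig ^+ 2 = s ^+ 2 + r ^+ 2.
  by rewrite sqr_sqrtr// addr_ge0 ?sqr_ge0.
have p2 : 0 < s ^+ 2 + r ^+ 2.
  by rewrite ltr_wpDr ?sqr_ge0// lt_neqAle eq_sym sqrf_eq0 s0 sqr_ge0.
have sig0 : sig != 0 by rewrite gt_eqF// sqrtr_gt0.
rewrite !normal_pdfE ?mulf_neq0 ?invr_eq0 ?oner_neq0//.
rewrite mulrACA [RHS]mulrACA; congr (_ * _).
  rewrite /normal_peak -!invfM; congr (_^-1).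
  rewrite -!sqrtrM; last 2 first.
  - by rewrite mulrn_wge0// mulr_ge0 ?sqr_ge0 ?pi_ge0.
  - by rewrite mulrn_wge0// mulr_ge0 ?sqr_ge0 ?pi_ge0.
  congr Num.sqrt; rewrite expr_div_n; field; exact: sig0.
rewrite /normal_fun -!expRD; congr expR; rewrite expr_div_n sig2; field.
by rewrite s0 gt_eqF.
Qed.

(** By Fubini the density of the sum is the integral over z of the left-hand side
of [normal_pdf_convolution]. *)
Lemma normal_prob_convolution (s r : R) (A : set R) : s != 0 -> r != 0 ->
  measurable A ->
  (\int[normal_prob 0 1]_z normal_prob 0 s ((fun y : R => (y + z * r)%R) @^-1` A) =
  normal_prob 0 (Num.sqrt (s ^+ 2 + r ^+ 2)) A)%E.
Proof.
move=> s0 r0 mA; set sig := Num.sqrt _.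
have p2 : 0 < s ^+ 2 + r ^+ 2.
  by rewrite ltr_wpDr ?sqr_ge0// lt_neqAle eq_sym sqrf_eq0 s0 sqr_ge0.
have sig0 : sig != 0 by rewrite gt_eqF// sqrtr_gt0.
(* Integrate over the value u = y + z r of the sum instead of y. *)
pose f (z u : R) : \bar R := ((\1_A u * normal_pdf 0 s (u - z * r))%:E)%E.
have mf : measurable_fun setT (fun zu : R * R => f zu.1 zu.2).
  apply/measurable_EFinP; apply: measurable_funM.
    by apply: measurableT_comp => //; exact: measurable_indic.
  apply: (measurableT_comp (measurable_normal_pdf 0 s)).
  by apply: measurable_funB => //; apply: measurable_funM.
have f0 z u : (0 <= f z u)%E by rewrite lee_fin mulr_ge0 ?normal_pdf_ge0.
have E z : normal_prob 0 s ((fun y : R => (y + z * r)%R) @^-1` A) = (\int[mu]_u f z u)%E.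
  have mB : measurable ((fun y : R => (y + z * r)%R) @^-1` A).
    have mg : measurable_fun setT (fun y : R => y + z * r) by exact: measurable_funD.
    by rewrite -[X in measurable X]setTI; exact: mg.
  have := @ge0_integral_affine R 1 (z * r) (f z) (oner_neq0 _).
  rewrite normr1 invr1 mul1e => <-//; last first.
    by apply: (measurableT_comp mf (measurable_pair1 z)) => //.
  rewrite /normal_prob integral_mkcond; apply: eq_integral => y _.
  rewrite patchE /f mul1r addrK indicE.
  have -> : (y \in (fun y : R => (y + z * r)%R) @^-1` A) = (y + z * r \in A).
    by apply/idP/idP; rewrite !inE.
  by case: ifP => _; rewrite ?mul1r ?mul0r.
under eq_integral do rewrite E.
rewrite ge0_integral_normal_prob; last first.
- by move=> z; exact: integral_ge0.
- exact: (measurable_fun_fubini_tonelli_F (m2 := mu) (fun zu : R * R => f zu.1 zu.2)).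
transitivity (\int[mu]_z \int[mu]_u (f z u * (normal_pdf 0 1 z)%:E))%E.
  apply: eq_integral => z _; rewrite ge0_integralZr//.
    exact: (measurableT_comp mf (measurable_pair1 z)).
  by rewrite lee_fin normal_pdf_ge0.
rewrite (fubini_tonelli (m1 := mu) (m2 := mu) (fun zu : R * R => f zu.1 zu.2 * (normal_pdf 0 1 zu.1)%:E)%E)/=; last first.
- by move=> [z u]; rewrite mule_ge0// lee_fin normal_pdf_ge0.
- apply: emeasurable_funM => //; apply/measurable_EFinP.
  exact: (measurableT_comp (measurable_normal_pdf 0 1)).
rewrite /normal_prob [RHS]integral_mkcond; apply: eq_integral => u _.
rewrite patchE.
transitivity (\int[mu]_z ((\1_A u * normal_pdf 0 sig u)%:E * (normal_pdf (u * r / sig ^+ 2) (s / sig) z)%:E))%E.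
  by apply: eq_integral => z _; rewrite /f -!EFinM; congr EFin; rewrite -[LHS]mulrA -[RHS]mulrA normal_pdf_convolution.
rewrite ge0_integralZl//; last 3 first.
- by apply/measurable_EFinP; exact: measurable_normal_pdf.
- by move=> z _; rewrite lee_fin normal_pdf_ge0.
- by rewrite lee_fin mulr_ge0 ?normal_pdf_ge0.
rewrite integral_normal_pdf mule1 indicE.
by case: ifP => _; rewrite ?mul1r ?mul0r.
Qed.

(** The cases s = 0 and r = 0 are included: the sums below contain vanishing
coefficients, for which [normal_law] is a Dirac mass. *)
Lemma normal_law_add d (T : measurableType d) (P : probability T R) (X : T -> R)
    (s r : R) (A : set R) :
  measurable_fun setT X -> 0 <= s ->
  (forall B, measurable B -> P (X @^-1` B) = normal_law 0 s B) ->
  measurable A ->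
  (P \x normal_prob 0 1)%E [set yz : T * measurableTypeR R | A (X yz.1 + yz.2 * r)] =
  normal_law 0 (Num.sqrt (s ^+ 2 + r ^+ 2)) A.
Proof.
move=> mX s0 PX mA; set D : set (T * measurableTypeR R) := [set _ | _].
have mh : measurable_fun setT (fun yz : T * measurableTypeR R => (X yz.1 + yz.2 * r : measurableTypeR R)).
  apply: measurable_funD; first exact: (measurableT_comp mX).
  exact: measurable_funM.
have mD : measurable D.
  by rewrite -[X in measurable X]setTI; exact: mh.
have mind : measurable_fun setT (fun yz : T * measurableTypeR R => (\1_D yz)%:E : \bar R).
  by apply/measurable_EFinP; exact: measurable_indic.
have -> : (P \x normal_prob 0 1)%E D =
    (\int[normal_prob 0 1]_z P (X @^-1` ((fun y : R => (y + z * r)%R) @^-1` A)))%E.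
  transitivity (\int[(P \x normal_prob 0 1)%E]_yz (\1_D yz)%:E)%E.
    by have := integral_indic (P \x normal_prob 0 1)%E measurableT mD; rewrite setIT => ->.
  rewrite fubini_tonelli2//.
  apply: eq_integral => z _; rewrite /fubini_G.
  rewrite -[in RHS](setIT (X @^-1` _)) -integral_indic//.
  have mg : measurable_fun setT (fun y => X y + z * r) by exact: measurable_funD.
  by rewrite -[X in measurable X]setTI; exact: mg.
have mB z : measurable ((fun y : R => (y + z * r)%R) @^-1` A).
  have mg : measurable_fun setT (fun y : R => y + z * r) by exact: measurable_funD.
  by rewrite -[X in measurable X]setTI; exact: mg.
under eq_integral => z _ do rewrite PX//.
have cstN (c : \bar R) : (\int[normal_prob 0 1]_(z in [set: R]) c = c)%E.
  by rewrite integral_cst// -[RHS]mule1; congr (_ * _)%E; exact: probability_setT.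
have [->|s1] := eqVneq s 0.
  have [->|r0] := eqVneq r 0.
    rewrite expr0n/= addr0 sqrtr0 /normal_law eqxx.
    under eq_integral => z _ do rewrite /dirac/=.
    rewrite (eq_integral (fun=> (\d_ (0:R) A))); last first.
      move=> z _; rewrite /dirac/= !indicE; congr (nat_of_bool _)%:R%:E.
      by apply/idP/idP; rewrite !inE/= mulr0 addr0.
    exact: cstN.
  rewrite expr0n/= add0r sqrtr_sqr /normal_law eqxx normr_eq0 (negPf r0).
  transitivity (\int[normal_prob 0 1]_z (\1_((fun z => z * r) @^-1` A) z)%:E)%E.
    apply: eq_integral => z _; rewrite diracE indicE; congr (nat_of_bool _)%:R%:E.
    by apply/idP/idP; rewrite !inE/= add0r.
  have mg : measurable_fun setT (fun z : R => z * r) by exact: measurable_funM.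
  have mC : measurable ((fun z : R => z * r) @^-1` A).
    by rewrite -[X in measurable X]setTI; exact: mg.
  have := integral_indic (normal_prob 0 1) measurableT mC; rewrite setIT => ->.
  by rewrite -[r in RHS]mul1r; exact: (pushforward_normal (oner_neq0 R) r0 mA).
have q0 : Num.sqrt (s ^+ 2 + r ^+ 2) != 0.
  rewrite gt_eqF// sqrtr_gt0 ltr_wpDr ?sqr_ge0//.
  by rewrite lt_neqAle eq_sym sqrf_eq0 s1 sqr_ge0.
rewrite /normal_law (negPf q0) (negPf s1).
have [->|r0] := eqVneq r 0.
  rewrite expr0n/= addr0 sqrtr_sqr ger0_norm//.
  rewrite (eq_integral (fun=> normal_prob 0 s A)); last first.
    move=> z _; congr (normal_prob _ _ _); apply/funext => y /=; by rewrite mulr0 addr0.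
  exact: cstN.
exact: normal_prob_convolution.
Qed.

End stability.

(** * Sums of independent normal multiples of fixed vectors *)

Section borel_rV.
Variables (R : realType) (q : nat).
Notation V := (borel_rV R q).

Lemma continuous_measurable_rV (g : 'rV[R]_q -> R) : continuous g ->
  measurable_fun [set: V] (g : V -> R).
Proof.
move=> /continuousP cg; apply: (measurability _ (RGenOpens.measurableE R)).
move=> _ [_ [a [b ->] <-]]; rewrite setTI.
by apply: sub_sigma_algebra; apply: cg; exact: interval_open.
Qed.

Lemma measurable_coord (i : 'I_q) : measurable_fun [set: V] (fun w : V => w 0 i : R).
Proof. by apply: continuous_measurable_rV => x; exact: coord_continuous. Qed.

(** An open set is a countable union of boxes with rational centres and sides
2 / (k + 1), so that measurability can be tested on the coordinates. *)
Lemma measurable_borel_rV d (T : measurableType d) (f : T -> V) :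
  (forall i, measurable_fun setT (fun t => f t 0 i : R)) -> measurable_fun setT f.
Proof.
move=> mf; apply: (@measurability _ _ _ V setT f (@open 'rV[R]_q) erefl).
move=> _ [U oU <-]; rewrite setTI.
pose box (ck : 'rV[rat]_q * nat) : set 'rV[R]_q :=
  [set y | forall i, `|ratr (ck.1 0 i) - y 0 i| < ck.2.+1%:R^-1].
pose good (n : nat) : set 'rV[R]_q :=
  if (unpickle n : option ('rV[rat]_q * nat)) is Some ck then
    (if `[< box ck `<=` U >] then box ck else set0) else set0.
have UE : U = \bigcup_n good n.
  apply/seteqP; split => [y Uy|y [n _]]; last first.
    rewrite /good; case: unpickle => // ck; case: asboolP => // + h; exact.
  have /nbhs_ballP[e /= e0 ye] : nbhs y U by exact: open_nbhs_nbhs.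
  pose k := Num.truncn (2 / e).
  have ke : k.+1%:R^-1 < e / 2.
    rewrite -[e / 2]invrK ltf_pV2 ?posrE ?invr_gt0 ?divr_gt0// invf_div.
    have h2 : 0 <= 2 / e by rewrite divr_ge0// ltW.
    by have /andP[] := truncn_itv h2.
  have k0 : 0 < k.+1%:R^-1 :> R by rewrite invr_gt0.
  have ex i : exists c : rat, `|ratr c - y 0 i| < k.+1%:R^-1.
    have /rat_in_itvoo[c] : y 0 i < y 0 i + k.+1%:R^-1 by rewrite ltrDl.
    rewrite in_itv/= => /andP[c1 c2]; exists c.
    by rewrite gtr0_norm ?subr_gt0// ltrBlDl.
  have [c hc] := choice ex.
  exists (pickle (\row_i c i, k)) => //; rewrite /good pickleK.
  have hb : box (\row_i c i, k) `<=` U.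
    move=> z /= hz; apply: ye; split => // i j; rewrite ord1 /ball/=.
    have := hz j; have := hc j; rewrite mxE => h1 h2.
    have := ler_distD (ratr (c j)) (y 0 j) (z 0 j).
    rewrite (distrC (y 0 j) (ratr _)) => /le_lt_trans; apply.
    by rewrite (splitr e) ltrD// (lt_trans _ ke).
  by case: asboolP => // _ i; rewrite mxE; exact: hc.
rewrite UE preimage_bigcup; apply: bigcupT_measurable => n.
rewrite /good; case: unpickle => [ck|]; last by rewrite preimage_set0.
case: asboolP => _; last by rewrite preimage_set0.
rewrite (_ : _ @^-1` _ = \bigcap_(i in [set: 'I_q])
    (fun t => f t 0 i : R) @^-1` ball (ratr (ck.1 0 i) : R) ck.2.+1%:R^-1); last first.
  apply/seteqP; split => t /= h i; [move=> _; exact: h|exact: (h i I)].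
apply: fin_bigcap_measurable => // i _.
by rewrite -[X in measurable X]setTI; apply: mf => //; apply: open_measurable; exact: ball_open.
Qed.

Definition line_shift (c : 'rV[R]_q) (yz : V * measurableTypeR R) : V :=
  yz.1 + (yz.2 : R) *: c.

Lemma measurable_line_shift c : measurable_fun setT (line_shift c).
Proof.
apply: measurable_borel_rV => i; rewrite /line_shift.
under eq_fun do rewrite !mxE.
apply: measurable_funD.
  exact: (measurableT_comp (measurable_coord i)).
apply: measurable_funM => //; exact: measurable_snd.
Qed.

HB.instance Definition _ c :=
  @isMeasurableFun.Build _ _ _ _ (line_shift c) (measurable_line_shift c).

(** The law of Z_1 c_1 + ... + Z_m c_m for independent standard normal Z_k. The
product with one normal law at a time lets Fubini peel off one summand. *)
Fixpoint gaussian_sum (cs : seq 'rV[R]_q) : probability V R :=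
  if cs is c :: cs' then
    distribution (gaussian_sum cs' \x normal_prob 0 1)%E (line_shift c)
  else dirac (0 : V).

Lemma gaussian_sum_law cs (t : 'rV[R]_q) (A : set R) : measurable A ->
  gaussian_sum cs [set w | A (\sum_(i < q) t 0 i * w 0 i)] =
  normal_law 0 (Num.sqrt (\sum_(c <- cs) (\sum_(i < q) t 0 i * c 0 i) ^+ 2)) A.
Proof.
elim: cs A => [|c cs IH] A mA /=.
  rewrite big_nil sqrtr0 /normal_law eqxx !diracE; congr (nat_of_bool _)%:R%:E.
  apply/idP/idP; rewrite !inE/=; under eq_bigr do rewrite mxE mulr0;
  by rewrite big1.
rewrite big_cons /distribution /pushforward.
pose X (w : V) : R := \sum_(i < q) t 0 i * w 0 i.
have mX : measurable_fun setT X.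
  apply: measurable_sum => i; apply: measurable_funM => //; exact: measurable_coord.
set s := \sum_(j <- cs) _; have s0 : 0 <= s by apply: sumr_ge0 => j _; exact: sqr_ge0.
have E := @normal_law_add R _ V (gaussian_sum cs) X (Num.sqrt s) (X c) A mX (sqrtr_ge0 _) IH mA.
rewrite addrC -[s in RHS](sqr_sqrtr s0) -E {E}.
have -> // : line_shift c @^-1` (fun w : V => A (\sum_(i < q) t 0 i * w 0 i)) =
  [set yz : V * measurableTypeR R | A (X yz.1 + yz.2 * X c)].
have XE yz : \sum_(i < q) t 0 i * line_shift c yz 0 i = X yz.1 + (yz.2 : R) * X c.
  rewrite /X mulr_sumr -big_split/=; apply: eq_bigr => i _.
  by rewrite !mxE mulrDr mulrCA.
by apply/seteqP; split => yz /=; rewrite XE.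
Qed.

Lemma ge0_integral_gaussian_sum_cons c cs (g : V -> \bar R) :
  measurable_fun setT g -> (forall w, 0 <= g w)%E ->
  (\int[gaussian_sum (c :: cs)]_w g w =
   \int[normal_prob 0 1]_z \int[gaussian_sum cs]_y g ((y : 'rV[R]_q) + (z : R) *: c)%R)%E.
Proof.
move=> mg g0; rewrite /= ge0_integral_distribution// fubini_tonelli2//.
- exact: measurableT_comp.
- by move=> yz; exact: g0.
Qed.

End borel_rV.

Section normal_moments.
Variable R : realType.

Lemma normal_law0E (s : R) (A : set R) : measurable A ->
  normal_law 0 `|s| A = normal_prob 0 1 ((fun z => z * s) @^-1` A).
Proof.
move=> mA; have [->|s0] := eqVneq s 0.
  rewrite normr0 /normal_law eqxx diracE.
  have [A0|A0] := boolP (0 \in A).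
    rewrite (_ : _ @^-1` _ = setT) ?probability_setT//.
    by apply/seteqP; split => // z _ /=; rewrite mulr0; exact: set_mem.
  rewrite (_ : _ @^-1` _ = set0) ?measure0//.
  by apply/seteqP; split => // z /=; rewrite mulr0 => /mem_set; rewrite (negPf A0).
rewrite /normal_law normr_eq0 (negPf s0).
by rewrite -[in LHS](mul1r s) -(pushforward_normal (oner_neq0 R) s0 mA).
Qed.

Variables (d : measure_display) (T : measurableType d) (P : probability T R).
Variables (X : T -> R) (s : R).
Hypothesis mX : measurable_fun setT X.
Hypothesis lawX : forall A, measurable A -> P (X @^-1` A) = normal_law 0 `|s| A.

Lemma ge0_integral_normal_law (f : R -> \bar R) :
  measurable_fun setT f -> (forall x, 0 <= f x)%E ->
  (\int[P]_x f (X x) = \int[normal_prob 0 1]_z f (z * s)%R)%E.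
Proof.
move=> mf f0.
have ms : measurable_fun setT (fun z : measurableTypeR R => z * s : measurableTypeR R).
  exact: measurable_funM.
rewrite -(@ge0_integral_pushforward _ _ T (measurableTypeR R) _ (X : T -> measurableTypeR R) mX P setT f)//.
rewrite -(@ge0_integral_pushforward _ _ _ _ _ _ ms (normal_prob 0 1) setT f)//.
apply: eq_measure_integral => A mA _.
exact: (etrans (lawX mA) (normal_law0E s mA)).
Qed.

Lemma normal_law_sqr : (\int[P]_x (X x ^+ 2)%:E = (s ^+ 2)%:E)%E.
Proof.
rewrite (ge0_integral_normal_law (f := fun x => (x ^+ 2)%:E))//; last 2 first.
- by apply/measurable_EFinP; exact: measurable_funX.
- by move=> x; rewrite lee_fin sqr_ge0.
under eq_integral do rewrite exprMn EFinM.
rewrite ge0_integralZr ?normal_second_moment ?mul1e ?lee_fin ?sqr_ge0//.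
  by apply/measurable_EFinP; exact: measurable_funX.
by move=> x _; rewrite lee_fin sqr_ge0.
Qed.

Lemma normal_law_sqr_integrable : P.-integrable setT (fun x => (X x ^+ 2)%:E).
Proof.
apply/integrableP; split.
  by apply/measurable_EFinP; exact: measurable_funX.
under eq_integral do rewrite gee0_abs ?lee_fin ?sqr_ge0//.
by rewrite normal_law_sqr ltry.
Qed.

Lemma normal_law_integrable : P.-integrable setT (fun x => (X x)%:E).
Proof.
apply: (@le_integrable _ _ _ _ _ _ _ (fun x => (1 + X x ^+ 2)%:E)) => //.
- exact/measurable_EFinP.
- move=> x _; rewrite /= lee_fin [leRHS]ger0_norm; last by rewrite addr_ge0 ?sqr_ge0.
  have := sqr_ge0 (`|X x| - 1); rewrite -(real_normK (num_real (X x))); nra.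
- under eq_fun do rewrite EFinD.
  apply: integrableD => //; last exact: normal_law_sqr_integrable.
  by apply: finite_measure_integrable_cst.
Qed.

End normal_moments.

(** X and - X have the same law, hence positive and negative parts with equal
integrals. *)
Lemma normal_law_mean d (T : measurableType d) (R : realType) (P : probability T R) (X : T -> R) (s : R) :
  measurable_fun setT X ->
  (forall A, measurable A -> P (X @^-1` A) = normal_law 0 `|s| A) ->
  (\int[P]_x (X x)%:E = 0)%E.
Proof.
move=> mX lawX; have iX := normal_law_integrable mX lawX.
have mN : measurable_fun setT (fun x => - X x) by exact: measurableT_comp.
have lawN A : measurable A -> P ((fun x => - X x) @^-1` A) = normal_law 0 `|s| A.
  move=> mA; have mA' : measurable ((fun z : R => - z) @^-1` A).
    have mo : measurable_fun setT (fun z : R => - z) by exact: oppr_measurable.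
    by rewrite -[X in measurable X]setTI; exact: mo.
  rewrite (lawX _ mA') normal_law0E// -[in RHS]normrN normal_law0E//.
  by congr (normal_prob _ _ _); apply/seteqP; split => z /=; rewrite mulrN.
have pos Y : measurable_fun setT Y ->
   (forall A, measurable A -> P (Y @^-1` A) = normal_law 0 `|s| A) ->
   (\int[P]_x (Num.max (Y x) 0)%:E = \int[normal_prob 0 1]_z (Num.max (z * s)%R 0)%:E)%E.
  move=> mY lawY.
  rewrite -(ge0_integral_normal_law mY lawY (f := fun x => (Num.max x 0)%:E))//.
    by apply/measurable_EFinP; exact: measurable_maxr.
  by move=> x; rewrite lee_fin le_max lexx orbT.
rewrite integralE.
have -> : ((fun x => (X x)%:E)^\+ = fun x => (Num.max (X x) 0)%:E)%E.
  by apply/funext => x; rewrite funeposE EFin_max.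
have -> : ((fun x => (X x)%:E)^\- = fun x => (Num.max (- X x) 0)%:E)%E.
  by apply/funext => x; rewrite funenegE EFin_max EFinN.
rewrite (pos _ mX lawX) -(pos _ mN lawN) subee//.
have := integrable_neg_fin_num measurableT iX; congr (_ \is a _).
by apply: eq_integral => x _; rewrite funenegE EFin_max EFinN.
Qed.

Section gaussian_vector.
Variables (R : realType) (q : nat).
Notation V := (borel_rV R q).

(** The law of every linear functional is known; covariances follow by
polarization from the variances of the sum and the difference of two
coordinates. *)
Lemma gaussian_sum_centered (cs : seq 'rV[R]_q) (K : 'M[R]_q) :
  (forall i j, K i j = \sum_(c <- cs) c 0 i * c 0 j) ->
  centered_gaussian K (gaussian_sum cs).
Proof.
move=> KE; pose L (t : 'rV[R]_q) (w : V) : R := \sum_(i < q) t 0 i * w 0 i.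
pose var (t : 'rV[R]_q) := Num.sqrt (\sum_(c <- cs) (\sum_(i < q) t 0 i * c 0 i) ^+ 2).
have mL t : measurable_fun setT (L t).
  by apply: measurable_sum => i; apply: measurable_funM => //; exact: measurable_coord.
have lawL t A : measurable A -> gaussian_sum cs (L t @^-1` A) = normal_law 0 `|var t| A.
  by move=> mA; rewrite ger0_norm ?sqrtr_ge0//; exact: gaussian_sum_law.
have Ld i : L (delta_mx 0 i) = fun w : V => w 0 i.
  apply/funext => w; rewrite /L (bigD1 i)//= big1 ?addr0 ?mxE ?eqxx ?mul1r//.
  by move=> j ji; rewrite mxE (negPf ji) andbF mul0r.
have LD i j : L (delta_mx 0 i + delta_mx 0 j) = fun w : V => w 0 i + w 0 j.
  apply/funext => w; have -> : w 0 i = L (delta_mx 0 i) w by rewrite Ld.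
  have -> : w 0 j = L (delta_mx 0 j) w by rewrite Ld.
  by rewrite /L -big_split; apply: eq_bigr => k _; rewrite !mxE mulrDl.
have LB i j : L (delta_mx 0 i - delta_mx 0 j) = fun w : V => w 0 i - w 0 j.
  apply/funext => w; have -> : w 0 i = L (delta_mx 0 i) w by rewrite Ld.
  have -> : w 0 j = L (delta_mx 0 j) w by rewrite Ld.
  by rewrite /L -sumrB; apply: eq_bigr => k _; rewrite !mxE mulrBl.
have mean i : expectation (gaussian_sum cs) (fun w : V => w 0 i) = 0%E.
  by have := normal_law_mean (mL _) (lawL (delta_mx 0 i)); rewrite Ld unlock.
split => [t||i j]; [|exact: mean|].
  exists 0, (var t) => A mA; exact: gaussian_sum_law.
rewrite unlock !mean/= unlock.
pose f (w : V) : R := (w 0 i + w 0 j) ^+ 2.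
pose g (w : V) : R := (w 0 i - w 0 j) ^+ 2.
have fI := normal_law_sqr_integrable (mL _) (lawL (delta_mx 0 i + delta_mx 0 j)).
have gI := normal_law_sqr_integrable (mL _) (lawL (delta_mx 0 i - delta_mx 0 j)).
have fE := normal_law_sqr (mL _) (lawL (delta_mx 0 i + delta_mx 0 j)).
have gE := normal_law_sqr (mL _) (lawL (delta_mx 0 i - delta_mx 0 j)).
rewrite !LD in fI fE; rewrite !LB in gI gE.
transitivity (\int[gaussian_sum cs]_w (4^-1%:E * ((f w)%:E - (g w)%:E)))%E.
  apply: eq_integral => w _; rewrite -EFinB -EFinM; congr EFin.
  change ((w 0 i - 0) * (w 0 j - 0) =
    4^-1 * ((w 0 i + w 0 j) ^+ 2 - (w 0 i - w 0 j) ^+ 2)).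
  by field.
rewrite integralZl//; last exact: integrableB.
rewrite integralB// fE gE -EFinB -EFinM; congr EFin.
rewrite !sqr_sqrtr ?sumr_ge0//; try by move=> *; exact: sqr_ge0.
rewrite -sumrB KE mulr_sumr; apply: eq_bigr => c _.
have E1 : \sum_(k < q) (delta_mx 0 i + delta_mx 0 j : 'rV[R]_q) 0 k * c 0 k = c 0 i + c 0 j.
  exact: (congr1 (fun h => h c) (LD i j)).
have E2 : \sum_(k < q) (delta_mx 0 i - delta_mx 0 j : 'rV[R]_q) 0 k * c 0 k = c 0 i - c 0 j.
  exact: (congr1 (fun h => h c) (LB i j)).
by rewrite E1 E2; field.
Qed.

End gaussian_vector.

(** * Lattice sums and integrals as iterated one-dimensional integrals *)

Section riemann_sums.
Variables (R : realType) (q : nat) (i0 : 'I_q).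
Notation mu := (@lebesgue_measure R).
Notation V := 'rV[R]_q.
Implicit Types (s t : seq 'I_q) (F : V -> R) (v : V).

(** Moving along [edir j] transfers mass from colour i0 to colour j; for j <> i0
these directions form a basis of the zero-sum hyperplane. *)
Definition edir (j : 'I_q) : V := delta_mx 0 j - delta_mx 0 i0.

(** Integral of F over v + span {edir j | j in s}, one direction after the other.
With r = id this is a Lebesgue integral; with r = grid a it is the sum of the
values of F on a lattice of mesh 1 / a, times the volume of a cell. *)
Fixpoint iter_int (r : R -> R) s F v : R :=
  if s is j :: s' then \int[mu]_u iter_int r s' F (v + r u *: edir j) else F v.

Definition grid (a u : R) : R := (Num.floor (a * u))%:~R / a.

Lemma grid_near a u : 0 < a -> `|grid a u - u| <= a^-1.
Proof.
move=> a0; rewrite /grid; have /andP[h1 h2] := floor_itv (a * u).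
have -> : (Num.floor (a * u))%:~R / a - u = ((Num.floor (a * u))%:~R - a * u) / a.
  by field; rewrite gt_eqF.
rewrite normrM (gtr0_norm (_ : 0 < a^-1)) ?invr_gt0//.
apply: ler_piMl; first by rewrite invr_ge0 ltW.
rewrite ler_norml; move: h1 h2; rewrite intrD; lra.
Qed.

Lemma measurable_comp_floor (a : R) (phi : int -> R) :
  measurable_fun setT (fun u : R => phi (Num.floor (a * u))).
Proof.
move=> _ B mB; rewrite setTI.
pose P (n : nat) : set R := if (unpickle n : option int) is Some k then
  (if phi k \in B then (fun u => a * u) @^-1` [set` `[k%:~R, (k + 1)%:~R[] else set0)
  else set0.
have -> : (fun u : R => phi (Num.floor (a * u))) @^-1` B = \bigcup_n P n.
  apply/seteqP; split => [u /= Bu|u [n _]].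
    exists (pickle (Num.floor (a * u))); first exact: I.
    by rewrite /P pickleK (mem_set Bu)/= in_itv/=; exact: floor_itv.
  rewrite /P; case: unpickle => // k; case: ifPn => // /set_mem Bk /=.
  by rewrite in_itv/= => /floor_def ->.
apply: bigcupT_measurable => n; rewrite /P; case: unpickle => // k.
case: ifP => // _.
have ma : measurable_fun setT (fun u : R => a * u) by exact: measurable_funM.
by rewrite -[X in measurable X]setTI; apply: ma.
Qed.

Definition gw (c x : R) : R := expR (- (c * x ^+ 2)).

Lemma gw_ge0 c x : 0 <= gw c x. Proof. exact: expR_ge0. Qed.

Lemma gw_le1 c x : 0 <= c -> gw c x <= 1.
Proof. by move=> c0; rewrite -expR0 ler_expR oppr_le0 mulr_ge0// sqr_ge0. Qed.

Lemma measurable_gw c x : measurable_fun setT (fun u : R => gw c (x + u)).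
Proof.
have m1 : measurable_fun setT (fun u : R => c * (x + u) ^+ 2).
  by apply: measurable_funM => //; apply: measurable_funX; exact: measurable_funD.
exact: (measurableT_comp (@measurable_expR R) (measurable_funN m1)).
Qed.

(** Halving the rate absorbs the cross term produced by the shift. *)
Lemma gw_shift c e u del : 0 <= c -> `|del| <= e ->
  gw c (u + del) <= expR (c * e ^+ 2) * gw (c / 2) u.
Proof.
move=> c0 de; rewrite -expRD ler_expR.
have h : del ^+ 2 <= e ^+ 2 by rewrite -(real_normK (num_real del)) ler_sqr// nnegrE// (le_trans _ de).
have h2 := sqr_ge0 (u + 2 * del).
have : 0 <= c * (e ^+ 2 - u ^+ 2 / 2 + (u + del) ^+ 2).
  apply: mulr_ge0 => //; nra.
nra.
Qed.

Lemma integral_gw c x : 0 < c ->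
  (\int[mu]_u (gw c (x + u))%:E = ((Num.sqrt c)^-1 * Num.sqrt pi)%:E)%E.
Proof.
move=> c0; have s0 : 0 < Num.sqrt c by rewrite sqrtr_gt0.
have E u : (gw c (x + u))%:E = (gauss_fun (Num.sqrt c * u + Num.sqrt c * x))%:E.
  by rewrite /gw /gauss_fun -mulrDr exprMn sqr_sqrtr ?ltW// addrC.
under eq_integral do rewrite E.
rewrite (@ge0_integral_affine _ (Num.sqrt c) (Num.sqrt c * x) (fun u => (gauss_fun u)%:E))//.
- by rewrite integralT_gauss -EFinM gtr0_norm.
- by rewrite gt_eqF.
- by apply/measurable_EFinP; exact: measurable_gauss_fun.
- by move=> u; rewrite lee_fin gauss_fun_ge0.
Qed.

Lemma integrable_gw c x : 0 < c -> mu.-integrable setT (fun u => (gw c (x + u))%:E).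
Proof.
move=> c0; apply/integrableP; split.
  by apply/measurable_EFinP; exact: measurable_gw.
under eq_integral do rewrite gee0_abs ?lee_fin ?gw_ge0//.
by rewrite integral_gw// ltry.
Qed.

Lemma integrableZ_gw k c x : 0 < c ->
  mu.-integrable setT (EFin \o (fun u => k * gw c (x + u))).
Proof.
move=> c0; rewrite (_ : _ \o _ = fun u => k%:E * (gw c (x + u))%:E)%E; last first.
  by apply/funext => u; rewrite /= EFinM.
by apply: integrableZl => //; exact: integrable_gw.
Qed.

Lemma normr_Rintegral_le (f g : R -> R) (K : R) : measurable_fun setT f ->
  mu.-integrable setT (EFin \o g) -> (forall u, `|f u| <= g u) ->
  (\int[mu]_u (g u)%:E <= K%:E)%E -> `|\int[mu]_u f u| <= K.
Proof.
move=> mf ig fg gK.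
have fi : mu.-integrable setT (EFin \o f).
  apply: (le_integrable measurableT _ _ ig); first exact/measurable_EFinP.
  by move=> u _; rewrite /= lee_fin (le_trans (fg u))// ler_norm.
rewrite -lee_fin EFin_normr_Rintegral//.
apply: (le_trans (le_abse_integral _ measurableT _)); first exact/measurable_EFinP.
apply: le_trans gK; apply: ge0_le_integral => //.
- by apply: measurableT_comp => //; exact/measurable_EFinP.
- exact: measurable_int ig.
- by move=> u _; rewrite lee_fin.
Qed.

(** The masses are controlled at lattice points only, so the lattices are part
of the data. *)
Definition grid_closed (a : R) (L : set V) :=
  forall v (k : int) j, L v -> L (v + (k%:~R / a) *: edir j).

(** The dominating function: a Gaussian weight in the directions that remain to
be integrated. *)
Definition wgt c s v : R := \prod_(i <- s) gw c (v 0 i).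

Lemma wgt_ge0 c s v : 0 <= wgt c s v.
Proof. by apply: prodr_ge0 => i _; exact: gw_ge0. Qed.

Lemma wgt_shift c t v u j : j \notin t -> i0 \notin t -> wgt c t (v + u *: edir j) = wgt c t v.
Proof.
move=> jt it; rewrite /wgt; apply: eq_big_seq => i it'.
rewrite !mxE; have /negPf -> : i != j by apply: contraNneq jt => <-.
have /negPf -> : i != i0 by apply: contraNneq it => <-.
by rewrite !andbF subrr mulr0 addr0.
Qed.

Lemma coord_shift v u j : j != i0 -> (v + u *: edir j) 0 j = v 0 j + u.
Proof. by move=> ji; rewrite !mxE !eqxx (negPf ji) andbF subr0 mulr1. Qed.

(** Integrating along edir j changes the coordinates j and i0 only: the weight in
coordinate j is traded for a constant, uniformly in the mesh 1 / a <= 1, and the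
others remain. *)
Lemma iter_int_bound c s t C : 0 < c -> 0 <= C -> uniq (s ++ t) -> i0 \notin s ++ t ->
  exists2 C', 0 <= C' & forall (a : R) (L : set V) F, 1 <= a -> grid_closed a L ->
   (forall v, L v -> `|F v| <= C * wgt c (s ++ t) v) ->
   forall v, L v -> `|iter_int (grid a) s F v| <= C' * wgt c t v.
Proof.
move=> c0; elim: s t C => [|j s IH] t C C0 ust ist /=; first by exists C.
move: ust ist => /= /andP[jst ust]; rewrite inE negb_or => /andP[ji0 ist].
have pst : perm_eq (s ++ j :: t) (j :: (s ++ t)) by apply/permPl; exact: (perm_catCA s [:: j] t).
have [||C1 C10 h1] := IH (j :: t) C C0.
- by rewrite (perm_uniq pst)/= jst.
- by rewrite (perm_mem pst) inE negb_or ji0.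
have c20 : 0 < c / 2 by rewrite divr_gt0.
(* The factor expR c pays for the rounding error, at most 1 / a <= 1. *)
pose K := expR c * ((Num.sqrt (c / 2))^-1 * Num.sqrt pi).
exists (C1 * K).
  by rewrite mulr_ge0// /K mulr_ge0 ?expR_ge0// mulr_ge0 ?invr_ge0 ?sqrtr_ge0.
move=> a L F a1 La Fb v Lv.
have a0 : 0 < a by exact: lt_le_trans a1.
pose g u := C1 * wgt c t v * expR c * gw (c / 2) (v 0 j + u).
have Fb' w : L w -> `|F w| <= C * wgt c (s ++ j :: t) w.
  by rewrite /wgt (perm_big _ pst); exact: Fb.
apply: (@normr_Rintegral_le _ g).
- exact: (measurable_comp_floor a (fun k => iter_int (grid a) s F (v + (k%:~R / a) *: edir j))).
- exact: integrableZ_gw.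
- move=> u; have Lu : L (v + grid a u *: edir j) by exact: La.
  apply: (le_trans (h1 a L F a1 La Fb' _ Lu)).
  rewrite /wgt big_cons -/(wgt c t _) wgt_shift//; last 2 first.
  + by move: jst; rewrite mem_cat negb_or => /andP[].
  + by move: ist; rewrite mem_cat negb_or => /andP[].
  rewrite /g -!mulrA ler_wpM2l// mulrC ler_wpM2l ?wgt_ge0//.
  rewrite coord_shift 1?eq_sym//.
  have -> : v 0 j + grid a u = (v 0 j + u) + (grid a u - u) by ring.
  have d1 : `|grid a u - u| <= 1.
    by apply: (le_trans (grid_near u a0)); rewrite invf_le1.
  by have := gw_shift (v 0 j + u) (ltW c0) d1; rewrite expr1n mulr1.
- rewrite /g; under eq_integral do rewrite EFinM.
  rewrite ge0_integralZl//; last 3 first.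
  + by apply/measurable_EFinP; exact: measurable_gw.
  + by move=> u _; rewrite lee_fin gw_ge0.
  + by rewrite lee_fin !mulr_ge0 ?wgt_ge0 ?expR_ge0.
  rewrite integral_gw// -EFinM lee_fin /K le_eqVlt; apply/orP; left; apply/eqP; ring.
Qed.

(** Induction on s, by dominated convergence in the first variable. The
hypothesis on F_ is continuous convergence, along all convergent sequences of
lattice points: the base points of the inner integrals move with n. *)
Lemma iter_int_cvg c C (a : nat -> R) (L : nat -> set V) (F_ : nat -> V -> R) F s :
  0 < c -> 0 <= C -> uniq s -> i0 \notin s ->
  (forall n, 1 <= a n) -> a n @[n --> \oo] --> +oo ->
  (forall n, grid_closed (a n) (L n)) ->
  (forall n v, L n v -> `|F_ n v| <= C * wgt c s v) ->
  (forall (v_ : nat -> V) v, (forall n, L n (v_ n)) ->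
    (forall i, v_ n 0 i @[n --> \oo] --> v 0 i) ->
    F_ n (v_ n) @[n --> \oo] --> F v) ->
  forall (v_ : nat -> V) v, (forall n, L n (v_ n)) ->
    (forall i, v_ n 0 i @[n --> \oo] --> v 0 i) ->
    iter_int (grid (a n)) s (F_ n) (v_ n) @[n --> \oo] --> iter_int id s F v.
Proof.
move=> c0 C0 + + a1 aoo La + HF.
elim: s => [|j s IH] us is0 Fb v_ v Lv vv; first exact: HF.
move: us is0; rewrite /= inE negb_or => /andP[js us] /andP[ji0 is0].
have {}ji0 : j != i0 by rewrite eq_sym.
have a0 n : 0 < a n by exact: lt_le_trans (a1 n).
have {}IH := IH us is0.
have Fb' n w : L n w -> `|F_ n w| <= C * wgt c s w.
  move=> Lw; apply: (le_trans (Fb _ _ Lw)); rewrite ler_wpM2l//.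
  by rewrite /wgt big_cons ler_piMl ?wgt_ge0// gw_le1// ltW.
have [||C1 C10 h1] := @iter_int_bound c s [:: j] C c0 C0.
- by rewrite cats1 rcons_uniq js.
- by rewrite cats1 mem_rcons inE negb_or eq_sym ji0.
have Fb1 n w : L n w -> `|F_ n w| <= C * wgt c (s ++ [:: j]) w.
  move=> Lw; apply: (le_trans (Fb _ _ Lw)).
  by rewrite /wgt [in leRHS](perm_big (j :: s))//= cats1 perm_rcons.
have [M M0 vM] : exists2 M, 0 <= M & forall n, `|v_ n 0 j| <= M.
  have /cvg_seq_bounded[M [Mr hM]] : cvgn (fun n => v_ n 0 j) by apply/cvg_ex; exists (v 0 j); exact: vv.
  exists (`|M| + 1) => [|n]; first by rewrite addr_ge0.
  apply: hM => //; have := ler_norm M; lra.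
pose K := expR (c * (1 + M) ^+ 2).
have key n u : `|iter_int (grid (a n)) s (F_ n) (v_ n + grid (a n) u *: edir j)|
   <= C1 * K * gw (c / 2) (0 + u).
  have Lu : L n (v_ n + grid (a n) u *: edir j) by exact: La.
  apply: (le_trans (h1 _ _ _ (a1 n) (La n) (Fb1 n) _ Lu)).
  rewrite -mulrA ler_wpM2l// /wgt big_seq1 coord_shift// add0r.
  have -> : v_ n 0 j + grid (a n) u = u + (v_ n 0 j + (grid (a n) u - u)) by ring.
  apply: gw_shift; first exact: ltW.
  apply: (le_trans (ler_normD _ _)); rewrite addrC lerD//.
  by apply: (le_trans (grid_near u (a0 n))); rewrite invf_le1.
have cv u : iter_int (grid (a n)) s (F_ n) (v_ n + grid (a n) u *: edir j) @[n --> \oo]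
   --> iter_int id s F (v + u *: edir j).
  apply: IH => //; first by move=> n; exact: La.
  move=> i; rewrite !mxE.
  under eq_fun do rewrite !mxE.
  apply: cvgD; first exact: vv.
  apply: cvgMl.
  have : (fun n => (grid (a n) u - u) + u) @ \oo --> 0 + u.
    apply: cvgD; last exact: cvg_cst.
    apply/norm_cvg0P; apply: (@squeeze_cvgr _ _ _ _ (cst 0) (fun n => (a n)^-1)).
    - by near=> n; rewrite normr_ge0/= grid_near.
    - exact: cvg_cst.
    - by apply/gtr0_cvgV0 => //; exact: nearW.
  by rewrite add0r; under eq_fun do rewrite subrK.
pose f_ n u : \bar R := (iter_int (grid (a n)) s (F_ n) (v_ n + grid (a n) u *: edir j))%:E.
pose f u : \bar R := (iter_int id s F (v + u *: edir j))%:E.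
pose g u : \bar R := (C1 * K * gw (c / 2) (0 + u))%:E.
have mf_ n : measurable_fun setT (f_ n).
  apply/measurable_EFinP.
  exact: (measurable_comp_floor (a n) (fun k => iter_int (grid (a n)) s (F_ n) (v_ n + (k%:~R / a n) *: edir j))).
have cvf u : f_ n u @[n --> \oo] --> f u.
  by apply: cvg_EFin; [exact: nearW|exact: cv].
have mf : measurable_fun setT f.
  by apply: (emeasurable_fun_cvg _ f mf_) => u _; exact: cvf.
have ig : mu.-integrable setT g.
  by apply: integrableZ_gw; rewrite divr_gt0.
have [||fi _ cvi] := @dominated_convergence _ _ _ (@lebesgue_measure R) setT
    measurableT f_ f g mf_ mf _ ig _.
- by apply: aeW => u _; exact: cvf.
- by apply: aeW => u n _; rewrite /f_ /g lee_fin; exact: key.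
rewrite /Rintegral; apply: fine_cvg; rewrite fineK//.
exact: integrable_fin_num.
Unshelve. all: end_near. Qed.

End riemann_sums.

Section grid_point_masses.
Variables (R : realType) (q : nat) (i0 : 'I_q).
Notation mu := (@lebesgue_measure R).
Notation V := 'rV[R]_q.

(** The lattice points seen by [iter_int i0 (grid a) s] from v; the coordinate i0
is determined by the sum. *)
Definition reach (a : R) (s : seq 'I_q) (v y : V) : Prop :=
  [/\ forall i, i \notin s -> i != i0 -> y 0 i = v 0 i,
    forall j, j \in s -> exists k : int, y 0 j - v 0 j = k%:~R / a &
    \sum_i y 0 i = \sum_i v 0 i].

Lemma sum_edir j : \sum_i edir R i0 j 0 i = 0.
Proof.
have S k : \sum_i (delta_mx 0 k : V) 0 i = 1.
  rewrite (bigD1 k)//= mxE !eqxx big1 ?addr0// => i ik.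
  by rewrite mxE (negPf ik) andbF.
under eq_bigr do rewrite mxE [X in _ + X]mxE.
by rewrite sumrB !S subrr.
Qed.

Lemma sum_shift (v : V) (u : R) j : \sum_i (v + u *: edir R i0 j) 0 i = \sum_i v 0 i.
Proof.
under eq_bigr do rewrite mxE [X in _ + X]mxE.
by rewrite big_split/= -mulr_sumr sum_edir mulr0 addr0.
Qed.

Lemma reach_nil a v y : reach a [::] v y <-> y = v.
Proof.
split => [[h _ hs]|->]; last by split.
apply/rowP => i; have [->|ii0] := eqVneq i i0; last exact: h.
move: hs; rewrite (bigD1 i0)//= [in RHS](bigD1 i0)//=.
rewrite (eq_bigr (fun i => v 0 i)); first by move/addIr.
by move=> k ki; exact: h.
Qed.

Lemma floor_interval (a : R) (k : int) : 0 < a ->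
  (\int[mu]_u ((Num.floor (a * u) == k)%:R : R)%:E = (a^-1)%:E)%E.
Proof.
move=> a0.
have E (u : R) : ((Num.floor (a * u) == k)%:R : R)%:E = (\1_[set` `[k%:~R / a, (k + 1)%:~R / a[] u)%:E.
  rewrite indicE; congr (nat_of_bool _)%:R%:E.
  apply/idP/idP.
    move=> /eqP <-; rewrite inE/= in_itv/= ler_pdivrMr// ltr_pdivlMr// mulrC.
    exact: floor_itv.
  rewrite inE/= in_itv/= ler_pdivrMr// ltr_pdivlMr// mulrC => h.
  by apply/eqP; exact: floor_def.
under eq_integral do rewrite E.
transitivity (mu [set` `[k%:~R / a, (k + 1)%:~R / a[]).
  have := integral_indic (@lebesgue_measure R) measurableT
    (measurable_itv `[k%:~R / a, (k + 1)%:~R / a[).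
  by rewrite setIT.
rewrite lebesgue_measure_itv/= lte_fin ltr_pM2r ?invr_gt0// ltr_int.
rewrite ltrDl ltr01 -EFinB; congr EFin; rewrite intrD; field; rewrite gt_eqF//.
Qed.

(** Along each direction a mass is met on exactly one cell of the grid, an
interval of length 1 / a. *)
Lemma iter_int_point_masses (T : finType) (a : R) (w : T -> R) (x : T -> V) s v :
  0 < a -> uniq s -> i0 \notin s ->
  iter_int i0 (grid a) s (fun y => \sum_(c : T) w c * (x c == y)%:R) v =
  a^-1 ^+ size s * \sum_(c : T) w c * `[< reach a s v (x c) >]%:R.
Proof.
move=> a0; elim: s v => [|j s IH] v /=.
  move=> _ _; rewrite expr0 mul1r; apply: eq_bigr => c _; congr (_ * (nat_of_bool _)%:R).
  apply/idP/idP; first by move/eqP => h; apply/asboolP/reach_nil.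
  by move/asboolP/reach_nil/eqP.
move=> /andP[js us]; rewrite inE negb_or => /andP[ji0 is0].
have {}ji0 : j != i0 by rewrite eq_sym.
pose k c : int := Num.floor (a * (x c 0 j - v 0 j)).
pose m : R := a^-1 ^+ size s.
pose r c : R := `[< reach a (j :: s) v (x c) >]%:R.
have E u : iter_int i0 (grid a) s (fun y => \sum_(c : T) w c * (x c == y)%:R)
    (v + grid a u *: edir R i0 j) =
    \sum_(c : T) (m * w c * r c) * (Num.floor (a * u) == k c)%:R.
  rewrite IH// mulr_sumr; apply: eq_bigr => c _.
  rewrite -!mulrA; congr (_ * (_ * _)); rewrite /r -natrM mulnb; congr (nat_of_bool _)%:R.
  apply/idP/andP.
    move=> /asboolP[h1 h2 h3].
    have hj : x c 0 j - v 0 j = grid a u.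
      have := h1 j js ji0; rewrite coord_shift// => ->; ring.
    split; last first.
      have -> : k c = Num.floor ((Num.floor (a * u))%:~R : R).
        by congr Num.floor; rewrite hj /grid; field; rewrite gt_eqF.
      by rewrite intrKfloor.
    apply/asboolP; split => [i||].
    - rewrite inE negb_or => /andP[ij is' ii]; rewrite h1// !mxE (negPf ij) (negPf ii).
      by rewrite !andbF subrr mulr0 addr0.
    - move=> i; rewrite inE => /predU1P[->|iS].
        by exists (Num.floor (a * u)); rewrite hj.
      have [k' hk] := h2 i iS; exists k'; rewrite -hk !mxE.
      have /negPf -> : i != j by apply: contraNneq js => <-.
      have /negPf -> : i != i0 by apply: contraNneq is0 => <-.
      by rewrite !andbF subrr mulr0 addr0.
    - by rewrite h3 sum_shift.
  move=> [/asboolP[h1 h2 h3] /eqP hk].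
  have hj : x c 0 j - v 0 j = grid a u.
    have [|k' hk'] := h2 j; first by rewrite inE eqxx.
    by rewrite /grid hk /k hk' mulrCA divff ?gt_eqF// mulr1 intrKfloor.
  apply/asboolP; split => [i is' ii|i iS|].
  - have [->|ij] := eqVneq i j; first by rewrite coord_shift// -hj; ring.
    rewrite h1//; last by rewrite inE negb_or ij.
    by rewrite !mxE (negPf ij) (negPf ii) !andbF subrr mulr0 addr0.
  - have [|k' hk'] := h2 i; first by rewrite inE iS orbT.
    exists k'; rewrite -hk' !mxE.
    have /negPf -> : i != j by apply: contraNneq js => <-.
    have /negPf -> : i != i0 by apply: contraNneq is0 => <-.
    by rewrite !andbF subrr mulr0 addr0.
  - by rewrite sum_shift.
have ifl c : mu.-integrable setT (fun u : R => ((Num.floor (a * u) == k c)%:R : R)%:E).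
  apply/integrableP; split.
    apply/measurable_EFinP.
    exact: (measurable_comp_floor a (fun z => (z == k c)%:R)).
  under eq_integral do rewrite gee0_abs ?lee_fin ?ler0n//.
  by rewrite floor_interval// ltry.
rewrite /Rintegral.
have -> : (\int[mu]_u (iter_int i0 (grid a) s (fun y => \sum_(c : T) w c * (x c == y)%:R)
    (v + grid a u *: edir R i0 j))%:E =
  \int[mu]_u \sum_(c : T) (m * w c * r c)%:E * ((Num.floor (a * u) == k c)%:R)%:E)%E.
  apply: eq_integral => u _; rewrite E -sumEFin; apply: eq_bigr => c _.
  by rewrite EFinM.
rewrite integral_sum//; last by move=> c; exact: integrableZl.
have I c : (\int[mu]_u ((m * w c * r c)%:E * ((Num.floor (a * u) == k c)%:R)%:E) =
    (m * w c * r c * a^-1)%:E)%E.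
  by apply: (etrans (integralZl measurableT (ifl c) _)); rewrite floor_interval.
rewrite (eq_bigr (fun c => (m * w c * r c * a^-1)%:E)%E); last by move=> c _; exact: I.
rewrite sumEFin/= exprS mulr_sumr; apply: eq_bigr => c _; rewrite /m /r; ring.
Qed.

End grid_point_masses.

(** * Iterated Gaussian integrals on the zero-sum hyperplane *)

Section gaussian_integral.
Variables (R : realType) (q : nat) (i0 : 'I_q) (A B : R).
Notation mu := (@lebesgue_measure R).
Notation V := 'rV[R]_q.
Notation BV := (borel_rV R q).
Implicit Types (s : seq 'I_q) (v w : V).

(** The form to be integrated is A v_i0^2 + B (sum of the other v_i^2). Its
minimum when k of the other coordinates and i0 have a prescribed total t is
A B / prec k * t^2. *)
Definition prec (k : nat) : R := B + k%:R * A.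

(** The quantity left unchanged when mass moves between i0 and the colours
of s. *)
Definition tot s v : R := v 0 i0 + \sum_(i <- s) v 0 i.

(** The form minimized over the distribution of the total [tot s v] among i0 and
the colours of s; [qform [::]] is the original form. *)
Definition qform s v : R :=
  B * \sum_(i | (i != i0) && (i \notin s)) v 0 i ^+ 2 +
  A * B / prec (size s) * tot s v ^+ 2.

(** The point where the minimum defining [qform s] is attained. *)
Definition cmean s v : V := \row_i
  if i == i0 then B / prec (size s) * tot s v
  else if i \in s then A / prec (size s) * tot s v else v 0 i.

(** The direction in which j fluctuates when the total of j, i0 and s is
prescribed: mass taken from i0 and s in the proportions of [cmean]. *)
Definition gdir s j : V := \row_i
  ((i == j)%:R - (i == i0)%:R * (B / prec (size s))
    - (i \in s)%:R * (A / prec (size s))).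

(** Standard deviation of the fluctuation along [gdir s j], for s of
size k. *)
Definition gdev k : R := Num.sqrt (prec k / (B * prec k.+1)).

Fixpoint gvecs s : seq V :=
  if s is j :: s' then gdev (size s') *: gdir s' j :: gvecs s' else [::].

Fixpoint gmass k : R :=
  if k is k'.+1 then gmass k' * (gdev k' * (normal_peak 1)^-1) else 1.

Definition gexp s (g : V -> R) w : R :=
  fine (\int[gaussian_sum (gvecs s)]_(y in [set: BV]) (g (w + y))%:E).

Lemma tot_shift s v u j : j \notin s -> i0 \notin s -> j != i0 ->
  tot s (v + u *: edir R i0 j) = tot s v - u.
Proof.
move=> js is0 ji; rewrite /tot.
have -> : \sum_(i <- s) (v + u *: edir R i0 j) 0 i = \sum_(i <- s) v 0 i.
  apply: eq_big_seq => i iS; rewrite !mxE.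
  have /negPf -> : i != j by apply: contraNneq js => <-.
  have /negPf -> : i != i0 by apply: contraNneq is0 => <-.
  by rewrite !andbF subrr mulr0 addr0.
rewrite !mxE !eqxx/= eq_sym (negPf ji) /=; ring.
Qed.

Lemma cmean_shift s v u j : j \notin s -> i0 \notin s -> j != i0 -> prec (size s) != 0 ->
  cmean s (v + u *: edir R i0 j) = cmean s v + u *: gdir s j.
Proof.
move=> js is0 ji D0; apply/rowP => i.
rewrite /cmean /gdir !mxE tot_shift//.
have [->|ii0] := eqVneq i i0.
  have /negPf -> : i0 != j by rewrite eq_sym.
  by rewrite (negPf is0) /=; field.
have [iS|iS] := boolP (i \in s).
  have /negPf -> : i != j by apply: contraNneq js => <-.
  by rewrite /=; field.
by rewrite /=; field.
Qed.

Definition gcenter s j v : R := (A * tot s v - prec (size s) * v 0 j) / prec (size s).+1.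

Lemma prec_succ k : prec k.+1 = prec k + A.
Proof. by rewrite /prec -natr1; ring. Qed.

Lemma tot_cons j s v : tot (j :: s) v = tot s v + v 0 j.
Proof. by rewrite /tot big_cons; ring. Qed.

Lemma cmean_cons s v j : j \notin s -> i0 \notin s -> j != i0 ->
  prec (size s) != 0 -> prec (size s).+1 != 0 ->
  cmean s v + gcenter s j v *: gdir s j = cmean (j :: s) v.
Proof.
move=> js is0 ji D0 D1; apply/rowP => i.
rewrite /cmean /gdir /gcenter !mxE tot_cons /= prec_succ inE.
rewrite prec_succ in D1.
have [->|ii0] := eqVneq i i0.
  have /negPf -> : i0 != j by rewrite eq_sym.
  by rewrite (negPf is0) /=; field; rewrite ?D0 ?D1.
have [->|ij] := eqVneq i j.
  by rewrite (negPf js) /=; field; rewrite ?D0 ?D1.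
have [iS|iS] /= := boolP (i \in s); first by field; rewrite ?D0 ?D1.
by ring.
Qed.

(** Completing the square in u. *)
Lemma qform_shift s v u j : j \notin s -> i0 \notin s -> j != i0 ->
  B != 0 -> 0 < prec (size s) -> 0 < prec (size s).+1 ->
  qform s (v + u *: edir R i0 j) = qform (j :: s) v +
   B * prec (size s).+1 / prec (size s) * (u - gcenter s j v) ^+ 2.
Proof.
move=> js is0 ji B0 D0 D1; rewrite /qform tot_shift// tot_cons /gcenter.
rewrite (bigD1 j) ?ji//= coord_shift//.
have -> : \sum_(i | (i != i0) && (i \notin s) && (i != j)) (v + u *: edir R i0 j) 0 i ^+ 2 =
   \sum_(i | (i != i0) && (i \notin j :: s)) v 0 i ^+ 2.
  apply: eq_big => [i|i].
    by rewrite inE negb_or -andbA [(i \notin s) && _]andbC.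
  move=> /andP[/andP[/negPf ii0 _] /negPf ij].
  by rewrite !mxE ii0 ij !andbF subrr mulr0 addr0.
set S := \sum_(_ | _) _; rewrite prec_succ /=.
have D0' : prec (size s) != 0 by rewrite gt_eqF.
have D1' : prec (size s) + A != 0 by rewrite -prec_succ gt_eqF.
by field; rewrite ?D0' ?D1'.
Qed.

Hypothesis B0 : 0 < B.

Lemma gdev_sqr k : 0 < prec k -> 0 < prec k.+1 ->
  0 < gdev k /\ gdev k ^+ 2 = prec k / (B * prec k.+1).
Proof.
move=> D0 D1; have p : 0 < prec k / (B * prec k.+1) by rewrite divr_gt0 ?mulr_gt0.
by rewrite /gdev sqrtr_gt0 sqr_sqrtr ?ltW.
Qed.

Lemma continuous_addl (g : V -> R) w : continuous g -> continuous (fun y => g (w + y)).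
Proof.
move=> cg y P /(cg (w + y)) gP.
have h : (fun y : V => w + y) @ (y : V) --> w + y.
  apply: (@cvgD R V V (nbhs y) _ (cst w) id w y); [exact: cvg_cst|exact: cvg_id].
exact: (h _ gP).
Qed.

Lemma gmass_gt0 k : (forall l, (l <= k)%N -> 0 < prec l) -> 0 < gmass k.
Proof.
elim: k => [//|k IH] Dk /=; rewrite mulr_gt0//.
  by apply: IH => l lk; apply: Dk; exact: leqW.
have [|| h _] := @gdev_sqr k; try exact: Dk.
by rewrite mulr_gt0// invr_gt0 normal_peak_gt0// oner_neq0.
Qed.

Section bounded.
Variables (g : V -> R) (M : R).
Hypotheses (cg : continuous g) (g0 : forall w, 0 <= g w) (gM : forall w, g w <= M).

Lemma measurable_addl w : measurable_fun [set: BV] (fun y : BV => (g (w + y))%:E).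
Proof.
by apply/measurable_EFinP; apply: continuous_measurable_rV; exact: continuous_addl.
Qed.

Lemma gexpE s w : (gexp s g w)%:E = (\int[gaussian_sum (gvecs s)]_y (g (w + y))%:E)%E.
Proof.
rewrite /gexp fineK// ge0_fin_numE; last by apply: integral_ge0 => y _; rewrite lee_fin.
apply: (@le_lt_trans _ _ M%:E); last exact: ltry.
have PT : gaussian_sum (gvecs s) setT = 1%E by exact: probability_setT.
apply: (@le_trans _ _ (\int[gaussian_sum (gvecs s)]_(y in [set: BV]) (cst M%:E) y)%E).
  apply: ge0_le_integral => //.
  - by move=> y _; rewrite lee_fin.
  - exact: measurable_addl.
  - by move=> y _; rewrite lee_fin; exact: gM.
by rewrite integral_cst// [X in (_ * X)%E]PT mule1.
Qed.

Lemma gexp_ge0 s w : 0 <= gexp s g w.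
Proof. by apply: fine_ge0; apply: integral_ge0 => y _; rewrite lee_fin. Qed.

Lemma measurable_gexp_line s w c :
  measurable_fun setT (fun z : measurableTypeR R => (gexp s g (w + (z : R) *: c))%:E).
Proof.
under eq_fun do rewrite gexpE.
pose f (yz : BV * measurableTypeR R) := (g (w + line_shift c yz))%:E.
have mf : measurable_fun setT f.
  by apply: (measurableT_comp (measurable_addl w)); exact: measurable_line_shift.
have := @measurable_fun_fubini_tonelli_G _ _ BV (measurableTypeR R) R (gaussian_sum (gvecs s)) f mf.
move=> h; have {}h := h (fun x => g0 _ : (0 <= f x)%E).
apply: eq_measurable_fun h => z _; rewrite /fubini_G; apply: eq_integral => y _.
by rewrite /f /line_shift /= [y + _]addrC addrA.
Qed.

Lemma gexp_cons s j w : (gexp (j :: s) g w)%:E =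
  (\int[normal_prob 0 1]_z (gexp s g (w + (z * gdev (size s)) *: gdir s j))%:E)%E.
Proof.
rewrite gexpE ge0_integral_gaussian_sum_cons; last 2 first.
- exact: measurable_addl.
- by move=> y; rewrite lee_fin.
apply: eq_integral => z _; rewrite gexpE; apply: eq_integral => y _.
by rewrite scalerA [y + _]addrC addrA.
Qed.

(** Each step completes the square in the new variable; its fluctuation becomes
the new vector of [gvecs], and the remaining weight is [qform] for the longer
list. *)
Lemma iter_int_gaussian s v : uniq s -> i0 \notin s ->
  (forall k, (k <= size s)%N -> 0 < prec k) ->
  iter_int i0 id s (fun y => g y * expR (- (qform [::] y / 2))) v =
  gmass (size s) * expR (- (qform s v / 2)) * gexp s g (cmean s v).
Proof.
elim: s v => [|j s IH] v /=.
  move=> _ _ _; rewrite mul1r mulrC; congr (_ * _).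
  have -> : cmean [::] v = v.
    apply/rowP => i; rewrite /cmean mxE /= /prec mul0r addr0 divff ?(lt0r_neq0 B0)//.
    by rewrite /tot big_nil addr0 mul1r; case: eqP => [->|].
  apply: EFin_inj; rewrite gexpE /= integral_dirac//; last exact: measurable_addl.
  by rewrite diracT mul1e addr0.
move=> /andP[js us]; rewrite inE negb_or => /andP[ji0 is0] Dk.
have {}ji0 : j != i0 by rewrite eq_sym.
have D0 : 0 < prec (size s) by apply: Dk; exact: leqnSn.
have D1 : 0 < prec (size s).+1 by exact: Dk.
have [r0 r2] := gdev_sqr D0 D1; set r := gdev (size s) in r0 r2 *.
set m := gcenter s j v.
pose w0 := cmean s v.
pose Z := gmass (size s); pose Q := expR (- (qform (j :: s) v / 2)).
have Z0 : 0 < Z by apply: gmass_gt0 => l lk; apply: Dk; exact: leqW.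
pose f (u : R) := (Z * Q * expR (- (((u - m) / r) ^+ 2 / 2)) * gexp s g (w0 + u *: gdir s j))%:E.
have mf : measurable_fun setT f.
  apply/measurable_EFinP; apply: measurable_funM; last first.
    by move/measurable_EFinP: (measurable_gexp_line s w0 (gdir s j)).
  apply: measurable_funM => //; apply: measurableT_comp => //; apply: measurableT_comp => //.
  apply: measurable_funM => //; apply: measurable_funX; apply: measurable_funM => //.
  exact: measurable_funB.
have f0 u : (0 <= f u)%E.
  by rewrite lee_fin mulr_ge0 ?gexp_ge0// !mulr_ge0 ?expR_ge0// ltW.
transitivity (fine (\int[mu]_u f u)).
  rewrite /Rintegral; congr fine; apply: eq_integral => u _; congr EFin.
  rewrite IH//; last by move=> k ks; apply: Dk; exact: leqW.
  rewrite (cmean_shift _ _ js is0 ji0 (lt0r_neq0 D0)).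
  rewrite (qform_shift _ _ js is0 ji0 (lt0r_neq0 B0) D0 D1).
  congr (_ * _); rewrite /Q -[RHS]mulrA -expRD; congr (_ * expR _).
  rewrite expr_div_n r2 -/m; field.
  by rewrite !gt_eqF.
have := @ge0_integral_affine R r m f (lt0r_neq0 r0) mf f0.
rewrite gtr0_norm// => E.
have {}E : (\int[mu]_u f u = r%:E * \int[mu]_z f (r * z + m)%R)%E.
  by rewrite E muleA -EFinM mulfV ?mul1e// gt_eqF.
have pk : 0 < @normal_peak R 1 by rewrite normal_peak_gt0// oner_neq0.
have fE z : f (r * z + m) = ((Z * Q * (normal_peak 1)^-1)%:E *
    ((gexp s g (cmean (j :: s) v + (z * r) *: gdir s j))%:E * (normal_pdf 0 1 z)%:E))%E.
  rewrite /f -!EFinM; congr EFin; rewrite addrK (mulrC r) mulfK ?gt_eqF//.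
  rewrite -(cmean_cons v js is0 ji0) ?gt_eqF// -/m -/w0 addrAC -addrA -scalerDl.
  rewrite normal_pdf01E; field; exact: lt0r_neq0.
rewrite E; under eq_integral do rewrite fE.
have mG : measurable_fun setT (fun z : R => (gexp s g (cmean (j :: s) v + (z * r) *: gdir s j))%:E).
  have := measurable_gexp_line s (cmean (j :: s) v) (r *: gdir s j).
  by under eq_fun do rewrite scalerA.
rewrite ge0_integralZl//; last 3 first.
- by apply: emeasurable_funM => //; apply/measurable_EFinP; exact: measurable_normal_pdf.
- by move=> z _; rewrite mule_ge0// lee_fin ?gexp_ge0 ?normal_pdf_ge0.
- by rewrite lee_fin !mulr_ge0 ?expR_ge0 ?invr_ge0// ltW.
rewrite -ge0_integral_normal_prob//; last by move=> z; rewrite lee_fin gexp_ge0.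
rewrite -gexp_cons -!EFinM /= /Z /Q; ring.
Qed.

End bounded.

End gaussian_integral.

(** * The covariance of the limit law *)

Section covariance.
Variables (R : realType) (q : nat) (i0 : 'I_q) (A B : R).
Notation prec := (prec A B).

(** For s = all colours but i0, the covariance of the Gaussian weight
exp (- qform [::] / 2) on the zero-sum vectors. *)
Definition gcov (s : seq 'I_q) (i l : 'I_q) : R :=
  (i \in s)%:R * (l \in s)%:R * ((i == l)%:R / B - A / (B * prec (size s)))
  - ((i == i0)%:R * (l \in s)%:R + (i \in s)%:R * (l == i0)%:R) / prec (size s)
  + (i == i0)%:R * (l == i0)%:R * ((size s)%:R / prec (size s)).

Lemma gvecs_cov s i l : 0 < B -> uniq s -> i0 \notin s ->
  (forall k, (k <= size s)%N -> 0 < prec k) ->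
  \sum_(c <- gvecs i0 A B s) c 0 i * c 0 l = gcov s i l.
Proof.
move=> B0; elim: s => [|j s IH] /=.
  by move=> _ _ _; rewrite big_nil /gcov /= ?mul0r ?mulr0 ?add0r; ring.
move=> /andP[js us]; rewrite inE negb_or => /andP[ji0 is0] Dk.
rewrite big_cons IH//; last by move=> k ks; apply: Dk; exact: leqW.
have D0 : 0 < prec (size s) by apply: Dk; exact: leqnSn.
have D1 : 0 < prec (size s).+1 by exact: Dk.
have [r0 r2] := gdev_sqr B0 D0 D1.
have D0' := lt0r_neq0 D0; have D1' := lt0r_neq0 D1; have B0' := lt0r_neq0 B0.
rewrite [LHS](_ : _ = gdev A B (size s) ^+ 2 * (gdir i0 A B s j 0 i * gdir i0 A B s j 0 l) + gcov s i l); last first.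
  by rewrite !mxE; ring.
rewrite r2 /gcov /gdir !mxE /= !inE; move: D1'; rewrite prec_succ => D1'.
rewrite -natr1.
have sE : (size s)%:R * A = prec (size s) - B by rewrite /prec; ring.
have [->|ii0] := eqVneq i i0.
  rewrite (negPf ji0) (negPf is0) /=.
  have [->|li0] := eqVneq l i0.
    by rewrite (negPf ji0) (negPf is0) /=; field: sE; rewrite ?D0' ?D1' ?B0'.
  have [->|lj] := eqVneq l j; first by rewrite (negPf js) /=; field; rewrite ?D0' ?D1' ?B0'.
  by case: (l \in s) => /=; field; rewrite ?D0' ?D1' ?B0'.
have [->|ij] := eqVneq i j.
  rewrite (negPf js) /=.
  have [->|li0] := eqVneq l i0.
    by rewrite (negPf ji0) (negPf is0) /=; field; rewrite ?D0' ?D1' ?B0'.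
  have [->|lj] := eqVneq l j; first by rewrite (negPf js) /=; field; rewrite ?D0' ?D1' ?B0'.
  by case: (l \in s) => /=; field; rewrite ?D0' ?D1' ?B0'.
have [->|li0] := eqVneq l i0.
  rewrite (negPf ji0) (negPf is0) /=.
  by case: (i \in s) => /=; field; rewrite ?D0' ?D1' ?B0'.
have [->|lj] := eqVneq l j.
  by rewrite (negPf js) (negPf ij) /=; case: (i \in s) => /=; field; rewrite ?D0' ?D1' ?B0'.
by case: (i \in s); case: (l \in s) => /=; field; rewrite ?D0' ?D1' ?B0'.
Qed.

End covariance.

Section covariance_matrix.
Variables (R : realType) (q : nat) (i0 : 'I_q) (beta a b : R) (x : 'rV[R]_q).
Hypotheses (b0 : 0 < b) (ba : b <= a) (a1 : a <= 1).
Hypotheses (xi0 : x 0 i0 = a) (xi : forall i, i != i0 -> x 0 i = b).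
Hypothesis ab1 : a + (q.-1)%:R * b = 1.

Lemma max_coordE : max_coord x = a.
Proof.
apply/le_anti/andP; split.
  apply: (big_ind (fun y => y <= a)) => [|y z ya za|i _].
  - by rewrite (le_trans (ltW b0)).
  - by rewrite ge_max ya.
  - by have [->|ii0] := eqVneq i i0; rewrite ?xi0 ?xi.
by rewrite -xi0 /max_coord (bigD1 i0)//= le_max lexx.
Qed.

Lemma min_coordE (hq : (1 < q)%N) : min_coord x = b.
Proof.
have [j ji0] : exists j : 'I_q, j != i0.
  apply/existsP; rewrite -negb_forall; apply/negP => /forallP h.
  have : (#|'I_q| <= 1)%N by apply/fintype_le1P => y z; rewrite (eqP (h y)) (eqP (h z)).
  by rewrite card_ord leqNgt hq.
apply/le_anti/andP; split.
  by rewrite -(xi ji0) /min_coord (bigD1 j)//= ge_min lexx.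
apply: (big_ind (fun y => b <= y)) => [|y z ya za|i _].
- by rewrite (le_trans ba).
- by rewrite le_min ya.
- by have [->|ii0] := eqVneq i i0; rewrite ?xi0 ?xi.
Qed.

(** As x takes only the values a >= b, the ratios [alpha] are 1 if one of the
two colours is i0 and (1/a - beta) / (1/b - beta) otherwise. *)
Lemma covariance_matrixE (s : seq 'I_q) i l : (1 < q)%N ->
  (forall i, (i \in s) = (i != i0)) -> size s = q.-1 ->
  0 < b^-1 - beta -> 0 < prec (a^-1 - beta) (b^-1 - beta) q.-1 ->
  covariance_matrix beta x i l = gcov i0 (a^-1 - beta) (b^-1 - beta) s i l.
Proof.
move=> hq si ss B0 D0; have a0 : 0 < a by exact: lt_le_trans ba.
have a0' := lt0r_neq0 a0; have b0' := lt0r_neq0 b0; have B0' := lt0r_neq0 B0.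
have D0' := lt0r_neq0 D0.
have qE : q%:R = q.-1%:R + 1 :> R by rewrite natr1 prednK// ltnW.
have DE : (b * a)^-1 - q%:R * beta = prec (a^-1 - beta) (b^-1 - beta) q.-1.
  have m1 : q.-1%:R * b = 1 - a by move: ab1; lra.
  rewrite /prec qE.
  have -> : (b * a)^-1 = (a + q.-1%:R * b) / (b * a) by rewrite ab1 mul1r.
  by field; rewrite a0'.
rewrite /covariance_matrix !mxE max_coordE min_coordE// DE /gcov ss !si.
have alE y z : y != i0 -> z != i0 -> alpha beta x (x 0 y) (x 0 z) = (a^-1 - beta) / (b^-1 - beta).
  move=> yi zi; rewrite /alpha max_coordE !xi// maxxx.
  by case: eqP => // <-; rewrite divff.
have al1 y : alpha beta x (x 0 i0) (x 0 y) = 1.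
  rewrite /alpha max_coordE xi0; have -> : Num.max a (x 0 y) = a.
    by apply/max_idPl; have [->|/xi ->] := eqVneq y i0; rewrite ?xi0.
  by rewrite eqxx.
have al2 y : alpha beta x (x 0 y) (x 0 i0) = 1 by rewrite -(al1 y) /alpha maxC.
have D1' : b^-1 - beta + q.-1%:R * (a^-1 - beta) != 0 by exact: D0'.
have [->|ii0] := eqVneq i i0.
  by have [le|li0] := eqVneq l i0; rewrite ?le /= al1 ?qE; ring.
have [->|li0] := eqVneq l i0; first by rewrite (negPf ii0) /= al2; ring.
by have [->|il] := eqVneq i l; rewrite /= alE// /prec ?qE; move: D1' B0';
  move: (a^-1 - beta) (b^-1 - beta) => A' B' D1' B0'; field; rewrite D1' B0'.
Qed.

End covariance_matrix.

(** * The free energy near a local minimizer *)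

Section entropy.
Variable R : realType.
Implicit Types s t u : R.

(** p * psi ((y - p) / p) is the remainder of the first-order expansion of
t ln t at p (see [psi_scaleE]). *)
Definition psi s : R := (1 + s) * ln (1 + s) - s.

Lemma ln_le s : 0 < s -> ln s <= s - 1.
Proof. by move=> s0; have := @le_ln1Dx R (s - 1); rewrite [1 + _]addrC subrK; apply; lra. Qed.

Lemma ln_lt s : 0 < s -> s != 1 -> ln s < s - 1.
Proof.
move=> s0 s1; have := @expR_gt1Dx R (ln s); rewrite lnK ?posrE//.
move=> h; have : ln s != 0 by rewrite ln_eq0.
by move/h; lra.
Qed.

Lemma psi_le_sqr s : -1 < s -> psi s <= s ^+ 2.
Proof.
move=> s1; have p : 0 < 1 + s by lra.
have := ln_le p; rewrite /psi => h.
have : (1 + s) * ln (1 + s) <= (1 + s) * (1 + s - 1) by rewrite ler_pM2l.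
rewrite expr2; lra.
Qed.

Lemma ln1Dx_near s : -1/2 <= s -> `|ln (1 + s) - s| <= 2 * s ^+ 2.
Proof.
move=> s2; have p : 0 < 1 + s by lra.
have h1 := ln_le p.
have h2 : ln (1 + s)^-1 <= (1 + s)^-1 - 1 by apply: ln_le; rewrite invr_gt0.
rewrite lnV ?posrE// in h2.
have h3 : s - s / (1 + s) <= 2 * s ^+ 2.
  have -> : s - s / (1 + s) = s ^+ 2 / (1 + s) by field; rewrite gt_eqF.
  rewrite ler_pdivrMr//; have := sqr_ge0 s; nra.
have h4 : (1 + s)^-1 - 1 = - (s / (1 + s)) by field; rewrite gt_eqF.
rewrite ler_norml; apply/andP; split; have := sqr_ge0 s; lra.
Qed.

Lemma is_derive_xlnx (x : R) : 0 < x -> is_derive x 1 (fun t => t * ln t) (ln x + 1).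
Proof.
move=> x0; have h := is_derive1_ln x0.
apply: is_derive_eq; rewrite /GRing.scale/= mulr1 divff ?gt_eqF//; ring.
Qed.

(** Mean value theorem for psi s - s^2 / 2, whose derivative ln (1 + s) - s is
of second order. *)
Lemma psi_near s : `|s| <= 1 / 2 -> `|psi s - s ^+ 2 / 2| <= 2 * `|s| ^+ 3.
Proof.
move=> s2.
pose h (t : R) := psi t - t ^+ 2 / 2.
have dh t : -1 < t -> is_derive t 1 h (ln (1 + t) - t).
  move=> t1; have p : 0 < 1 + t by lra.
  have d1 : is_derive t 1 (fun t => (1 + t) * ln (1 + t)) (ln (1 + t) + 1).
    have h1 : is_derive (1 + t) 1 (fun t : R => t * ln t) (ln (1 + t) + 1) by exact: is_derive_xlnx.
    have h2 : is_derive t (1 : R) (cst 1 + id : R -> R) (0 + 1) by exact: is_deriveD.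
    rewrite add0r in h2.
    have := @is_derive1_comp R _ _ t _ _ h1 h2; by rewrite mulr1.
  by rewrite /h /psi; apply: is_derive_eq; rewrite /GRing.scale/=; field.
have h0 : h 0 = 0 by rewrite /h /psi addr0 ln1 mulr0; ring.
have [s0|s0|->] := ltgtP s 0; last by rewrite [psi 0 - _]h0 normr0 expr0n /= mulr0.
- have sb : -1/2 <= s by move: s2; rewrite ler_norml => /andP[]; lra.
  have [| |c] := @MVT R h (fun t => ln (1 + t) - t) s 0 s0.
  + move=> t; rewrite in_itv/= => /andP[t1 t2]; apply: dh; lra.
  + apply: derivable_within_continuous => t; rewrite in_itv/= => /andP[t1 t2].
    by apply: ex_derive; apply: dh; lra.
  rewrite in_itv/= => /andP[c1 c2]; rewrite h0 !sub0r => hc.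
  have -> : psi s - s ^+ 2 / 2 = h s by [].
  rewrite -[h s]opprK hc normrN normrM normrN.
  have hh : `|ln (1 + c) - c| <= 2 * c ^+ 2 by apply: ln1Dx_near; lra.
  rewrite exprSr mulrA ler_wpM2r// (le_trans hh)// ler_wpM2l//.
  by rewrite real_normK ?num_real//; nra.
- have sb : s <= 1/2 by move: s2; rewrite ler_norml => /andP[]; lra.
  have [| |c] := @MVT R h (fun t => ln (1 + t) - t) 0 s s0.
  + move=> t; rewrite in_itv/= => /andP[t1 t2]; apply: dh; lra.
  + apply: derivable_within_continuous => t; rewrite in_itv/= => /andP[t1 t2].
    by apply: ex_derive; apply: dh; lra.
  rewrite in_itv/= => /andP[c1 c2]; rewrite h0 !subr0 => hc.
  have -> : psi s - s ^+ 2 / 2 = h s by [].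
  rewrite hc normrM.
  have hh : `|ln (1 + c) - c| <= 2 * c ^+ 2 by apply: ln1Dx_near; lra.
  rewrite exprSr mulrA ler_wpM2r// (le_trans hh)// ler_wpM2l//.
  by rewrite real_normK ?num_real//; nra.
Qed.

Lemma psi_scaleE (p y : R) : 0 < p -> 0 <= y ->
  p * psi ((y - p) / p) = y * ln y - p * ln p - (y - p) * (ln p + 1).
Proof.
move=> p0 y0; rewrite /psi.
have -> : 1 + (y - p) / p = y / p by field; rewrite gt_eqF.
have [->|yn0] := eqVneq y 0; first by rewrite !(mul0r, sub0r); field; rewrite gt_eqF.
have yp : 0 < y by rewrite lt_neqAle eq_sym yn0.
rewrite ln_div ?posrE//; field; rewrite gt_eqF//.
Qed.

(** Otherwise the linear term would make the right-hand side negative on one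
side of 0. *)
Lemma slope_eq0 (K L r : R) : 0 < r ->
  (forall t, `|t| < r -> 0 <= K * t ^+ 2 + L * t) -> L = 0.
Proof.
move=> r0 h; apply/eqP; rewrite -normr_le0 leNgt; apply/negP => L0.
pose t := Num.min (r / 2) (`|L| / (2 * (`|K| + 1))).
have K0 : 0 < `|K| + 1 by rewrite ltr_wpDl.
have t0 : 0 < t by rewrite lt_min !divr_gt0// mulr_gt0.
have tr : t < r by rewrite gt_min ltr_pdivrMr// mulr_natr mulr2n ltrDl r0.
have tK : `|K| * t < `|L|.
  have : t <= `|L| / (2 * (`|K| + 1)) by rewrite ge_min lexx orbT.
  rewrite ler_pdivlMr ?mulr_gt0// => ht.
  have := normr_ge0 K; nra.
have tK2 : `|K| * t * t < `|L| * t by rewrite ltr_pM2r.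
have KK : - (`|K| * t * t) <= K * t * t <= `|K| * t * t.
  by rewrite -ler_norml !normrM (gtr0_norm t0).
have [L1|L1] := leP 0 L.
  have := h (- t); rewrite normrN gtr0_norm// => /(_ tr).
  by rewrite (ger0_norm L1) in tK2; rewrite !expr2; lra.
have := h t; rewrite gtr0_norm// => /(_ tr).
by rewrite (ltr0_norm L1) in tK2; rewrite !expr2; lra.
Qed.

(** For small t a cubic term cannot compensate a negative quadratic one. *)
Lemma curvature_ge0 (K L r : R) : 0 < r -> 0 <= L ->
  (forall t, 0 < t -> t < r -> 0 <= K * t ^+ 2 + L * t ^+ 3) -> 0 <= K.
Proof.
move=> r0 L0 h; rewrite leNgt; apply/negP => K0.
pose t := Num.min (r / 2) (- K / (2 * (L + 1))).
have L1 : 0 < L + 1 by rewrite ltr_wpDl.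
have t0 : 0 < t by rewrite lt_min !divr_gt0// ?mulr_gt0// oppr_gt0.
have tr : t < r by rewrite gt_min ltr_pdivrMr// mulr_natr mulr2n ltrDl r0.
have tK : L * t < - K.
  have : t <= - K / (2 * (L + 1)) by rewrite ge_min lexx orbT.
  rewrite ler_pdivlMr ?mulr_gt0// => ht; nra.
have := h t t0 tr; rewrite (_ : K * t ^+ 2 + L * t ^+ 3 = t ^+ 2 * (K + L * t)); last by ring.
by rewrite pmulr_rge0 ?exprn_gt0//; lra.
Qed.

End entropy.

Section free_energy_expansion.
Variables (R : realType) (q : nat).
Notation V := 'rV[R]_q.
Implicit Types (beta h : R) (p x y : V) (i j : 'I_q).

Definition field h i : R := h * (i == 0%N :> nat)%:R.

(** Up to the constant 1, the derivative of [energy1]; at an interior critical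
point of the free energy on the simplex it is the same for all colours. *)
Definition chem beta h i (t : R) : R := ln t - beta * t - field h i.

Definition energy1 beta h i (t : R) : R := t * ln t - beta / 2 * t ^+ 2 - field h i * t.

Lemma free_energyE beta h x : free_energy beta h x = \sum_i energy1 beta h i (x 0 i).
Proof.
rewrite /free_energy /energy1 !sumrB -mulr_sumr; congr (_ - _).
rewrite mulr_sumr [RHS](bigID (fun i : 'I_q => i == 0%N :> nat))/= [X in _ + X]big1 ?addr0.
  by apply: eq_bigr => i i0; rewrite /field i0 mulr1.
by move=> i /negPf i0; rewrite /field i0 mulr0 mul0r.
Qed.

Lemma energy1B beta h i (p y : R) : 0 < p -> 0 <= y ->
  energy1 beta h i y - energy1 beta h i p =
  p * psi ((y - p) / p) - beta / 2 * (y - p) ^+ 2 + (y - p) * (chem beta h i p + 1).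
Proof. by move=> p0 y0; rewrite psi_scaleE// /energy1 /chem; field. Qed.

(** The first-order terms add up to a multiple of the sum of y - p. *)
Lemma free_energyB beta h p y c : (forall i, 0 < p 0 i) -> (forall i, 0 <= y 0 i) ->
  \sum_i y 0 i = \sum_i p 0 i -> (forall i, chem beta h i (p 0 i) = c) ->
  free_energy beta h y - free_energy beta h p =
  \sum_i (p 0 i * psi ((y 0 i - p 0 i) / p 0 i) - beta / 2 * (y 0 i - p 0 i) ^+ 2).
Proof.
move=> p0 y0 yp hc; rewrite !free_energyE -sumrB.
under eq_bigr => i _ do rewrite energy1B// hc.
have S : \sum_i (y 0 i - p 0 i) = 0 by rewrite sumrB yp subrr.
by rewrite big_split/= -mulr_suml S mul0r addr0.
Qed.

Lemma coord_move x (t : R) i j k : i != j ->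
  (x + t *: edir R j i) 0 k = x 0 k + t * (k == i)%:R - t * (k == j)%:R.
Proof. by move=> ij; rewrite !mxE /=; ring. Qed.

Lemma free_energy_move beta h x (t : R) i j : i != j ->
  free_energy beta h (x + t *: edir R j i) - free_energy beta h x =
  energy1 beta h i (x 0 i + t) - energy1 beta h i (x 0 i) +
  (energy1 beta h j (x 0 j - t) - energy1 beta h j (x 0 j)).
Proof.
move=> ij; rewrite !free_energyE -sumrB (bigD1 i)//= (bigD1 j) 1?eq_sym//=.
rewrite !coord_move// !eqxx [j == i]eq_sym (negPf ij) /= big1.
  by rewrite !(mulr1, mulr0, subr0, addr0).
move=> k /andP[/negPf ki /negPf kj]; rewrite coord_move// ki kj /=.
by rewrite !mulr0 addr0 subr0 subrr.
Qed.

Lemma simplex_move x (t : R) i j : i != j -> simplex x ->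
  0 <= x 0 i + t -> 0 <= x 0 j - t -> simplex (x + t *: edir R j i).
Proof.
move=> ij [x1 x0] h1 h2; split; first by rewrite sum_shift.
move=> k; rewrite coord_move//.
have [->|ki] := eqVneq k i; first by rewrite (negPf ij) mulr0 subr0 mulr1.
have [->|kj] := eqVneq k j; first by rewrite mulr0 addr0 mulr1.
by rewrite !mulr0 addr0 subr0.
Qed.

Lemma enorm_move x (t : R) i j : i != j ->
  enorm (x + t *: edir R j i - x) <= 2 * `|t|.
Proof.
move=> ij; rewrite addrC addKr /enorm.
have -> : \sum_k (t *: edir R j i) 0 k ^+ 2 = 2 * t ^+ 2.
  rewrite (bigD1 i)//= (bigD1 j) 1?eq_sym//= big1.
    by rewrite !mxE !eqxx [j == i]eq_sym (negPf ij) /=; ring.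
  by move=> k /andP[/negPf ki /negPf kj]; rewrite !mxE ki kj /= subrr mulr0 expr0n.
rewrite -(ler_pXn2r (n := 2))// ?nnegrE ?mulr_ge0//.
have t2 : 0 <= 2 * t ^+ 2 by rewrite mulr_ge0// sqr_ge0.
rewrite (sqr_sqrtr t2) exprMn real_normK ?num_real//.
have := sqr_ge0 t; lra.
Qed.

(** Minimality tested on transfers of mass between two colours only, for which
the free energy changes in two terms. *)
Lemma local_min_move beta h p : local_minimizer beta h p -> exists2 r : R, 0 < r &
  forall (t : R) i j, i != j -> 0 <= p 0 i + t -> 0 <= p 0 j - t -> `|t| < r ->
  0 <= energy1 beta h i (p 0 i + t) - energy1 beta h i (p 0 i) +
  (energy1 beta h j (p 0 j - t) - energy1 beta h j (p 0 j)).
Proof.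
move=> [sp [r r0 hr]]; exists (r / 2); first by rewrite divr_gt0.
move=> t i j ij h1 h2 tr; rewrite -free_energy_move// subr_ge0; apply: hr.
  exact: simplex_move.
by rewrite /eball/= (le_lt_trans (enorm_move _ _ ij))// mulrC -ltr_pdivlMr.
Qed.

(** First-order condition for the transfer of mass between i and j. *)
Lemma local_min_chem beta h p i j : local_minimizer beta h p ->
  (forall i, 0 < p 0 i) -> chem beta h i (p 0 i) = chem beta h j (p 0 j).
Proof.
move=> lp p0; have [->//|ij] := eqVneq i j.
have [r r0 hr] := local_min_move lp.
pose K := (p 0 i)^-1 + (p 0 j)^-1 + `|beta|.
apply/eqP; rewrite -subr_eq0; apply/eqP.
pose r' := Num.min r (Num.min (p 0 i) (p 0 j)).
apply: (@slope_eq0 _ K _ r'); first by rewrite !lt_min r0 !p0.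
move=> t; rewrite !lt_min => /and3P[tr ti tj].
have {ti}/andP[ti1 ti2] : - p 0 i < t < p 0 i by rewrite -ltr_norml.
have {tj}/andP[tj1 tj2] : - p 0 j < t < p 0 j by rewrite -ltr_norml.
have := hr t i j ij; rewrite !energy1B//; last 2 first.
- lra.
- lra.
have -> : p 0 i + t - p 0 i = t by ring.
have -> : p 0 j - t - p 0 j = - t by ring.
have ii : p 0 i * psi (t / p 0 i) <= t ^+ 2 / p 0 i.
  have -> : t ^+ 2 / p 0 i = p 0 i * (t / p 0 i) ^+ 2 by field; rewrite gt_eqF.
  by rewrite ler_pM2l// psi_le_sqr// ltr_pdivlMr// mulN1r.
have jj : p 0 j * psi (- t / p 0 j) <= t ^+ 2 / p 0 j.
  have -> : t ^+ 2 / p 0 j = p 0 j * (- t / p 0 j) ^+ 2 by field; rewrite gt_eqF.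
  by rewrite ler_pM2l// psi_le_sqr// ltr_pdivlMr// mulN1r; lra.
have bb : - beta * t ^+ 2 <= `|beta| * t ^+ 2.
  by rewrite ler_wpM2r ?sqr_ge0// -normrN ler_norm.
rewrite /K; move=> /(_ _ _ tr) H.
have {}H := H (ltW (_ : 0 < p 0 i + t)) (ltW (_ : 0 < p 0 j - t)).
have {}H : 0 <= p 0 i * psi (t / p 0 i) - beta / 2 * t ^+ 2 + t * (chem beta h i (p 0 i) + 1) +
  (p 0 j * psi (- t / p 0 j) - beta / 2 * (- t) ^+ 2 + - t * (chem beta h j (p 0 j) + 1)).
  by apply: H; lra.
rewrite sqrrN in H; lra.
Qed.

(** Second-order condition for the transfer of mass between i and j. *)
Lemma local_min_curvature beta h p i j : local_minimizer beta h p ->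
  (forall i, 0 < p 0 i) -> i != j -> 2 * beta <= (p 0 i)^-1 + (p 0 j)^-1.
Proof.
move=> lp p0 ij; have [r r0 hr] := local_min_move lp.
have hc := local_min_chem i j lp p0.
rewrite -subr_ge0 -(pmulr_rge0 _ (_ : 0 < 2^-1 :> R))//.
pose r' := Num.min r (Num.min (p 0 i / 2) (p 0 j / 2)).
pose L := 2 * (p 0 i)^-1 ^+ 2 + 2 * (p 0 j)^-1 ^+ 2.
apply: (@curvature_ge0 _ _ L r'); first by rewrite !lt_min r0 !divr_gt0.
  by rewrite /L addr_ge0// mulr_ge0// sqr_ge0.
move=> t t0; rewrite !lt_min => /and3P[tr ti tj].
have hp k (u : R) : `|u| = t -> t < p 0 k / 2 ->
    p 0 k * psi (u / p 0 k) <= t ^+ 2 / p 0 k / 2 + 2 * (p 0 k)^-1 ^+ 2 * t ^+ 3.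
  move=> ut tk; have := @psi_near R (u / p 0 k).
  rewrite normrM ut normrV ?unitfE ?gt_eqF// gtr0_norm// => H.
  have {}H := H (_ : t / p 0 k <= 1 / 2).
  have {}H : `|psi (u / p 0 k) - (u / p 0 k) ^+ 2 / 2| <= 2 * (t / p 0 k) ^+ 3.
    by apply: H; rewrite ler_pdivrMr//; lra.
  move: H => /ler_normlP[_ H].
  have {}H : p 0 k * (psi (u / p 0 k) - (u / p 0 k) ^+ 2 / 2) <= p 0 k * (2 * (t / p 0 k) ^+ 3).
    by rewrite ler_pM2l.
  have u2 : u ^+ 2 = t ^+ 2 by rewrite -ut real_normK ?num_real.
  have E1 : p 0 k * ((u / p 0 k) ^+ 2 / 2) = t ^+ 2 / p 0 k / 2.
    by rewrite expr_div_n u2; field; rewrite gt_eqF.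
  have E2 : p 0 k * (2 * (t / p 0 k) ^+ 3) = 2 * (p 0 k)^-1 ^+ 2 * t ^+ 3.
    by field; rewrite gt_eqF.
  by rewrite mulrBr E1 E2 in H; lra.
have := hr t i j ij; rewrite !energy1B//; last 2 first.
- by have := p0 j; lra.
- by have := p0 i; lra.
have -> : p 0 i + t - p 0 i = t by ring.
have -> : p 0 j - t - p 0 j = - t by ring.
have h1 := hp i t (gtr0_norm t0) ti.
have h2 := hp j (- t); rewrite normrN in h2; have {}h2 := h2 (gtr0_norm t0) tj.
have pi := p0 i; have pj := p0 j.
have a1 : 0 <= p 0 i + t by lra.
have a2 : 0 <= p 0 j - t by lra.
move=> /(_ a1 a2); rewrite gtr0_norm// => /(_ tr); rewrite hc sqrrN /L; lra.
Qed.

Lemma global_min_local beta h x : global_minimizer beta h x -> local_minimizer beta h x.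
Proof. by move=> [sx gx]; split => //; exists 1 => // y sy _; exact: gx. Qed.

(** The slope of t ln t at 0 is minus infinity: giving a little mass to an empty
colour would lower the free energy. *)
Lemma global_min_gt0 beta h x i : global_minimizer beta h x -> 0 < x 0 i.
Proof.
move=> gx; have [[x1 x0] _] := gx.
rewrite lt_neqAle x0 andbT eq_sym; apply/negP => /eqP xi0.
have [j xj0] : exists j, 0 < x 0 j.
  apply: contrapT => /forallNP xx.
  move: x1; rewrite big1; first by move/eqP; rewrite eq_sym oner_eq0.
  by move=> k _; apply/le_anti; rewrite x0 andbT leNgt; apply/negP/xx.
have ij : i != j by apply: contraTneq xj0 => <-; rewrite xi0 ltxx.
(* Moving t from j to i changes the free energy by t ln t + O(t); K bounds the
   second term divided by t, with room to spare. *)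
pose c := `|chem beta h j (x 0 j)|; pose K := c + `|beta| + `|field h i| + 3.
pose t := Num.min (Num.min 1 (x 0 j / 2)) (expR (- K)).
have t0 : 0 < t by rewrite !lt_min ltr01 divr_gt0// expR_gt0.
have t1 : t <= 1 by rewrite !ge_min lexx.
have tj : t <= x 0 j / 2 by rewrite !ge_min lexx orbT.
have tK : t <= expR (- K) by rewrite !ge_min lexx !orbT.
have lt : ln t <= - K by rewrite -[leRHS]expRK ler_ln ?posrE ?expR_gt0.
have sy : simplex (x + t *: edir R j i).
  apply: (simplex_move ij gx.1); first by rewrite addr_ge0// ltW.
  lra.
have := gx.2 _ sy; rewrite -subr_ge0 free_energy_move// xi0 add0r.
rewrite [energy1 beta h i 0]/energy1 mul0r expr0n mulr0 mulr0 !subr0.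
rewrite energy1B//; last lra.
have -> : x 0 j - t - x 0 j = - t by ring.
have jj : x 0 j * psi (- t / x 0 j) <= t.
  apply: (@le_trans _ _ (x 0 j * (- t / x 0 j) ^+ 2)).
    by rewrite ler_pM2l// psi_le_sqr// ltr_pdivlMr// mulN1r; lra.
  rewrite expr_div_n sqrrN.
  have -> : x 0 j * (t ^+ 2 / x 0 j ^+ 2) = t * (t / x 0 j) by field; rewrite gt_eqF.
  by rewrite ler_piMr// ?ltW// ltr_pdivrMr//; lra.
rewrite /energy1 sqrrN.
have l1 : t * ln t <= t * - K by rewrite ler_pM2l.
have l2 : - t * chem beta h j (x 0 j) <= t * c.
  by rewrite mulNr -mulrN ler_pM2l// -[c]normrN ler_norm.
have l3 : - beta * t ^+ 2 <= t * `|beta|.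
  apply: (@le_trans _ _ (`|beta| * t ^+ 2)).
    by rewrite ler_wpM2r ?sqr_ge0// -normrN ler_norm.
  rewrite mulrC ler_wpM2r// expr2; nra.
have l4 : - field h i * t <= t * `|field h i|.
  by rewrite mulrC ler_pM2l// -normrN ler_norm.
rewrite /K in l1; nra.
Qed.

End free_energy_expansion.

(** * The free energy along vectors with two distinct coordinates *)

Section one_parameter_family.
Variables (R : realType) (m beta h : R).
Hypothesis m0 : 0 < m.
Implicit Types s t : R.

(** The difference of the two values of [chem] on the vectors described at
[branch]; up to a factor m / (m + 1), the derivative of [branch]. *)
Definition gap s : R := ln (1 + m * s) - ln (1 - s) - beta * s - h.

(** The free energy of the vector with one coordinate (1 + m s) / (m + 1) and m
coordinates (1 - s) / (m + 1), whose difference is s. *)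
Definition branch s : R :=
  (1 + m * s) / (m + 1) * ln ((1 + m * s) / (m + 1)) +
  m * ((1 - s) / (m + 1) * ln ((1 - s) / (m + 1)))
  - beta / 2 * (((1 + m * s) / (m + 1)) ^+ 2 + m * ((1 - s) / (m + 1)) ^+ 2)
  - h * ((1 + m * s) / (m + 1)).

(** (m + 1)^2 times the product of the two distinct coordinates; the derivative
of [gap] is (m + 1) / disc - beta. *)
Definition disc s : R := (1 + m * s) * (1 - s).

Lemma is_derive_affine (a b t : R) : is_derive t 1 (fun s : R => a + b * s) b.
Proof.
have h1 : is_derive t (1 : R) (cst a + b *: (id : R -> R) : R -> R) (0 + b *: 1) by exact: is_deriveD.
by rewrite add0r /GRing.scale/= mulr1 in h1.
Qed.

Lemma is_derive_gap s : 0 <= s -> s < 1 -> is_derive s 1 gap ((m + 1) / disc s - beta).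
Proof.
move=> s0 s1; have p1 : 0 < 1 + m * s by rewrite ltr_wpDr// mulr_ge0// ltW.
have p2 : 0 < 1 - s by lra.
have d1 : is_derive s 1 (fun s : R => ln (1 + m * s)) ((1 + m * s)^-1 * m).
  exact: (@is_derive1_comp R (@ln R) (fun s : R => 1 + m * s) s _ _ (is_derive1_ln p1) (is_derive_affine 1 m s)).
have d2 : is_derive s 1 (fun s : R => ln (1 - s)) ((1 - s)^-1 * -1).
  have p2' : 0 < 1 + -1 * s by rewrite mulN1r.
  have := @is_derive1_comp R (@ln R) (fun s : R => 1 + -1 * s) s _ _ (is_derive1_ln p2') (is_derive_affine 1 (-1) s).
  rewrite mulN1r; congr (is_derive _ _ _ _); apply/funext => t /=.
  by rewrite mulN1r.
have d3 := is_derive_affine (- h) (- beta) s.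
have d := is_deriveD (is_deriveB d1 d2) d3.
rewrite (_ : gap = (fun s => ln (1 + m * s)) - (fun s => ln (1 - s)) + (fun s => - h + - beta * s)); last first.
  by apply/funext => t; rewrite /gap !fctE; ring.
have -> : (m + 1) / disc s - beta = (1 + m * s)^-1 * m - (1 - s)^-1 * -1 - beta.
  rewrite /disc; field; rewrite ?(gt_eqF p1) ?(gt_eqF p2)//.
exact: d.
Qed.

Lemma is_derive_branch s : 0 <= s -> s < 1 -> is_derive s 1 branch (m / (m + 1) * gap s).
Proof.
move=> s0 s1; have p1 : 0 < 1 + m * s by rewrite ltr_wpDr// mulr_ge0// ltW.
have p2 : 0 < 1 - s by lra.
have p3 : 0 < m + 1 by rewrite addr_gt0.
pose f1 (s : R) := (m + 1)^-1 + m / (m + 1) * s.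
pose f2 (s : R) := (m + 1)^-1 + - (m + 1)^-1 * s.
have q1 t : (1 + m * t) / (m + 1) = f1 t by rewrite /f1; field; rewrite gt_eqF.
have q2 t : (1 - t) / (m + 1) = f2 t by rewrite /f2; field; rewrite gt_eqF.
have a1 : 0 < f1 s by rewrite -q1 divr_gt0.
have a2 : 0 < f2 s by rewrite -q2 divr_gt0.
have e1 := is_derive_affine (m + 1)^-1 (m / (m + 1)) s.
have e2 := is_derive_affine (m + 1)^-1 (- (m + 1)^-1) s.
rewrite -/f1 in e1; rewrite -/f2 in e2.
have d1 : is_derive s 1 (fun s => f1 s * ln (f1 s)) ((ln (f1 s) + 1) * (m / (m + 1))).
  exact: (@is_derive1_comp R (fun t : R => t * ln t) f1 s _ _ (is_derive_xlnx a1) e1).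
have d2 : is_derive s 1 (fun s => f2 s * ln (f2 s)) ((ln (f2 s) + 1) * - (m + 1)^-1).
  exact: (@is_derive1_comp R (fun t : R => t * ln t) f2 s _ _ (is_derive_xlnx a2) e2).
have d3 := is_deriveM e1 e1; have d4 := is_deriveM e2 e2.
have d := is_deriveB (is_deriveB (is_deriveD d1 (is_deriveZ m d2))
   (is_deriveZ (beta / 2) (is_deriveD d3 (is_deriveZ m d4)))) (is_deriveZ h e1).
have -> : branch = (fun s => f1 s * ln (f1 s)) + m *: (fun s => f2 s * ln (f2 s))
   - (beta / 2) *: (f1 * f1 + m *: (f2 * f2)) - h *: f1.
  by apply/funext => t; rewrite /branch q1 q2 !fctE /GRing.scale/= !expr2.
apply: (@is_derive_eq _ _ _ _ _ _ _ _ d).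
rewrite /GRing.scale/= /gap.
have l1 : ln (f1 s) = ln (1 + m * s) - ln (m + 1) by rewrite -q1 ln_div ?posrE.
have l2 : ln (f2 s) = ln (1 - s) - ln (m + 1) by rewrite -q2 ln_div ?posrE.
by rewrite l1 l2 /f1 /f2; field; rewrite gt_eqF.
Qed.

Lemma disc_gt0 s : 0 <= s -> s < 1 -> 0 < disc s.
Proof.
move=> s0 s1; rewrite /disc mulr_gt0 ?subr_gt0//.
by rewrite ltr_wpDr// mulr_ge0// ltW.
Qed.

Lemma gap_mvt a b : 0 <= a -> a < b -> b < 1 -> exists2 c, a < c < b &
  gap b - gap a = ((m + 1) / disc c - beta) * (b - a).
Proof.
move=> a0 ab b1.
have [||c] := @MVT R gap (fun s => (m + 1) / disc s - beta) a b ab.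
- move=> t; rewrite in_itv/= => /andP[t1 t2]; apply: is_derive_gap; lra.
- apply: derivable_within_continuous => t; rewrite in_itv/= => /andP[t1 t2].
  by apply: ex_derive; apply: is_derive_gap; lra.
by rewrite in_itv/= => hc ->; exists c.
Qed.

Lemma branch_mvt a b : 0 <= a -> a < b -> b < 1 -> exists2 c, a < c < b &
  branch b - branch a = m / (m + 1) * gap c * (b - a).
Proof.
move=> a0 ab b1.
have [||c] := @MVT R branch (fun s => m / (m + 1) * gap s) a b ab.
- move=> t; rewrite in_itv/= => /andP[t1 t2]; apply: is_derive_branch; lra.
- apply: derivable_within_continuous => t; rewrite in_itv/= => /andP[t1 t2].
  by apply: ex_derive; apply: is_derive_branch; lra.
by rewrite in_itv/= => hc ->; exists c.
Qed.

(** [disc] is a strictly concave quadratic function. *)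
Lemma disc_concave a t b : 0 <= a -> a < 1 -> a < t -> t < b -> (m + 1) <= beta * disc a ->
  (m + 1) <= beta * disc b -> m + 1 < beta * disc t.
Proof.
move=> a0 a1 at_ tb ha hb; have ab : 0 < b - a by lra.
have E : (b - a) * disc t = (b - t) * disc a + (t - a) * disc b + m * ((t - a) * (b - t) * (b - a)).
  by rewrite /disc; ring.
have be0 : 0 < beta.
  rewrite -(pmulr_lgt0 _ (disc_gt0 a0 a1)); apply: lt_le_trans ha.
  by rewrite addr_gt0.
rewrite -(ltr_pM2l ab).
have -> : (b - a) * (beta * disc t) = (b - t) * (beta * disc a) + (t - a) * (beta * disc b)
   + beta * (m * ((t - a) * (b - t) * (b - a))).
  by rewrite mulrCA E; ring.
have h1 : (b - t) * (m + 1) <= (b - t) * (beta * disc a) by rewrite ler_pM2l//; lra.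
have h2 : (t - a) * (m + 1) <= (t - a) * (beta * disc b) by rewrite ler_pM2l//; lra.
have h3 : 0 < beta * (m * ((t - a) * (b - t) * (b - a))).
  by rewrite !mulr_gt0// subr_gt0.
lra.
Qed.

(** If beta * disc s1 >= m + 1, Rolle's theorem for [gap] gives a point c between
s1 and s2 with beta * disc c = m + 1. By strict concavity the derivative of
[gap] is negative between s1 and c, so that [branch] decreases from s1
to c. *)
Lemma branch_nondegenerate s1 s2 : 0 <= s1 -> s1 < 1 -> 0 <= s2 -> s2 < 1 ->
  s1 != s2 -> gap s1 = 0 -> gap s2 = 0 ->
  (forall s, 0 <= s -> s < 1 -> branch s1 <= branch s) -> beta * disc s1 < m + 1.
Proof.
move=> s10 s11 s20 s21 s12 g1 g2 bmin; rewrite ltNge; apply/negP => hd.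
have m1 : 0 < m / (m + 1) by rewrite divr_gt0 ?addr_gt0.
have neg t : 0 <= t -> t < 1 -> m + 1 < beta * disc t -> (m + 1) / disc t - beta < 0.
  by move=> t0 t1 ht; rewrite subr_lt0 ltr_pdivrMr ?disc_gt0.
have root a b : 0 <= a -> a < b -> b < 1 -> gap a = 0 -> gap b = 0 ->
    exists2 c, a < c < b & m + 1 <= beta * disc c.
  move=> a0 ab b1 ga gb; have [c /andP[c1 c2]] := gap_mvt a0 ab b1.
  rewrite ga gb subrr => /esym/eqP; rewrite mulf_eq0 [b - a == 0]subr_eq0 (gt_eqF ab) orbF.
  rewrite subr_eq0 => /eqP <-; exists c; first by rewrite c1.
  by rewrite divfK// gt_eqF// disc_gt0//; lra.
have [l12|l12|e12] := ltgtP s1 s2; last by rewrite e12 eqxx in s12.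
- have [c /andP[c1 c2] hc] := root s1 s2 s10 l12 s21 g1 g2.
  have [|t /andP[t1 t2] ht] := branch_mvt s10 c1; first lra.
  have gt : gap t < 0.
    have [|u /andP[u1 u2] hu] := gap_mvt s10 t1; first lra.
    rewrite g1 subr0 in hu; rewrite hu pmulr_llt0 ?subr_gt0//; apply: neg; try lra.
    by apply: (disc_concave s10 s11 u1 _ hd hc); lra.
  have : branch s1 <= branch c by apply: bmin; lra.
  rewrite -subr_ge0 ht.
  have -> : (0 <= m / (m + 1) * gap t * (c - s1)) = false.
    by apply/negbTE; rewrite -ltNge pmulr_llt0 ?subr_gt0// pmulr_rlt0.
  by [].
- have [c /andP[c1 c2] hc] := root s2 s1 s20 l12 s11 g2 g1.
  have c0 : 0 <= c by lra.
  have [t /andP[t1 t2] ht] := branch_mvt c0 c2 s11.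
  have gt : 0 < gap t.
    have t0 : 0 <= t by lra.
    have [u /andP[u1 u2] hu] := gap_mvt t0 t2 s11.
    rewrite g1 sub0r in hu; rewrite -oppr_lt0 hu pmulr_llt0 ?subr_gt0//; apply: neg; try lra.
    by apply: (disc_concave c0 _ _ u2 hc hd); lra.
  have : branch s1 <= branch c by apply: bmin; lra.
  rewrite -subr_le0 ht.
  have -> : (m / (m + 1) * gap t * (s1 - c) <= 0) = false.
    by apply/negbTE; rewrite -ltNge; apply: mulr_gt0; rewrite ?subr_gt0//; apply: mulr_gt0.
  by [].
Qed.

End one_parameter_family.

(** * Global minimizers are nondegenerate *)

Section shape.
Variables (R : realType) (q : nat).
Notation V := 'rV[R]_q.
Implicit Types (beta h : R) (x y : V) (i j : 'I_q).

(** Otherwise exchanging the two colours would lower the free energy. *)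
Lemma global_min_field_max beta h x i j : 0 < h -> global_minimizer beta h x ->
  i = 0%N :> nat -> x 0 j <= x 0 i.
Proof.
move=> h0 gx i0; have [->//|ji] := eqVneq j i; have ij : i != j by rewrite eq_sym.
have sx := gx.1; have x0 := sx.2.
have e1 : x 0 i + (x 0 j - x 0 i) = x 0 j by ring.
have e2 : x 0 j - (x 0 j - x 0 i) = x 0 i by ring.
have sy : simplex (x + (x 0 j - x 0 i) *: edir R j i).
  by apply: simplex_move; rewrite ?e1 ?e2.
have := gx.2 _ sy; rewrite -subr_ge0 free_energy_move// e1 e2 /energy1.
have -> : field h i = h by rewrite /field i0 mulr1.
have -> : field h j = 0.
  rewrite /field; have /negPf -> : (j : nat) != 0%N by apply: contra ji => /eqP j0; apply/eqP/val_inj; rewrite /= j0 i0.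
  by rewrite mulr0.
move=> H; have {}H : 0 <= h * (x 0 i - x 0 j) by lra.
by move: H; rewrite pmulr_rge0// subr_ge0.
Qed.

(** ln t - beta t increases as long as beta t <= 1. *)
Lemma chem_inj beta (u v : R) : 0 < u -> 0 < v -> beta * u <= 1 -> beta * v <= 1 ->
  ln u - beta * u = ln v - beta * v -> u = v.
Proof.
have lt (y z : R) : 0 < y -> 0 < z -> beta * z <= 1 -> y < z -> ln y - beta * y < ln z - beta * z.
  move=> y0 z0 bz yz.
  have := @ln_lt R (y / z); rewrite divr_gt0// ln_div ?posrE// => H.
  have {}H : ln y - ln z < y / z - 1.
    by apply: H => //; rewrite lt_eqF// ltr_pdivrMr// mul1r.
  have : (z - y) * (z^-1 - beta) >= 0.
    apply: mulr_ge0; rewrite subr_ge0; first exact: ltW.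
    by rewrite -(ler_pM2r z0) mulVf ?lt0r_neq0.
  have -> : (z - y) * (z^-1 - beta) = 1 - y / z - beta * z + beta * y.
    by field; rewrite gt_eqF.
  lra.
move=> u0 v0 bu bv e; have [uv|vu|//] := ltgtP u v.
- by have := lt _ _ u0 v0 bv uv; rewrite e ltxx.
- by have := lt _ _ v0 u0 bu vu; rewrite e ltxx.
Qed.

Lemma chem_decreasing beta (u v : R) : 0 < u -> u < v -> 1 <= beta * u ->
  ln v - beta * v < ln u - beta * u.
Proof.
move=> u0 uv bu; have v0 : 0 < v by exact: lt_trans uv.
have := @ln_lt R (v / u); rewrite divr_gt0// ln_div ?posrE// => H.
have {}H : ln v - ln u < v / u - 1.
  by apply: H => //; rewrite gt_eqF// ltr_pdivlMr// mul1r.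
have : (v - u) * (beta - u^-1) >= 0.
  apply: mulr_ge0; rewrite subr_ge0; first exact: ltW.
  by rewrite -(ler_pM2r u0) mulVf ?lt0r_neq0.
have -> : (v - u) * (beta - u^-1) = 1 - v / u + beta * v - beta * u.
  by field; rewrite gt_eqF.
lra.
Qed.

(** The equation ln t - beta t = const has at most one solution with
beta t <= 1. A colour other than the largest one cannot exceed 1 / beta: if it
equals the largest one this contradicts the second-order condition, and if it is
smaller, the monotonicity of ln t - beta t beyond 1 / beta. *)
Lemma global_min_shape beta h x : (1 < q)%N -> 0 <= h -> global_minimizer beta h x ->
  exists (i0 : 'I_q) (b : R),
  [/\ field h i0 = h, forall i, i != i0 -> field h i = 0,
      0 < h -> i0 = 0%N :> nat,
      forall i, i != i0 -> x 0 i = b & [/\ 0 < b, b <= x 0 i0, beta * b <= 1 &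
      ln (x 0 i0) - beta * x 0 i0 - h = ln b - beta * b]].
Proof.
move=> hq h0 gx; have x0 i := global_min_gt0 i gx.
have lx := global_min_local gx; have q0 : (0 < q)%N by exact: ltnW.
have [i0 [fi0 fi hi0 xmax]] : exists i0 : 'I_q, [/\ field h i0 = h,
    forall i, i != i0 -> field h i = 0, 0 < h -> i0 = 0%N :> nat & forall i, x 0 i <= x 0 i0].
  have [->|hn0] := eqVneq h 0.
    pose i0 := [arg max_(i > Ordinal q0 | true) x 0 i]%O.
    exists i0; split.
    - by rewrite /field mul0r.
    - by move=> i _; rewrite /field mul0r.
    - by rewrite ltxx.
    - by move=> i; rewrite /i0; case: Order.TotalTheory.arg_maxP => // k _; apply.
  have hp : 0 < h by rewrite lt_neqAle eq_sym hn0.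
  exists (Ordinal q0); split => //.
  - by rewrite /field /= mulr1.
  - move=> i ii; rewrite /field; have /negPf -> : (i : nat) != 0%N.
      by apply: contra ii => /eqP ii; apply/eqP/val_inj.
    by rewrite mulr0.
  - by move=> i; exact: (global_min_field_max i hp gx).
have ch i : i != i0 -> ln (x 0 i0) - beta * x 0 i0 - h = ln (x 0 i) - beta * x 0 i.
  move=> ii; have := local_min_chem i0 i lx x0.
  by rewrite /chem fi0 fi// subr0.
have bx i : i != i0 -> beta * x 0 i <= 1.
  move=> ii; rewrite leNgt; apply/negP => b1.
  have [e|ne] := eqVneq (x 0 i) (x 0 i0).
    have i0i : i0 != i by rewrite eq_sym.
    have := local_min_curvature lx x0 i0i; rewrite -e.
    have := x0 i; move=> xi0 H.
    have xv : (x 0 i)^-1 * x 0 i = 1 by rewrite mulVf// lt0r_neq0.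
    have : (2 * beta) * x 0 i <= ((x 0 i)^-1 + (x 0 i)^-1) * x 0 i by rewrite ler_pM2r.
    rewrite [leRHS]mulrDl xv -mulrA; lra.
  have lt : x 0 i < x 0 i0 by rewrite lt_neqAle ne xmax.
  have := chem_decreasing (x0 i) lt (ltW b1); have := ch i ii; lra.
have [j ji] : exists j : 'I_q, j != i0.
  exists (if i0 == Ordinal q0 then Ordinal hq else Ordinal q0).
  by case: ifPn => [/eqP ->|]; [|rewrite eq_sym].
exists i0, (x 0 j); split => //.
  move=> i ii; apply: (chem_inj (x0 i) (x0 j) (bx _ ii) (bx _ ji)).
  by rewrite -(ch i)// -(ch j).
by split => //; [exact: bx|exact: ch].
Qed.

Lemma card_neq i0 : #|[pred i : 'I_q | i != i0]| = q.-1.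
Proof. by have := cardC1 i0; rewrite card_ord => <-; apply: eq_card. Qed.

Lemma sum_two_level x i0 (b : R) : (0 < q)%N -> (forall i, i != i0 -> x 0 i = b) ->
  \sum_i x 0 i = x 0 i0 + q.-1%:R * b.
Proof.
move=> q0 xb; rewrite (bigD1 i0)//= (eq_bigr (fun=> b)); last by move=> i; exact: xb.
by rewrite sumr_const mulr_natl card_neq.
Qed.

(** A second global minimizer yields a second zero of [gap]: its own parameter if
that is a different one; if the parameters agree, the two minimizers have
different largest colours, so that h = 0, and then s = 0 is a zero.
Nondegeneracy along the family is the last inequality; together with b <= a and
beta b <= 1 it implies the one before. *)
Lemma minimizer_structure beta h x : (1 < q)%N -> 0 <= h ->
  global_minimizer beta h x ->
  (exists x', global_minimizer beta h x' /\ x' <> x) ->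
  exists (i0 : 'I_q) (a b : R),
  [/\ [/\ 0 < b, b <= a, a <= 1 & a + q.-1%:R * b = 1],
      x 0 i0 = a, forall i, i != i0 -> x 0 i = b &
      0 < b^-1 - beta /\ 0 < prec (a^-1 - beta) (b^-1 - beta) q.-1].
Proof.
move=> hq h0 gx [x' [gx' xx']]; have q0 : (0 < q)%N by exact: ltnW.
have [i0 [b [fi0 fi hi0 xb [b0 ba bb ch]]]] := global_min_shape hq h0 gx.
have [i1 [b' [_ _ hi1 xb' [b0' ba' _ ch']]]] := global_min_shape hq h0 gx'.
pose m : R := q.-1%:R.
have m0 : 0 < m by rewrite ltr0n -ltnS prednK.
set a := x 0 i0 in ba ch *; set a' := x' 0 i1 in ba' ch'.
have ab : a + m * b = 1 by rewrite -(sum_two_level q0 xb); case: gx => -[].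
have ab' : a' + m * b' = 1 by rewrite -(sum_two_level q0 xb'); case: gx' => -[].
have gapE (u v : R) : 0 < v -> v <= u -> u + m * v = 1 -> ln u - beta * u - h = ln v - beta * v ->
   gap m beta h (u - v) = 0.
  move=> v0 vu uv e; have u0 : 0 < u by exact: lt_le_trans vu.
  have p3 : 0 < m + 1 by rewrite addr_gt0.
  have -> : gap m beta h (u - v) = ln ((m + 1) * u) - ln ((m + 1) * v) - beta * (u - v) - h.
    by rewrite /gap; congr (ln _ - ln _ - _ - _); move: uv; lra.
  by rewrite !lnM ?posrE//; lra.
have bd (u v : R) : 0 < v -> v <= u -> u + m * v = 1 -> u - v < 1.
  by move=> v0 vu uv; have := mulr_gt0 m0 v0; lra.
have s0 : 0 <= a - b by rewrite subr_ge0.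
have s0' : 0 <= a' - b' by rewrite subr_ge0.
have [s2 [s20 s21 s12 gs2]] : exists s2, [/\ 0 <= s2, s2 < 1, a - b != s2 & gap m beta h s2 = 0].
  have [e|ne] := eqVneq (a - b) (a' - b'); last first.
    by exists (a' - b'); split => //; [exact: bd|exact: gapE].
  have bE : b = b'.
    have : (m + 1) * b = (m + 1) * b' by move: ab ab' e; lra.
    by move/mulfI; apply; rewrite gt_eqF// addr_gt0.
  have aE : a = a' by move: e; rewrite bE; lra.
  have hz : h = 0.
    apply/eqP; rewrite eq_le h0 andbT leNgt; apply/negP => hp; apply: xx'.
    have i01 : i1 = i0 by apply: val_inj; rewrite /= hi0// hi1.
    apply/rowP => i; have [->|ii] := eqVneq i i0; first by rewrite -/a aE /a' i01.
    by rewrite xb// bE xb'// i01.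
  have sn0 : a - b != 0.
    apply/eqP => s0z; apply: xx'; apply/rowP => i.
    have -> : x 0 i = b by have [->|/xb//] := eqVneq i i0; rewrite -/a; lra.
    by have [->|/xb'->//] := eqVneq i i1; rewrite -/a'; lra.
  exists 0; split => //.
  by rewrite /gap hz !(mulr0, addr0, subr0, oppr0) ln1 subrr.
have bmin s : 0 <= s -> s < 1 -> branch m beta h (a - b) <= branch m beta h s.
  move=> t0 t1.
  pose u (s : R) : V := \row_i (if i == i0 then (1 + m * s) / (m + 1) else (1 - s) / (m + 1)).
  have p3 : 0 < m + 1 by rewrite addr_gt0.
  have uE s' : free_energy beta h (u s') = branch m beta h s'.
    rewrite free_energyE (bigD1 i0)//= (eq_bigr (fun=> (1 - s') / (m + 1) * ln ((1 - s') / (m + 1)) - beta / 2 * ((1 - s') / (m + 1)) ^+ 2)); last first.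
      by move=> i ii; rewrite mxE (negPf ii) /energy1 fi// mul0r subr0.
    rewrite sumr_const card_neq.
    rewrite mxE eqxx /energy1 fi0 -[_ *+ q.-1]mulr_natl -/m /branch; ring.
  have ux : u (a - b) = x.
    apply/rowP => i; rewrite mxE; have [->|/xb ->] := eqVneq i i0.
      rewrite -/a; apply: (mulIf (lt0r_neq0 p3)); rewrite divfK ?lt0r_neq0//.
      by move: ab; lra.
    apply: (mulIf (lt0r_neq0 p3)); rewrite divfK ?lt0r_neq0//.
    by move: ab; lra.
  rewrite -!uE ux; apply: gx.2; split.
    rewrite (@sum_two_level _ i0 ((1 - s) / (m + 1)))// => [|i ii]; last by rewrite mxE (negPf ii).
    by rewrite mxE eqxx -/m; field; rewrite gt_eqF.
  move=> i; rewrite mxE; case: ifP => _; apply: divr_ge0; rewrite ?(ltW p3)//.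
    by rewrite addr_ge0// mulr_ge0// ltW.
  by rewrite subr_ge0 ltW.
have := branch_nondegenerate m0 s0 (bd _ _ b0 ba ab) s20 s21 s12 (gapE _ _ b0 ba ab ch) gs2 bmin.
have p3 : 0 < m + 1 by rewrite addr_gt0.
have a0 : 0 < a by exact: lt_le_trans ba.
have -> : disc m (a - b) = (m + 1) ^+ 2 * (a * b).
  have e1 : 1 + m * (a - b) = (m + 1) * a by move: ab; lra.
  have e2 : 1 - (a - b) = (m + 1) * b by move: ab; lra.
  by rewrite /disc e1 e2; ring.
move=> H; have {}H : beta * (m + 1) < (a * b)^-1.
  have p4 : 0 < a * b by exact: mulr_gt0.
  rewrite -[ltRHS]mul1r ltr_pdivlMr// -(ltr_pM2l p3).
  rewrite mulr1; have -> // : (m + 1) * (beta * (m + 1) * (a * b)) = beta * ((m + 1) ^+ 2 * (a * b)).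
  by ring.
have precE : prec (a^-1 - beta) (b^-1 - beta) q.-1 = (a * b)^-1 - beta * (m + 1).
  rewrite /prec -/m; have -> : (a * b)^-1 = (a + m * b) / (a * b) by rewrite ab mul1r.
  by field; rewrite !gt_eqF.
have S0 : 0 < prec (a^-1 - beta) (b^-1 - beta) q.-1 by rewrite precE subr_gt0.
exists i0, a, b; split => //.
  by split => //; move: ab (mulr_gt0 m0 b0); lra.
split => //.
have bi : beta <= b^-1 by rewrite -[b^-1]mul1r ler_pdivlMr.
rewrite subr_gt0 lt_neqAle bi andbT; apply/eqP => be.
move: S0; rewrite /prec -/m be subrr add0r pmulr_rgt0// subr_gt0 ltf_pV2 ?posrE//.
by rewrite ltNge ba.
Qed.

End shape.

(** * Stability of the minimizer under perturbation of the parameters *)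

Section continuity.
Variables (R : realType) (q : nat).
Notation V := 'rV[R]_q.
Implicit Types (beta h : R) (p x y : V) (i j : 'I_q).

Lemma continuous_sum_ord (T : topologicalType) (f : 'I_q -> T -> R) :
  (forall i, continuous (f i)) -> continuous (fun t => \sum_i f i t).
Proof. by move=> cf t; apply: cvg_big => [|i _]; [exact: add_continuous|exact: cf]. Qed.

Lemma continuous_xlnx : continuous (fun t : R => t * ln t).
Proof.
move=> t; have [t0|t0|->] := ltgtP t 0.
- rewrite /continuous_at (ln0 (ltW t0)) mulr0.
  apply/cvgr0Pnorm_lt => e e0; near=> u => /=; rewrite ln0 ?mulr0 ?normr0//.
  by near: u; have := lt_nbhsl t0; apply: filterS => u /ltW.
- by apply: cvgM; [exact: cvg_id|exact: continuous_ln].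
(* Near 0, |t ln t| <= 2 sqrt t. *)
- rewrite /continuous_at mul0r; apply/cvgr0Pnorm_lt => e e0.
  near=> u => /=.
  have [u0|u0] := leP u 0; first by rewrite ln0// mulr0 normr0.
  have u1 : u < 1.
    by near: u; apply: lt_nbhsl; exact: ltr01.
  have ue : u < (e / 2) ^+ 2.
    by near: u; apply: lt_nbhsl; rewrite exprn_gt0// divr_gt0.
  have s0 : 0 < Num.sqrt u by rewrite sqrtr_gt0.
  have l1 : ln (Num.sqrt u)^-1 <= (Num.sqrt u)^-1 - 1 by apply: ln_le; rewrite invr_gt0.
  have E : ln u = 2 * ln (Num.sqrt u).
    by rewrite -{1}(sqr_sqrtr (ltW u0)) lnXn// mulr_natl.
  rewrite lnV ?posrE// in l1.
  have l2 : - (u * ln u) <= 2 * Num.sqrt u.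
    rewrite E -{1}(sqr_sqrtr (ltW u0)).
    have -> : 2 * Num.sqrt u = Num.sqrt u ^+ 2 * (2 * (Num.sqrt u)^-1) by field; rewrite gt_eqF.
    by rewrite -mulrN ler_pM2l ?exprn_gt0//; lra.
  have l3 : Num.sqrt u < e / 2.
    rewrite -(ltr_pXn2r (n := 2))// ?nnegrE ?sqrtr_ge0//; last by rewrite divr_ge0// ltW.
    by rewrite sqr_sqrtr ?ltW.
  rewrite ler0_norm; last by rewrite pmulr_rle0// ln_le0// ltW.
  lra.
Unshelve. all: by end_near. Qed.

Lemma continuous_coord_comp (f : R -> R) i : continuous f -> continuous (fun y : V => f (y 0 i)).
Proof.
move=> cf y; apply: (@continuous_comp _ _ _ (fun y : V => y 0 i) f); last exact: cf.
exact: coord_continuous.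
Qed.

Lemma continuous_energy1 beta h i : continuous (energy1 beta h i).
Proof.
move=> t; apply: cvgB; last by apply: cvgM; [exact: cvg_cst|exact: cvg_id].
apply: cvgB; first exact: continuous_xlnx.
by apply: cvgM; [exact: cvg_cst|exact: exprn_continuous].
Qed.

Lemma continuous_free_energy beta h : continuous (free_energy beta h : V -> R).
Proof.
have -> : free_energy beta h = (fun x : V => \sum_i energy1 beta h i (x 0 i)).
  by apply/funext => x; rewrite free_energyE.
apply: (@continuous_sum_ord V) => i.
apply: (@continuous_coord_comp _ i (@continuous_energy1 beta h i)).
Qed.

Lemma continuous_enorm x : continuous (fun y : V => enorm (y - x)).
Proof.
move=> y; rewrite /enorm.
apply: (@continuous_comp _ _ _ (fun y : V => \sum_i (y - x) 0 i ^+ 2) Num.sqrt); last exact: sqrt_continuous.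
move: y; apply: (@continuous_sum_ord V) => i.
have c : continuous (fun t : R => (t - x 0 i) ^+ 2).
  move=> t; apply: (@continuous_comp _ _ _ (fun t : R => t - x 0 i) (fun t => t ^+ 2)).
    by apply: cvgB; [exact: cvg_id|exact: cvg_cst].
  exact: exprn_continuous.
rewrite (_ : (fun y : V => (y - x) 0 i ^+ 2) = (fun y => (y 0 i - x 0 i) ^+ 2)); last first.
  by apply/funext => z; rewrite !mxE.
apply: (@continuous_coord_comp _ i c).
Qed.

Lemma enorm_sqr x : enorm x ^+ 2 = \sum_i x 0 i ^+ 2.
Proof. by rewrite /enorm sqr_sqrtr// sumr_ge0// => i _; rewrite sqr_ge0. Qed.

Lemma enorm_ge0 x : 0 <= enorm x. Proof. exact: sqrtr_ge0. Qed.

Lemma coord_le_enorm x i : `|x 0 i| <= enorm x.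
Proof.
rewrite -(ler_pXn2r (n := 2))// ?nnegrE ?enorm_ge0// enorm_sqr real_normK ?num_real//.
by rewrite (bigD1 i)//= lerDl sumr_ge0// => k _; rewrite sqr_ge0.
Qed.

Lemma simplex_le1 x i : simplex x -> x 0 i <= 1.
Proof. by move=> [<- x0]; rewrite (bigD1 i)//= lerDl sumr_ge0. Qed.

Lemma simplex_compact : compact (@simplex R q : set V).
Proof.
have cl : closed (@simplex R q : set V).
  have -> : @simplex R q = (fun y : V => \sum_i y 0 i) @^-1` [set 1] `&`
      \bigcap_(i in [set: 'I_q]) (fun y : V => y 0 i) @^-1` [set t | 0 <= t].
    apply/seteqP; split => y; first by move=> [y1 y0]; split => // i _; exact: y0.
    by move=> [y1 y0]; split => // i; exact: y0.
  apply: closedI.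
    apply: preimage_closed; last exact: closed_eq.
    by move=> y _; apply: (@continuous_sum_ord V) => i; exact: coord_continuous.
  apply: closed_bigI => i _; apply: preimage_closed; last exact: closed_ge.
  by move=> y _; exact: coord_continuous.
apply: (subclosed_compact cl (@rV_compact R q (fun=> `[0, 1]%classic) _)).
  by move=> _; exact: segment_compact.
by move=> y sy i; rewrite /= in_itv/= sy.2 simplex_le1.
Qed.

End continuity.

Section quadratic_approximation.
Variables (R : realType) (q : nat).
Notation V := 'rV[R]_q.
Implicit Types (beta h : R) (p x y v : V) (i j : 'I_q).

(** Second derivative of the free energy at x in the direction v. *)
Definition hess beta x v : R := \sum_i ((x 0 i)^-1 - beta) * v 0 i ^+ 2.

(** Cauchy-Schwarz against the constant vector 1. *)
Lemma sqr_sum_le (P : pred 'I_q) v m : m = #|P|%:R -> 0 < m ->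
  (\sum_(i | P i) v 0 i) ^+ 2 <= m * \sum_(i | P i) v 0 i ^+ 2.
Proof.
move=> mP m0; set s := \sum_(i | P i) v 0 i.
have : 0 <= \sum_(i | P i) (v 0 i - s / m) ^+ 2 by apply: sumr_ge0 => i _; exact: sqr_ge0.
have -> : \sum_(i | P i) (v 0 i - s / m) ^+ 2 =
    \sum_(i | P i) v 0 i ^+ 2 - 2 * (s / m) * s + m * (s / m) ^+ 2.
  have -> : m * (s / m) ^+ 2 = \sum_(i | P i) (s / m) ^+ 2 by rewrite sumr_const -mulr_natl -mP.
  rewrite [X in _ - X]mulr_sumr -sumrB -big_split/=.
  by apply: eq_bigr => i _; ring.
have -> : \sum_(i | P i) v 0 i ^+ 2 - 2 * (s / m) * s + m * (s / m) ^+ 2 =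
    (m * \sum_(i | P i) v 0 i ^+ 2 - s ^+ 2) / m by field; rewrite gt_eqF.
by rewrite pmulr_lge0 ?invr_gt0// subr_ge0.
Qed.

Lemma hess_qform beta x i0 a b v : x 0 i0 = a -> (forall i, i != i0 -> x 0 i = b) ->
  b^-1 - beta != 0 ->
  hess beta x v = qform i0 (a^-1 - beta) (b^-1 - beta) [::] v.
Proof.
move=> xi0 xi B0; rewrite /hess /qform /tot big_nil addr0 /prec/= mul0r addr0.
rewrite mulfK// (bigD1 i0)//= xi0 addrC; congr (_ + _).
by rewrite mulr_sumr; apply: eq_big => i; [rewrite andbT|move=> ii; rewrite xi].
Qed.

(** On zero-sum vectors w = v_i0^2 lies between 0 and m times the sum of the other
squares, and the claim is affine in w: it suffices to know it at the two
ends. *)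
Lemma hess_coercive beta x i0 a b : (1 < q)%N ->
  x 0 i0 = a -> (forall i, i != i0 -> x 0 i = b) ->
  0 < b^-1 - beta -> 0 < prec (a^-1 - beta) (b^-1 - beta) q.-1 ->
  exists2 k : R, 0 < k & forall v, zero_sum v -> k * \sum_i v 0 i ^+ 2 <= hess beta x v.
Proof.
move=> hq xi0 xi; set A := a^-1 - beta; set B := b^-1 - beta; rewrite /prec.
set m : R := q.-1%:R => B0 S0.
have m0 : 0 < m by rewrite ltr0n -ltnS prednK// ltnW.
pose k := Num.min B (B + m * A) / (m + 1).
have k0 : 0 < k by rewrite divr_gt0 ?addr_gt0// lt_min B0.
have kB : k <= B.
  apply: (@le_trans _ _ (B / (m + 1))); first by rewrite ler_pM2r ?invr_gt0 ?addr_gt0// ge_min lexx.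
  by rewrite ler_pdivrMr ?addr_gt0//; have := mulr_gt0 m0 B0; lra.
have kS : k * (m + 1) <= B + m * A by rewrite divfK ?lt0r_neq0 ?addr_gt0// ge_min lexx orbT.
exists k => // v v0.
have [T [TE hT]] : exists T, T = \sum_(i | i != i0) v 0 i ^+ 2 /\ v 0 i0 ^+ 2 <= m * T.
  eexists; split; first reflexivity.
  have -> : v 0 i0 ^+ 2 = (\sum_(i | i != i0) v 0 i) ^+ 2.
    by move: v0; rewrite /zero_sum/= (bigD1 i0)//= => /eqP; rewrite addr_eq0 => /eqP ->; rewrite sqrrN.
  by apply: sqr_sum_le => //; rewrite card_neq.
rewrite /hess [X in k * X](bigD1 i0)//= -TE.
rewrite [leRHS](bigD1 i0)//= xi0 -/A.
have -> : \sum_(i | i != i0) ((x 0 i)^-1 - beta) * v 0 i ^+ 2 = B * T.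
  by rewrite TE mulr_sumr; apply: eq_bigr => i /xi ->.
rewrite -(ler_pM2l m0) -subr_ge0.
set w := v 0 i0 ^+ 2 in hT *.
have w0 : 0 <= w by exact: sqr_ge0.
have -> : m * (A * w + B * T) - m * (k * (w + T)) =
  w * (B + m * A - k * (m + 1)) + (m * T - w) * (B - k) by ring.
by rewrite addr_ge0// mulr_ge0// subr_ge0.
Qed.

(** By [free_energyB], the value of f (y) - f (p) when p is a critical point. *)
Definition excess beta p y : R :=
  \sum_i (p 0 i * psi ((y 0 i - p 0 i) / p 0 i) - beta / 2 * (y 0 i - p 0 i) ^+ 2).

(** Second-order expansion at p, with the curvature 1 / p replaced by the
curvature 1 / t at a nearby point. *)
Lemma psi_quadratic (mu r t p y : R) : 0 < mu -> r <= mu / 8 -> mu <= t ->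
  `|p - t| <= r -> `|y - t| <= r ->
  `|p * psi ((y - p) / p) - (y - p) ^+ 2 / t / 2| <= 17 * r / mu ^+ 2 * (y - p) ^+ 2.
Proof.
move=> mu0 rmu mut pt yt; have t0 : 0 < t by exact: lt_le_trans mut.
have r0 : 0 <= r by exact: le_trans pt.
move: (pt) => /ler_normlP[pt1 pt2]; move: (yt) => /ler_normlP[yt1 yt2].
have p2 : mu / 2 <= p by lra.
have p0 : 0 < p by lra.
set d := y - p; have dr : `|d| <= 2 * r by rewrite ler_norml /d; apply/andP; split; lra.
have dp : `|d / p| = `|d| / p by rewrite normrM normrV ?unitfE ?gt_eqF// (gtr0_norm p0).
have := @psi_near R (d / p); rewrite dp => H.
have {}H : `|psi (d / p) - (d / p) ^+ 2 / 2| <= 2 * (`|d| / p) ^+ 3.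
  by apply: H; rewrite ler_pdivrMr//; lra.
have -> : p * psi (d / p) - d ^+ 2 / t / 2 =
   p * (psi (d / p) - (d / p) ^+ 2 / 2) + (t - p) / (p * t) / 2 * d ^+ 2.
  by field; rewrite ?gt_eqF.
apply: (le_trans (ler_normD _ _)).
rewrite normrM (gtr0_norm p0).
have d2 : `|d| ^+ 2 = d ^+ 2 by rewrite real_normK ?num_real.
have mup : mu ^+ 2 <= 4 * p ^+ 2 by nra.
(* The cubic error contributes 16 r / mu^2, since |d| <= 2 r and p >= mu / 2;
   the change of curvature contributes r / mu^2. *)
have h1 : p * `|psi (d / p) - (d / p) ^+ 2 / 2| <= 16 * r / mu ^+ 2 * d ^+ 2.
  apply: (@le_trans _ _ (p * (2 * (`|d| / p) ^+ 3))); first by rewrite ler_pM2l.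
  have -> : p * (2 * (`|d| / p) ^+ 3) = (2 * `|d| / p ^+ 2) * d ^+ 2.
    by rewrite -d2; field; rewrite gt_eqF.
  apply: ler_wpM2r; first exact: sqr_ge0.
  rewrite ler_pdivrMr ?exprn_gt0// mulrAC ler_pdivlMr ?exprn_gt0//.
  apply: (@le_trans _ _ (2 * (2 * r) * (4 * p ^+ 2))); last lra.
  by apply: ler_pM; rewrite ?mulr_ge0 ?sqr_ge0//; lra.
have h2 : `|(t - p) / (p * t) / 2 * d ^+ 2| <= r / mu ^+ 2 * d ^+ 2.
  rewrite normrM (ger0_norm (sqr_ge0 d)); apply: ler_wpM2r; first exact: sqr_ge0.
  have -> : (t - p) / (p * t) / 2 = (t - p) / (2 * (p * t)) by field; rewrite ?gt_eqF.
  have pt0 : 0 < 2 * (p * t) by rewrite !mulr_gt0.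
  rewrite normrM normrV ?unitfE ?lt0r_neq0// (gtr0_norm pt0) distrC.
  rewrite ler_pdivrMr// mulrAC ler_pdivlMr ?exprn_gt0//.
  by apply: ler_pM; rewrite ?sqr_ge0//; nra.
apply: (le_trans (lerD h1 h2)); lra.
Qed.

Lemma excess_near (mu r : R) beta beta' x p y : 0 < mu -> r <= mu / 8 ->
  (forall i, mu <= x 0 i) -> (forall i, `|p 0 i - x 0 i| <= r) ->
  (forall i, `|y 0 i - x 0 i| <= r) ->
  `|excess beta' p y - hess beta x (y - p) / 2| <=
  (17 * r / mu ^+ 2 + `|beta' - beta| / 2) * \sum_i (y 0 i - p 0 i) ^+ 2.
Proof.
move=> mu0 rmu mux px yx; rewrite /excess /hess mulr_suml -sumrB mulr_sumr.
apply: (le_trans (ler_norm_sum _ _ _)); apply: ler_sum => i _.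
have -> : (y - p) 0 i = y 0 i - p 0 i by rewrite !mxE.
rewrite [leRHS]mulrDl; set e := (y 0 i - p 0 i).
have -> : p 0 i * psi (e / p 0 i) - beta' / 2 * e ^+ 2 - ((x 0 i)^-1 - beta) * e ^+ 2 / 2 =
  (p 0 i * psi (e / p 0 i) - e ^+ 2 / x 0 i / 2) - (beta' - beta) / 2 * e ^+ 2.
  by field; rewrite lt0r_neq0// (lt_le_trans mu0).
apply: (le_trans (ler_normB _ _)); apply: lerD; first exact: psi_quadratic.
by rewrite 2!normrM (ger0_norm (sqr_ge0 e)) (gtr0_norm (_ : 0 < 2^-1)).
Qed.

End quadratic_approximation.

Section perturbation.
Variables (R : realType) (q : nat).
Notation V := 'rV[R]_q.
Variables (beta_ h_ : nat -> R) (beta h : R).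
Notation fe n := (free_energy (beta_ n) (h_ n)).
Hypotheses (hbeta_ : beta_ n @[n --> \oo] --> beta) (hh_ : h_ n @[n --> \oo] --> h).
Hypothesis q0 : (0 < q)%N.
Variables (x : V) (eps : R).
Hypotheses (hx : global_minimizer beta h x) (heps : 0 < eps).
Hypothesis huniq : forall y, global_minimizer beta h y -> enorm (y - x) <= eps -> y = x.
Variable d : nat -> V.
Hypothesis hd : forall n, (1 <= n)%N -> smallest_shift (beta_ n) (h_ n) x (d n).
Variable k : R.
Hypothesis k0 : 0 < k.
Hypothesis hk : forall v, zero_sum v -> k * \sum_i v 0 i ^+ 2 <= hess beta x v.

Lemma free_energy_perturb beta' h' (y : V) : simplex y ->
  `|free_energy beta' h' y - free_energy beta h y| <= `|beta' - beta| + `|h' - h|.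
Proof.
move=> sy; have [y1 y0] := sy.
have -> : free_energy beta' h' y - free_energy beta h y =
   (beta - beta') / 2 * \sum_i y 0 i ^+ 2 + (h - h') * \sum_(i < q | i == 0%N :> nat) y 0 i.
  by rewrite /free_energy; field.
have s1 : 0 <= \sum_i y 0 i ^+ 2 <= 1.
  rewrite sumr_ge0/= => [|i _]; last exact: sqr_ge0.
  by rewrite -y1 ler_sum// => i _; rewrite expr2 ler_piMl// simplex_le1.
have s2 : 0 <= \sum_(i < q | i == 0%N :> nat) y 0 i <= 1.
  rewrite sumr_ge0//= -y1 [leRHS](bigID (fun i : 'I_q => i == 0%N :> nat))/= lerDl.
  exact: sumr_ge0.
move: s1 s2; set s1 := \sum_i _; set s2 := \sum_(_ | _) _.
move=> /andP[s10 s11] /andP[s20 s21].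
apply: (le_trans (ler_normD _ _)); rewrite !normrM (ger0_norm s10) (ger0_norm s20).
rewrite (gtr0_norm (_ : 0 < 2^-1))// (distrC beta) (distrC h).
apply: lerD; last by rewrite ler_piMr.
by have := normr_ge0 (beta' - beta); nra.
Qed.

Lemma near_free_energy (e : R) : 0 < e ->
  \forall n \near \oo, forall y : V, simplex y ->
    `|fe n y - free_energy beta h y| <= e.
Proof.
move=> e0; have e2 : 0 < e / 2 by rewrite divr_gt0.
move/cvgrPdist_le: hbeta_ => /(_ _ e2) hb; move/cvgrPdist_le: hh_ => /(_ _ e2).
apply: filterS2 hb => n h1 h2 y sy; apply: (le_trans (free_energy_perturb _ _ sy)).
by rewrite distrC (distrC (h_ n)); lra.
Qed.

(** Compactness, as x is the only global minimizer at distance at most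
eps. *)
Lemma energy_gap (r : R) : 0 < r -> exists2 e, 0 < e &
  forall y, simplex y -> r <= enorm (y - x) -> enorm (y - x) <= eps ->
    free_energy beta h x + e <= free_energy beta h y.
Proof.
move=> r0.
pose K : set V := simplex (q:=q) `&` ((fun y : V => enorm (y - x)) @^-1` [set t | r <= t] `&`
  (fun y : V => enorm (y - x)) @^-1` [set t | t <= eps]).
have [K0|/nonemptyPn K0] := pselect (K !=set0); last first.
  exists 1 => // y sy y1 y2; suff : K y by rewrite K0.
  by split.
have cK : compact K.
  apply: subclosed_compact (@simplex_compact R q) _; last by move=> y [].
  apply: closedI; first exact: (compact_closed _ (@simplex_compact R q)).
  apply: closedI; apply: preimage_closed; try (exact: closed_ge); try (exact: closed_le).
    by move=> y _; exact: continuous_enorm.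
  by move=> y _; exact: continuous_enorm.
have [|y0 /set_mem[sy0 [y1 y2]] hy0] := @EVT_min_rV R q (free_energy beta h) K K0 cK.
  by apply: continuous_subspaceT; exact: continuous_free_energy.
have y0x : free_energy beta h x < free_energy beta h y0.
  rewrite lt_neqAle hx.2// andbT; apply/eqP => e.
  have gy : global_minimizer beta h y0 by split=> // z sz; rewrite -e; exact: hx.2.
  have yx := huniq gy y2.
  move: y1; rewrite /= yx subrr /enorm big1 ?sqrtr0; last by move=> i _; rewrite mxE expr0n.
  by rewrite leNgt r0.
exists (free_energy beta h y0 - free_energy beta h x); first by rewrite subr_gt0.
move=> y sy y1' y2'; rewrite addrC subrK; apply: hy0; apply/mem_set; split => //.
Qed.

Lemma zero_sumB (p y : V) : simplex p -> simplex y -> zero_sum (y - p).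
Proof.
move=> [p1 _] [y1 _]; rewrite /zero_sum/= (eq_bigr (fun i => y 0 i - p 0 i)).
  by rewrite sumrB y1 p1 subrr.
by move=> i _; rewrite !mxE.
Qed.

(** Minimize f_n over the simplex intersected with a small closed ball around x.
By [energy_gap] the minimum is not on the sphere once f_n is close to f, so it is
a local minimizer of f_n; the smallest shift is at most as long. *)
Lemma near_shift (r : R) : 0 < r -> \forall n \near \oo, enorm (d n) <= r.
Proof.
move=> r0; pose t := Num.min r eps.
have t0 : 0 < t by rewrite lt_min r0.
have tr : t <= r by rewrite ge_min lexx.
have te : t <= eps by rewrite ge_min lexx orbT.
have [e e0 he] := energy_gap t0.
have e3 : 0 < e / 3 by rewrite divr_gt0.
near=> n.
have n1 : (1 <= n)%N by near: n; exact: nbhs_infty_ge.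
have fn : forall y : V, simplex y ->
    `|fe n y - free_energy beta h y| <= e / 3.
  by near: n; exact: near_free_energy.
pose K : set V := simplex (q:=q) `&` (fun y : V => enorm (y - x)) @^-1` [set s | s <= t].
have xx : enorm (x - x) = 0.
  by rewrite subrr /enorm big1 ?sqrtr0// => i _; rewrite mxE expr0n.
have K0 : K !=set0.
  by exists x; split; [exact: hx.1|rewrite /= xx ltW].
have cK : compact K.
  apply: subclosed_compact (@simplex_compact R q) _; last by move=> y [].
  apply: closedI; first exact: (compact_closed _ (@simplex_compact R q)).
  apply: preimage_closed; last exact: closed_le.
  by move=> y _; exact: continuous_enorm.
have [|y0 /set_mem[sy0 y1] hy0] := @EVT_min_rV R q (fe n) K K0 cK.
  by apply: continuous_subspaceT; exact: continuous_free_energy.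
have yt : enorm (y0 - x) < t.
  rewrite lt_neqAle y1 andbT; apply/eqP => yt.
  have := he _ sy0; rewrite yt lexx => /(_ isT te).
  have := hy0 x; have -> : x \in K by apply/mem_set; split; [exact: hx.1|rewrite /= xx ltW].
  move=> /(_ isT).
  have := fn _ sy0; have := fn _ hx.1; rewrite !ler_norml => /andP[? ?] /andP[? ?]; lra.
have lm : local_minimizer (beta_ n) (h_ n) (x + (y0 - x)).
  rewrite addrC subrK; split => //.
  have /nbhs_ballP[s /= s0 hs] : nbhs y0 ((fun y : V => enorm (y - x)) @^-1` [set s | s < t]).
    by apply: (@continuous_enorm R q x y0); exact: lt_nbhsl.
  exists s => // y sy yy; apply: hy0; apply/mem_set; split => //; rewrite /= ltW//.
  apply: (hs y); split => // i j; rewrite ord1 /ball/= distrC.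
  have := coord_le_enorm (y - y0) j; rewrite !mxE => /le_lt_trans; apply.
  exact: yy.
have [_ _ /(_ _ (zero_sumB hx.1 sy0) lm) dn] := hd n1.
by rewrite (le_trans dn)// (le_trans (ltW yt)).
Unshelve. all: by end_near. Qed.

Lemma near_shift_coord (r : R) : 0 < r -> \forall n \near \oo, forall i, `|(x + d n) 0 i - x 0 i| <= r.
Proof.
move=> r0; apply: filterS (near_shift r0) => n h1 i.
by rewrite mxE addrC addKr (le_trans (coord_le_enorm _ _)).
Qed.

Lemma min_coord_gt0 : exists2 mu, 0 < mu & forall i, mu <= x 0 i.
Proof.
exists (\big[Num.min/1]_i x 0 i); last by move=> i; rewrite (bigD1 i)//= ge_min lexx.
apply: (big_ind (fun t => 0 < t)) => [//|s t s0 t0|i _]; first by rewrite lt_min s0.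
exact: (global_min_gt0 i hx).
Qed.

(** Near x the excess differs from half the Hessian form by at most half of the
lower bound of the latter. *)
Lemma near_excess : exists2 r, 0 < r & \forall n \near \oo, forall y : V, simplex y ->
  (forall i, `|y 0 i - x 0 i| <= r) ->
  k / 4 * \sum_i (y 0 i - (x + d n) 0 i) ^+ 2 <=
  fe n y - fe n (x + d n).
Proof.
have [mu mu0 hmu] := min_coord_gt0.
(* 17 r / mu^2 <= k / 8 and |beta_n - beta| / 2 <= k / 8 leave k / 4 of the
   coercivity constant k / 2 of half the Hessian form. *)
pose r := Num.min (mu / 8) (k * mu ^+ 2 / 136).
have r0 : 0 < r by rewrite lt_min !divr_gt0// mulr_gt0// exprn_gt0.
have r1 : r <= mu / 8 by rewrite ge_min lexx.
have r2 : 17 * r / mu ^+ 2 <= k / 8.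
  rewrite ler_pdivrMr ?exprn_gt0//.
  have : r <= k * mu ^+ 2 / 136 by rewrite ge_min lexx orbT.
  lra.
exists r => //.
have k4 : 0 < k / 4 by rewrite divr_gt0.
near=> n => y sy yr.
have n1 : (1 <= n)%N by near: n; exact: nbhs_infty_ge.
have bn : `|beta_ n - beta| <= k / 4.
  by rewrite distrC; near: n; by move/cvgrPdist_le : hbeta_; apply.
have pr : forall i, `|(x + d n) 0 i - x 0 i| <= r by near: n; exact: near_shift_coord.
have [d0 lm _] := hd n1.
set p := x + d n in pr lm *.
have p0 i : 0 < p 0 i by have := pr i; rewrite ler_norml => /andP[]; have := hmu i; lra.
pose i1 := Ordinal q0.
have hc i := local_min_chem i i1 lm p0.
rewrite (free_energyB p0 sy.2 _ hc) -/(excess (beta_ n) p y); last by rewrite sy.1 lm.1.1.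
have := excess_near beta (beta_ n) mu0 r1 hmu pr yr => /ler_normlP[ex _].
have := hk (zero_sumB lm.1 sy); have E : \sum_i (y - p) 0 i ^+ 2 = \sum_i (y 0 i - p 0 i) ^+ 2.
  by apply: eq_bigr => i _; rewrite !mxE.
rewrite E; set T := \sum_i _ in ex *.
have T0 : 0 <= T by apply: sumr_ge0 => i _; exact: sqr_ge0.
nra.
Unshelve. all: by end_near. Qed.

(** Away from x the [energy_gap] survives the perturbation, and
f_n (p_n) <= f_n (x) by [near_excess] applied to x. *)
Lemma free_energy_lower_bound : exists2 c, 0 < c & \forall n \near \oo, forall y : V,
  simplex y -> eball x eps y ->
  c * \sum_i (y 0 i - (x + d n) 0 i) ^+ 2 <=
  fe n y - fe n (x + d n).
Proof.
have [r r0 hr] := near_excess.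
have [e e0 he] := energy_gap r0.
have e4 : 0 < e / 4 by rewrite divr_gt0.
have Q0 : 0 < q%:R :> R by rewrite ltr0n.
pose c := Num.min (k / 4) (e / 2 / q%:R).
exists c; first by rewrite lt_min !divr_gt0.
near=> n => y sy yeps.
have n1 : (1 <= n)%N by near: n; exact: nbhs_infty_ge.
have fn : forall y : V, simplex y ->
    `|fe n y - free_energy beta h y| <= e / 4.
  by near: n; exact: near_free_energy.
have fx : forall y : V, simplex y ->
  (forall i, `|y 0 i - x 0 i| <= r) ->
  k / 4 * \sum_i (y 0 i - (x + d n) 0 i) ^+ 2 <=
  fe n y - fe n (x + d n).
  by near: n; exact: hr.
have [_ [sp _] _] := hd n1.
set p := x + d n in fx sp *.
have T0 (z : V) : 0 <= \sum_i (z 0 i - p 0 i) ^+ 2 by apply: sumr_ge0 => i _; exact: sqr_ge0.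
have [yr|yr] := pselect (forall i, `|y 0 i - x 0 i| <= r).
  by apply: le_trans (fx _ sy yr); apply: ler_wpM2r => //; rewrite ge_min lexx.
have {yr}[i yr] : exists i, r < `|y 0 i - x 0 i|.
  apply: contrapT => /forallNP nr; apply: yr => i; rewrite leNgt; exact/negP/nr.
have ry : r <= enorm (y - x).
  by rewrite (le_trans (ltW yr))//; have := coord_le_enorm (y - x) i; rewrite !mxE.
have := he y sy ry (ltW yeps).
have xp : 0 <= fe n x - fe n p.
  apply: le_trans (fx _ hx.1 _); first by rewrite mulr_ge0// divr_ge0// ltW.
  by move=> j; rewrite subrr normr0 ltW.
have := fn _ sy; have := fn _ hx.1; rewrite !ler_norml => /andP[? ?] /andP[? ?] gy.
apply: (@le_trans _ _ (e / 2)); last lra.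
apply: (@le_trans _ _ (e / 2 / q%:R * \sum_i (y 0 i - p 0 i) ^+ 2)).
  by apply: ler_wpM2r => //; rewrite ge_min lexx orbT.
rewrite -[leRHS](divfK (lt0r_neq0 Q0)) ler_pM2l ?divr_gt0//.
have -> : q%:R = \sum_(i < q) (1 : R) by rewrite sumr_const card_ord.
apply: ler_sum => j _; rewrite -real_normK ?num_real// expr_le1// ler_norml.
have := simplex_le1 j sy; have := simplex_le1 j sp; have := sy.2 j; have := sp.2 j.
by move=> *; apply/andP; split; lra.
Unshelve. all: by end_near. Qed.

Lemma near_simplex (a_ : nat -> R) (w_ : nat -> V) (w : V) (r : R) : 0 < r ->
  a_ n @[n --> \oo] --> +oo -> (forall i, w_ n 0 i @[n --> \oo] --> w 0 i) ->
  (\forall n \near \oo, zero_sum (w_ n)) -> \forall n \near \oo,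
  simplex (x + d n + (a_ n)^-1 *: w_ n) /\
  forall i, `|(x + d n + (a_ n)^-1 *: w_ n) 0 i - x 0 i| <= r.
Proof.
move=> r0 ha hw wz.
have [mu mu0 hmu] := min_coord_gt0.
pose t := Num.min r mu / 2; have t0 : 0 < t by rewrite divr_gt0// lt_min r0.
have tr : t <= r / 2 by rewrite ler_pM2r// ge_min lexx.
have tmu : t <= mu / 2 by rewrite ler_pM2r// ge_min lexx orbT.
near=> n.
have n1 : (1 <= n)%N by near: n; exact: nbhs_infty_ge.
have pr : forall i, `|(x + d n) 0 i - x 0 i| <= t by near: n; exact: near_shift_coord.
have wb : forall i, `|w_ n 0 i| <= `|w 0 i| + 1.
  near: n; apply: filter_forall => i.
  move/cvgrPdist_le : (hw i) => /(_ _ ltr01); apply: filterS => n h1.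
  by have := ler_distD (w 0 i) (w_ n 0 i) 0; rewrite !subr0 distrC; lra.
have an : \sum_i (`|w 0 i| + 1) / t + 1 <= a_ n.
  by near: n; move/cvgryPge : ha; apply.
have a0 : 0 < a_ n.
  by apply: lt_le_trans an; rewrite ltr_wpDl// sumr_ge0// => i _; rewrite divr_ge0 ?addr_ge0// ltW.
have wt i : `|(a_ n)^-1 * w_ n 0 i| <= t.
  rewrite normrM gtr0_norm ?invr_gt0// mulrC ler_pdivrMr// (le_trans (wb i))//.
  rewrite mulrC -ler_pdivrMr// (le_trans _ an)// (bigD1 i)//= -addrA lerDl addr_ge0//.
  by apply: sumr_ge0 => j _; rewrite divr_ge0 ?addr_ge0// ltW.
have yE i : (x + d n + (a_ n)^-1 *: w_ n) 0 i = (x + d n) 0 i + (a_ n)^-1 * w_ n 0 i.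
  by rewrite !mxE.
have [_ [sp _] _] := hd n1.
have yx i : `|(x + d n + (a_ n)^-1 *: w_ n) 0 i - x 0 i| <= 2 * t.
  rewrite yE; move: (pr i) (wt i); rewrite !ler_norml => /andP[? ?] /andP[? ?].
  by apply/andP; split; lra.
split; last by move=> i; rewrite (le_trans (yx i))//; lra.
split.
  under eq_bigr do rewrite yE; rewrite big_split/= sp.1 -mulr_sumr.
  have -> : \sum_i w_ n 0 i = 0 by near: n.
  by rewrite mulr0 addr0.
move=> i; move: (yx i) (hmu i); rewrite ler_norml => /andP[? ?]; lra.
Unshelve. all: by end_near. Qed.

Lemma cvg_sum_coord (f : R -> 'I_q -> R) (w_ : nat -> V) (w : V) : (forall i, continuous (f^~ i)) ->
  (forall i, w_ n 0 i @[n --> \oo] --> w 0 i) ->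
  \sum_i f (w_ n 0 i) i @[n --> \oo] --> \sum_i f (w 0 i) i.
Proof.
move=> cf hw; apply: cvg_big => [|i _]; first exact: add_continuous.
exact: (@cvg_comp _ _ _ (fun n => w_ n 0 i) (f^~ i) _ _ _ (hw i) (cf i _)).
Qed.

(** Second-order expansion at the moving critical point x + d_n. *)
Lemma cvg_scaled_excess (a_ : nat -> R) (w_ : nat -> V) (w : V) :
  a_ n @[n --> \oo] --> +oo -> (forall i, w_ n 0 i @[n --> \oo] --> w 0 i) ->
  (\forall n \near \oo, zero_sum (w_ n)) ->
  a_ n ^+ 2 * (fe n (x + d n + (a_ n)^-1 *: w_ n)
    - fe n (x + d n)) @[n --> \oo] --> hess beta x w / 2.
Proof.
move=> ha hw wz; apply/cvgrPdist_le => e e0.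
have [mu mu0 hmu] := min_coord_gt0.
pose T := \sum_i w 0 i ^+ 2.
have T0 : 0 <= T by apply: sumr_ge0 => i _; exact: sqr_ge0.
have hT : \sum_i w_ n 0 i ^+ 2 @[n --> \oo] --> T.
  by apply: (@cvg_sum_coord (fun t _ => t ^+ 2)) => // i; exact: exprn_continuous.
have hH : hess beta x (w_ n) @[n --> \oo] --> hess beta x w.
  apply: (@cvg_sum_coord (fun t i => ((x 0 i)^-1 - beta) * t ^+ 2)) => // i t.
  by apply: cvgM; [exact: cvg_cst|exact: exprn_continuous].
pose eta := e / 2 / (T + 1).
have eta0 : 0 < eta by rewrite !divr_gt0// ltr_wpDl.
pose r := Num.min (mu / 8) (eta * mu ^+ 2 / 34).
have r0 : 0 < r by rewrite lt_min !divr_gt0// mulr_gt0// exprn_gt0.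
have r1 : r <= mu / 8 by rewrite ge_min lexx.
have r2 : 17 * r / mu ^+ 2 <= eta / 2.
  rewrite ler_pdivrMr ?exprn_gt0//.
  have : r <= eta * mu ^+ 2 / 34 by rewrite ge_min lexx orbT.
  lra.
near=> n.
have n1 : (1 <= n)%N by near: n; exact: nbhs_infty_ge.
have bn : `|beta_ n - beta| <= eta.
  by rewrite distrC; near: n; move/cvgrPdist_le : hbeta_; apply.
have pr : forall i, `|(x + d n) 0 i - x 0 i| <= r by near: n; exact: near_shift_coord.
have Tn : \sum_i w_ n 0 i ^+ 2 <= T + 1.
  have : `|T - \sum_i w_ n 0 i ^+ 2| <= 1 by near: n; move/cvgrPdist_le : hT; apply.
  by rewrite ler_norml => /andP[]; lra.
have Hn : `|hess beta x w - hess beta x (w_ n)| <= e.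
  by near: n; move/cvgrPdist_le : hH; apply.
have an : 0 < a_ n by near: n; move/cvgryPgt : ha; apply.
have [sy yr] : simplex (x + d n + (a_ n)^-1 *: w_ n) /\
  forall i, `|(x + d n + (a_ n)^-1 *: w_ n) 0 i - x 0 i| <= r.
  by near: n; exact: near_simplex.
have [_ lm _] := hd n1.
set p := x + d n in pr lm sy yr *; set y := p + _ in sy yr *.
have p0 i : 0 < p 0 i by have := pr i; rewrite ler_norml => /andP[]; have := hmu i; lra.
pose i1 := Ordinal q0.
have hc i := local_min_chem i i1 lm p0.
rewrite (free_energyB p0 sy.2 _ hc) -/(excess (beta_ n) p y); last by rewrite sy.1 lm.1.1.
have ypE i : y 0 i - p 0 i = (a_ n)^-1 * w_ n 0 i by rewrite /y !mxE; ring.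
have := excess_near beta (beta_ n) mu0 r1 hmu pr yr.
have -> : y - p = (a_ n)^-1 *: w_ n by rewrite /y addrC addKr.
have -> : hess beta x ((a_ n)^-1 *: w_ n) = hess beta x (w_ n) / a_ n ^+ 2.
  rewrite /hess mulr_suml; apply: eq_bigr => i _; rewrite !mxE exprMn exprVn.
  by rewrite -mulrA; congr (_ * _); rewrite mulrC.
have -> : \sum_i (y 0 i - p 0 i) ^+ 2 = (\sum_i w_ n 0 i ^+ 2) / a_ n ^+ 2.
  by rewrite mulr_suml; apply: eq_bigr => i _; rewrite ypE exprMn exprVn mulrC.
set E := excess _ _ _; set Hw := hess _ _ (w_ n) in Hn *; set S := \sum_i _ in Tn *.
have a2 : 0 < a_ n ^+ 2 by rewrite exprn_gt0.
rewrite mulrA ler_pdivlMr// -{2}(gtr0_norm a2) -normrM => H.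
have {}H : `|a_ n ^+ 2 * E - Hw / 2| <= e / 2.
  move: H; have -> : (E - Hw / a_ n ^+ 2 / 2) * a_ n ^+ 2 = a_ n ^+ 2 * E - Hw / 2.
    by field; rewrite lt0r_neq0.
  move/le_trans; apply; apply: (@le_trans _ _ (eta * (T + 1))).
    apply: ler_pM => //; last lra.
      by rewrite addr_ge0// !mulr_ge0// ?invr_ge0 ?sqr_ge0// ltW.
    by apply: sumr_ge0 => i _; exact: sqr_ge0.
  by rewrite /eta divfK// lt0r_neq0// ltr_wpDl.
move: H Hn; rewrite !ler_norml => /andP[? ?] /andP[? ?]; apply/andP; split; lra.
Unshelve. all: by end_near. Qed.

End perturbation.

(** * Multinomial coefficients and entropy *)

Section stirling.
Variable R : realType.

(** The remainder in Stirling's formula. It vanishes at k = 0 since ln 0 = 0, so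
that empty colours need no separate treatment. *)
Definition stirling_rem (k : nat) : R :=
  ln (k`!)%:R - (k%:R + 1 / 2) * ln k%:R + k%:R.

Lemma ln_factE k : ln (k`!)%:R = stirling_rem k + (k%:R + 1 / 2) * ln k%:R - k%:R.
Proof. by rewrite /stirling_rem; ring. Qed.

(** The increments are of order 1 / k^2; the bound is written in telescoping
form. *)
Lemma stirling_remS k : (2 <= k)%N ->
  `|stirling_rem k.+1 - stirling_rem k| <= 6 * (k%:R^-1 - k.+1%:R^-1).
Proof.
move=> k2; pose t : R := k%:R^-1.
have K0 : 0 < k%:R :> R by rewrite ltr0n; lia.
have t0 : 0 < t by rewrite invr_gt0.
have t2 : t <= 1 / 2.
  by rewrite /t -[X in _ <= X]invrK lef_pV2 ?posrE// ?invf_div ?divr1 ?ler_nat.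
have kE : k%:R = t^-1 by rewrite /t invrK.
have k1E : k.+1%:R = (1 + t) / t by rewrite -natr1 kE; field; rewrite gt_eqF.
have p1 : 0 < 1 + t by rewrite addr_gt0.
have lk : ln k%:R = - ln t by rewrite kE lnV.
have lk1 : ln k.+1%:R = ln (1 + t) - ln t by rewrite k1E ln_div ?posrE.
have -> : stirling_rem k.+1 - stirling_rem k = - (((2 + t) * psi t - t ^+ 2) / (2 * t * (1 + t))).
  rewrite /stirling_rem factS natrM lnM ?posrE ?ltr0n ?fact_gt0// lk lk1 k1E kE /psi.
  by field; rewrite ?gt_eqF.
have -> : t - k.+1%:R^-1 = t ^+ 2 / (1 + t) by rewrite k1E; field; rewrite ?gt_eqF.
have := @psi_near R t; rewrite gtr0_norm// => /(_ t2) /ler_normlP[h1 h2].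
have q0 : 0 < 2 * t * (1 + t) by rewrite !mulr_gt0.
rewrite normrN normrM (gtr0_norm (_ : 0 < (2 * t * (1 + t))^-1)) ?invr_gt0//.
rewrite ler_pdivrMr//.
have -> : 6 * (t ^+ 2 / (1 + t)) * (2 * t * (1 + t)) = 12 * t ^+ 3 by field; rewrite gt_eqF.
have t3 : 0 < t ^+ 3 by rewrite exprn_gt0.
have h3 : (2 + t) * (psi t - t ^+ 2 / 2) <= (2 + t) * (2 * t ^+ 3) by rewrite ler_pM2l//; lra.
have h4 : (2 + t) * (t ^+ 2 / 2 - psi t) <= (2 + t) * (2 * t ^+ 3) by rewrite ler_pM2l//; lra.
have h5 : (2 + t) * (2 * t ^+ 3) <= 5 * t ^+ 3 by nra.
rewrite ler_norml; apply/andP; split; lra.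
Qed.

(** Subtracting 6 / k makes the sequence increasing and adding 6 / k makes it
decreasing. *)
Lemma cvg_stirling_rem : exists l : R, stirling_rem n @[n --> \oo] --> l.
Proof.
pose up (n : nat) : R := stirling_rem (n + 2) + 6 * (n + 2)%:R^-1.
pose lo (n : nat) : R := stirling_rem (n + 2) - 6 * (n + 2)%:R^-1.
have step n : lo n <= lo n.+1 /\ up n.+1 <= up n.
  have := @stirling_remS (n + 2); rewrite leq_addl => /(_ isT).
  rewrite /lo /up addSn.
  move: (stirling_rem (n + 2).+1) (stirling_rem (n + 2)) => s1 s2.
  move: ((n + 2).+1%:R^-1) ((n + 2)%:R^-1) => i1 i2.
  by rewrite ler_norml => /andP[? ?]; split; lra.
have nlo : nondecreasing_seq lo by apply/nondecreasing_seqP => n; case: (step n).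
have nup : nonincreasing_seq up by apply/nonincreasing_seqP => n; case: (step n).
have c : cvgn lo.
  apply: nondecreasing_is_cvgn => //; exists (up 0%N) => _ [n _ <-].
  apply: (@le_trans _ _ (up n)); last exact: nup.
  have : 0 <= (n + 2)%:R^-1 :> R by rewrite invr_ge0.
  by rewrite /lo /up; lra.
exists (limn lo).
rewrite -(cvg_shiftn 2) (_ : (fun _ => _) = lo \+ (fun n => 6 * (n + 2)%:R^-1)); last first.
  by apply/funext => n; rewrite /lo /= subrK.
rewrite -[limn lo]addr0; apply: cvgD => //.
rewrite -(mulr0 6); apply: cvgMr.
rewrite (cvg_shiftn 2 (fun n => n%:R^-1 : R)).
apply/gtr0_cvgV0; first by near=> n; rewrite ltr0n; near: n; exact: nbhs_infty_gt.
exact: cvgr_idn.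
Unshelve. all: by end_near. Qed.

Lemma stirling_rem_bounded : exists2 M : R, 0 <= M & forall n, `|stirling_rem n| <= M.
Proof.
have [l hl] := cvg_stirling_rem.
have /cvg_seq_bounded[M [_ hM]] : cvgn stirling_rem by apply/cvg_ex; exists l.
exists (`|M| + 1); first by rewrite addr_ge0.
by move=> n; apply: hM => //; rewrite ltr_pwDr// ler_norm.
Qed.

End stirling.

Section multinomial.
Variable q : nat.

Definition count_tuples n (K : 'I_q -> nat) : nat :=
  (\sum_(t : n.-tuple 'I_q) [forall k, count_mem k t == K k])%N.

Lemma sum_tupleS n (F : n.+1.-tuple 'I_q -> nat) :
  (\sum_t F t = \sum_(k : 'I_q) \sum_(t : n.-tuple 'I_q) F [tuple of k :: t])%N.
Proof.
rewrite pair_bigA /=.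
rewrite (reindex (fun kt : 'I_q * n.-tuple 'I_q => [tuple of kt.1 :: kt.2]))//.
exists (fun t => (thead t, [tuple of behead t])) => [[k t] _|t _] /=.
  by congr (_, _); apply: val_inj.
by rewrite -tuple_eta.
Qed.

(** Induction on n, according to the first letter k of the tuple: the
multinomial coefficients of the shorter tuples add up with weights K k. *)
Lemma count_tuples_fact n (K : 'I_q -> nat) : (\sum_k K k = n)%N ->
  (count_tuples n K * \prod_k (K k)`! = n`!)%N.
Proof.
elim: n K => [|n IH] K KS.
  have K0 k : K k = 0%N by apply/eqP; rewrite -leqn0 -KS (bigD1 k)//= leq_addr.
  rewrite [X in (_ * X)%N]big1 => [|k _]; last by rewrite K0.
  rewrite muln1 /count_tuples (eq_bigr (fun=> 1%N)) => [|t _]; last first.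
    by rewrite tuple0; apply/eqP; rewrite eqb1; apply/forallP => k; rewrite K0.
  by rewrite sum_nat_const card_tuple.
rewrite /count_tuples sum_tupleS.
pose K' k j := (K j - (k == j))%N.
have E k : (\sum_(t : n.-tuple 'I_q) [forall j, count_mem j [tuple of k :: t] == K j] =
    (0 < K k) * count_tuples n (K' k))%N.
  rewrite /count_tuples big_distrr/=; apply: eq_bigr => t _.
  have [K0|K0] := posnP (K k).
    rewrite mul0n; apply/eqP; rewrite eqb0; apply/negP => /forallP/(_ k).
    by rewrite /= eqxx K0.
  rewrite mul1n; congr nat_of_bool; apply/forallP/forallP => h j; have := h j; rewrite /K' /=.
    by move/eqP <-; rewrite addKn.
  move/eqP ->; rewrite subnKC//.
  by case: eqP => [<-|].
rewrite (eq_bigr _ (fun k _ => E k)) big_distrl/=.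
rewrite (eq_bigr (fun k => K k * n`!)%N) => [|k _]; last first.
  have [K0|K0] := posnP (K k); first by rewrite K0 !mul0n.
  have S' : (\sum_j K' k j = n)%N.
    apply/eqP; rewrite -(eqn_add2r 1) [X in _ == X]addn1 -KS [X in _ == X](bigD1 k)//= (bigD1 k)//=.
    rewrite /K' eqxx -addnA [(_ + 1)%N]addnC addnA subnK// eqn_add2l; apply/eqP.
    by apply: eq_bigr => j /negPf; rewrite eq_sym => ->; rewrite subn0.
  rewrite mul1n -(IH (K' k) S') [in LHS](bigD1 k)//= [in RHS](bigD1 k)//=.
  have -> : (\prod_(i < q | i != k) (K' k i)`! = \prod_(i < q | i != k) (K i)`!)%N.
    by apply: eq_bigr => j /negPf; rewrite /K' eq_sym => ->; rewrite subn0.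
  have -> : (K k)`! = (K k * (K' k k)`!)%N by rewrite /K' eqxx subn1 -{1 2}(prednK K0) factS.
  by rewrite -(mulnA (K k)) mulnCA.
by rewrite -big_distrl/= KS factS.
Qed.

End multinomial.

(** * Gibbs weights as functions of the colour counts *)

Section gibbs_weights.
Variables (R : realType) (q : nat).
Notation V := 'rV[R]_q.
Implicit Types (beta h : R) (p x y : V) (i j k : 'I_q).

Definition occ n (s : configuration q n) k : nat := (\sum_(i < n) (s i == k))%N.

Lemma empiricalE n (s : configuration q n) k : empirical R s 0 k = (occ s k)%:R.
Proof. by rewrite mxE natr_sum. Qed.

Lemma occ_sum n (s : configuration q n) : (\sum_k occ s k = n)%N.
Proof.
rewrite exchange_big/= -[RHS]card_ord -sum1_card; apply: eq_bigr => i _.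
by rewrite (bigD1 (s i))//= eqxx big1 ?addn0// => k; rewrite eq_sym => /negPf ->.
Qed.

Lemma count_configurations n (K : 'I_q -> nat) :
  (\sum_(s : configuration q n) [forall k, occ s k == K k] = count_tuples n K)%N.
Proof.
rewrite /count_tuples.
rewrite (reindex (fun t : n.-tuple 'I_q => [ffun i => tnth t i] : configuration q n))/=.
  apply: eq_bigr => t _; congr nat_of_bool; apply: eq_forallb => k; congr (_ == _).
  rewrite /occ -sum1_count big_tuple [RHS]big_mkcond; apply: eq_bigr => i _.
  by rewrite ffunE /=; case: eqP.
exists (fun s : configuration q n => [tuple s i | i < n]) => [t _|s _].
  by apply: eq_from_tnth => i; rewrite tnth_mktuple ffunE.
by apply/ffunP => i; rewrite ffunE tnth_mktuple.
Qed.

Lemma sum_pairs n (s : configuration q n) :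
  \sum_(i < n) \sum_(j < n | (i < j)%N) (s i == s j)%:R =
  (\sum_k (occ s k)%:R ^+ 2 - n%:R) / 2 :> R.
Proof.
set P := \sum_(i < n) _.
have E : \sum_k (occ s k)%:R ^+ 2 = \sum_(i < n) \sum_(j < n) (s i == s j)%:R :> R.
  under eq_bigr => k _ do rewrite expr2 /occ natr_sum mulr_suml.
  rewrite exchange_big/=; apply: eq_bigr => i _.
  under eq_bigr => k _ do rewrite mulr_sumr.
  rewrite exchange_big/=; apply: eq_bigr => j _.
  rewrite (bigD1 (s i))//= eqxx mul1r big1 ?addr0 1?eq_sym// => k.
  by rewrite eq_sym => /negPf ->; rewrite mul0r.
have D : \sum_(i < n) \sum_(j < n) (s i == s j)%:R = P + (P + n%:R) :> R.
  have -> : n%:R = \sum_(i < n) (1 : R) by rewrite sumr_const card_ord.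
  have -> : P + (P + \sum_(i < n) (1 : R)) =
      \sum_(i < n) (\sum_(j < n | (i < j)%N) (s i == s j)%:R +
      (\sum_(j < n | (j < i)%N) (s i == s j)%:R + 1)).
    rewrite !big_split/=; congr (_ + (_ + _)); rewrite /P (exchange_big_dep xpredT)//=.
    by apply: eq_bigr => i _; apply: eq_bigr => j _; rewrite eq_sym.
  apply: eq_bigr => i _; rewrite (bigID (fun j : 'I_n => (i < j)%N))/=; congr (_ + _).
  rewrite (bigD1 i) ?ltnn//= eqxx addrC; congr (_ + _); apply: eq_bigl => j.
  by rewrite -leqNgt ltn_neqAle andbC.
by rewrite E D; field.
Qed.

(** The pair interaction counts the pairs of equal spins, that is
(sum_k N_k^2 - n) / 2. The entropy is added and subtracted in the exponent
because it will compensate the number of configurations. *)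
Lemma gibbs_weightE n beta h (s : configuration q n) : (0 < n)%N ->
  let y := n%:R^-1 *: empirical R s in
  gibbs_weight beta h s =
  expR (n%:R * (\sum_k y 0 k * ln (y 0 k) - free_energy beta h y) - beta / 2).
Proof.
move=> n0 y; rewrite /gibbs_weight; congr expR; rewrite sum_pairs.
have N0 : n%:R != 0 :> R by rewrite pnatr_eq0 -lt0n.
have F : \sum_(i < n) (s i == 0%N :> nat)%:R = n%:R * \sum_(k < q | k == 0%N :> nat) y 0 k.
  rewrite mulr_sumr; under [RHS]eq_bigr => k _.
    by rewrite mxE empiricalE mulrA divff// mul1r natr_sum; over.
  rewrite exchange_big/=; apply: eq_bigr => i _.
  have [si|si] := boolP (s i == 0%N :> nat).
    by rewrite (bigD1 (s i))//= eqxx big1 ?addr0// => k /andP[_]; rewrite eq_sym => /negPf ->.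
  rewrite big1// => k k0; case: eqP => // sk; by rewrite sk k0 in si.
have S : \sum_k (occ s k)%:R ^+ 2 = n%:R ^+ 2 * \sum_k y 0 k ^+ 2.
  by rewrite mulr_sumr; apply: eq_bigr => k _; rewrite mxE empiricalE exprMn exprVn mulrA divff ?mul1r// expf_neq0.
by rewrite F S /free_energy; field.
Qed.

(** n^((q-1)/2) times the number of configurations with counts K, divided by the
exponential of n times the entropy of K / n (see [count_entropy]). *)
Definition entropy_factor n (K : 'I_q -> nat) : R :=
  expR (stirling_rem R n - \sum_k stirling_rem R (K k) +
    2^-1 * \sum_k (ln n%:R - ln (K k)%:R)).

Lemma count_entropy n (K : 'I_q -> nat) : (0 < q)%N -> (0 < n)%N -> (\sum_k K k = n)%N ->
  Num.sqrt n%:R ^+ q.-1 * ((count_tuples n K)%:R *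
    expR (n%:R * \sum_k ((K k)%:R / n%:R) * ln ((K k)%:R / n%:R))) = entropy_factor n K :> R.
Proof.
move=> q0 n0 KS; have N0 : 0 < n%:R :> R by rewrite ltr0n.
have P0 : 0 < \prod_k ((K k)`!)%:R :> R by apply: prodr_gt0 => k _; rewrite ltr0n fact_gt0.
have C : (count_tuples n K)%:R = (n`!)%:R / \prod_k ((K k)`!)%:R :> R.
  by rewrite -(count_tuples_fact KS) natrM natr_prod mulfK ?lt0r_neq0.
have lnP : ln (\prod_k ((K k)`!)%:R) = \sum_k ln (((K k)`!)%:R) :> R.
  have : (ln (\prod_k ((K k)`!)%:R) = \sum_k ln (((K k)`!)%:R) :> R) /\ 0 < (\prod_k ((K k)`!)%:R : R); last by case.
  elim/big_rec2 : _ => [|k u v _ [<- v0]]; first by rewrite ln1 ltr01.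
  by rewrite lnM ?posrE ?ltr0n ?fact_gt0//; split => //; rewrite mulr_gt0// ltr0n fact_gt0.
have -> : Num.sqrt n%:R ^+ q.-1 = expR (q.-1%:R * (2^-1 * ln n%:R)) :> R.
  rewrite expRM_natl; congr (_ ^+ _).
  have s0 : 0 < Num.sqrt n%:R :> R by rewrite sqrtr_gt0.
  rewrite -[LHS]lnK ?posrE//; congr expR; rewrite -[in RHS](sqr_sqrtr (ltW N0)) lnXn//.
  by field.
rewrite C -[X in X * expR _]lnK ?posrE ?divr_gt0 ?ltr0n ?fact_gt0//.
rewrite -!expRD /entropy_factor; congr expR.
rewrite ln_div ?posrE ?ltr0n ?fact_gt0// lnP ln_factE.
under eq_bigr => k _ do rewrite ln_factE.
have -> : \sum_k (stirling_rem R (K k) + ((K k)%:R + 1 / 2) * ln (K k)%:R - (K k)%:R) =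
  \sum_k stirling_rem R (K k) + (\sum_k (K k)%:R * ln (K k)%:R + 2^-1 * \sum_k ln (K k)%:R) - n%:R.
  rewrite -[in RHS]KS natr_sum mulr_sumr -!big_split/= -sumrB; apply: eq_bigr => k _; ring.
have -> : n%:R * \sum_k ((K k)%:R / n%:R) * ln ((K k)%:R / n%:R) =
   \sum_k (K k)%:R * ln (K k)%:R - n%:R * ln n%:R :> R.
  have -> : n%:R * ln n%:R = \sum_k (K k)%:R * ln n%:R :> R.
    by rewrite -mulr_suml -natr_sum KS.
  rewrite mulr_sumr -sumrB; apply: eq_bigr => k _.
  have [->|K0] := posnP (K k); first by rewrite !mul0r mulr0 subrr.
  rewrite ln_div ?posrE ?ltr0n//; field; exact: lt0r_neq0.
have qE : q%:R = q.-1%:R + 1 :> R by rewrite natr1 prednK.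
rewrite [in RHS]sumrB sumr_const card_ord -[_ *+ q]mulr_natl qE.
by field.
Qed.

End gibbs_weights.

Section cell_masses.
Variables (R : realType) (q : nat).
Notation V := 'rV[R]_q.
Implicit Types (beta h eps : R) (p x y v w : V) (i j k : 'I_q).

(** The vector W of the configurations whose counts are v, for p = x + d. *)
Definition rescale n p v : V := (Num.sqrt n%:R)^-1 *: (v - n%:R *: p).

Lemma fluctuation_rescale n x d (s : configuration q n) :
  fluctuation n x d s = rescale n (x + d) (empirical R s).
Proof. by rewrite /fluctuation /rescale [n%:R *: (x + d)]scalerDr opprD addrA. Qed.

(** Negative counts are allowed, so that the lattice is invariant under the
moves of [iter_int]. *)
Definition lattice n p : set V := [set w | exists N : 'I_q -> int,
  \sum_i N i = n%:Z /\ w = rescale n p (\row_i (N i)%:~R)].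

(** The first factor is common to all configurations: sqrt n ^ (q-1) is the
inverse of the volume of a cell of the lattice of fluctuations, and the
exponential normalizes the weight at the minimizer. *)
Definition config_mass n beta h (A : set (configuration q n)) p (g : V -> R)
    (s : configuration q n) : R :=
  (Num.sqrt n%:R ^+ q.-1 * expR (n%:R * free_energy beta h p + beta / 2)) *
  (`[< A s >]%:R * gibbs_weight beta h s * g (rescale n p (empirical R s))).

Definition cell_mass n beta h A p g w : R :=
  \sum_(s : configuration q n) config_mass beta h A p g s *
    (rescale n p (empirical R s) == w)%:R.

Lemma rescale_inj n p : (0 < n)%N -> injective (rescale n p).
Proof.
move=> n0 v w /(scalerI _) h; apply: (addIr (- (n%:R *: p))); apply: h.
by rewrite invr_neq0// gt_eqF// sqrtr_gt0 ltr0n.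
Qed.

Definition profile n (K : 'I_q -> nat) : V := \row_k ((K k)%:R / n%:R).

Lemma empirical_profile n (s : configuration q n) (K : 'I_q -> nat) : (0 < n)%N ->
  (empirical R s == n%:R *: profile n K) = [forall k, occ s k == K k].
Proof.
move=> n0; have N0 : n%:R != 0 :> R by rewrite pnatr_eq0 -lt0n.
apply/eqP/forallP => [e k|e].
  have := congr1 (fun v : V => v 0 k) e; rewrite empiricalE !mxE mulrC divfK//.
  by move/eqP; rewrite eqr_nat.
by apply/rowP => k; rewrite empiricalE (eqP (e k)) !mxE mulrC divfK.
Qed.

Lemma rescale_profile n p (K : 'I_q -> nat) : (0 < n)%N ->
  rescale n p (n%:R *: profile n K) = Num.sqrt n%:R *: (profile n K - p).
Proof.
move=> n0; rewrite /rescale -scalerBr scalerA; congr (_ *: _).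
have N0 : 0 < n%:R :> R by rewrite ltr0n.
rewrite -{2}(sqr_sqrtr (ltW N0)) expr2 mulrA mulVf ?mul1r//.
by rewrite gt_eqF// sqrtr_gt0.
Qed.

(** All the configurations of a cell have the same weight, so that Stirling's
formula applies to their number. *)
Lemma cell_mass_profile n beta h x eps p g (K : 'I_q -> nat) : (0 < q)%N -> (0 < n)%N ->
  (\sum_k K k = n)%N -> let y := profile n K in let w := rescale n p (n%:R *: y) in
  cell_mass beta h [set s : configuration q n | eball x eps (n%:R^-1 *: empirical R s)] p g w =
  `[< eball x eps y >]%:R * (entropy_factor R n K *
    expR (- (n%:R * (free_energy beta h y - free_energy beta h p))) * g w).
Proof.
move=> q0 n0 KS y w; have N0 : n%:R != 0 :> R by rewrite pnatr_eq0 -lt0n.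
rewrite /cell_mass.
have E (s : configuration q n) :
   config_mass beta h [set s | eball x eps (n%:R^-1 *: empirical R s)] p g s *
    (rescale n p (empirical R s) == w)%:R =
   (Num.sqrt n%:R ^+ q.-1 * expR (n%:R * free_energy beta h p + beta / 2)) *
  (`[< eball x eps y >]%:R * expR (n%:R * (\sum_k y 0 k * ln (y 0 k) - free_energy beta h y) - beta / 2) * g w)
   * [forall k, occ s k == K k]%:R.
  rewrite (inj_eq (rescale_inj n0)) empirical_profile//.
  have [K'|_] := boolP [forall k, occ s k == K k]; last by rewrite !mulr0.
  have es : empirical R s = n%:R *: y by apply/eqP; rewrite empirical_profile.
  rewrite /config_mass gibbs_weightE// es scalerA mulVf// scale1r.
  have -> // : `[< [set s0 : configuration q n | eball x eps (n%:R^-1 *: empirical R s0)] s >] = `[< eball x eps y >].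
  by apply/asbool_equiv_eq; rewrite /= es scalerA mulVf// scale1r.
rewrite (eq_bigr _ (fun s _ => E s)) -mulr_sumr.
have -> : \sum_(s : configuration q n) [forall k, occ s k == K k]%:R = (count_tuples n K)%:R :> R.
  by rewrite -count_configurations natr_sum.
rewrite -(count_entropy R q0 n0 KS).
have -> : \sum_k y 0 k * ln (y 0 k) = \sum_k ((K k)%:R / n%:R) * ln ((K k)%:R / n%:R) :> R.
  by apply: eq_bigr => k _; rewrite mxE.
set H := \sum_k _; set f := free_energy _ _ y; set f' := free_energy _ _ p.
have -> : expR (n%:R * (H - f) - beta / 2) = expR (n%:R * H) * expR (- (n%:R * (f - f'))) / expR (n%:R * f' + beta / 2).
  by rewrite -!expRN -!expRD; congr expR; ring.
by field; rewrite gt_eqF// expR_gt0.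
Qed.

Lemma cell_mass_empty n beta h (A : set (configuration q n)) p g w : (0 < n)%N ->
  (forall K : 'I_q -> nat, (\sum_k K k = n)%N -> w <> rescale n p (n%:R *: profile n K)) ->
  cell_mass beta h A p g w = 0.
Proof.
move=> n0 wK; rewrite /cell_mass big1// => s _.
case: eqP => [e|]; last by rewrite mulr0.
have := wK (occ s) (occ_sum s); rewrite -e; case.
by congr rescale; apply/eqP; rewrite empirical_profile//; apply/forallP.
Qed.

Lemma profile_simplex n (K : 'I_q -> nat) : (0 < n)%N -> (\sum_k K k = n)%N ->
  simplex (profile n K).
Proof.
move=> n0 KS; split=> [|k]; last by rewrite mxE divr_ge0.
under eq_bigr do rewrite mxE.
by rewrite -mulr_suml -natr_sum KS divff// pnatr_eq0 -lt0n.
Qed.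

Lemma lattice_zero_sum n p w : simplex p -> lattice n p w -> zero_sum w.
Proof.
move=> [p1 _] [N [NS ->]]; rewrite /zero_sum/=.
rewrite (eq_bigr (fun i => (Num.sqrt n%:R)^-1 * ((N i)%:~R - n%:R * p 0 i))); last first.
  by move=> i _; rewrite !mxE.
rewrite -mulr_sumr sumrB -mulr_sumr p1 mulr1 -rmorph_sum NS.
by rewrite /= subrr mulr0.
Qed.

Lemma lattice_profile n p w : (0 < n)%N -> lattice n p w ->
  (forall i, 0 <= (p + (Num.sqrt n%:R)^-1 *: w) 0 i) ->
  exists2 K : 'I_q -> nat, (\sum_k K k = n)%N &
    profile n K = p + (Num.sqrt n%:R)^-1 *: w.
Proof.
move=> n0 [N [NS ->]] w0.
have N0 : 0 < n%:R :> R by rewrite ltr0n.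
have E i : (p + (Num.sqrt n%:R)^-1 *: rescale n p (\row_i (N i)%:~R)) 0 i = (N i)%:~R / n%:R.
  rewrite !mxE mulrA -invfM -expr2 sqr_sqrtr ?ltW//.
  by field; rewrite gt_eqF.
have Npos i : 0 <= N i.
  by have := w0 i; rewrite E pmulr_lge0 ?invr_gt0// ler0z.
exists (fun i => `|N i|%N).
  apply/eqP; rewrite -eqz_nat -NS; apply/eqP; rewrite -[LHS]natz natr_sum.
  by apply: eq_bigr => i _; rewrite natz gez0_abs.
apply/rowP => i; rewrite E mxE; congr (_ / _).
by rewrite -[in RHS](gez0_abs (Npos i)).
Qed.

Lemma grid_closed_lattice n p i0 : grid_closed i0 (Num.sqrt n%:R) (lattice n p).
Proof.
move=> v k j [N [NS ->]].
exists (fun i => N i + k * ((i == j)%:Z - (i == i0)%:Z)); split.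
  rewrite big_split/= NS -mulr_sumr sumrB.
  have S (l : 'I_q) : \sum_(i < q) (i == l)%:Z = 1.
    by rewrite (bigD1 l)//= eqxx big1 ?addr0// => i /negPf ->.
  by rewrite !S subrr mulr0 addr0.
apply/rowP => i; rewrite !mxE rmorphD rmorphM rmorphB /=.
by case: (i == j); case: (i == i0) => /=; ring.
Qed.

End cell_masses.

Lemma cvg_sqrt_nat (R : realType) : Num.sqrt n%:R @[n --> \oo] --> (+oo : set_system R).
Proof.
apply/cvgryPge => X; near=> n.
have h1 : X ^+ 2 <= n%:R.
  near: n; have /cvgryPge : n%:R @[n --> \oo] --> (+oo : set_system R) by exact: cvgr_idn.
  by apply.
by rewrite (le_trans (ler_norm X))// -sqrtr_sqr ler_wsqrtr.
Unshelve. all: by end_near. Qed.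

Section entropy_factor_asymptotics.
Variables (R : realType) (q : nat).
Implicit Types (K : 'I_q -> nat).

Lemma ln_nat_ge0 k : 0 <= ln (k%:R : R).
Proof. by case: k => [|k]; [rewrite ln0|rewrite ln_ge0// ler1n]. Qed.

Lemma entropy_factor_le (M : R) n K (t : R) : (forall k, `|stirling_rem R k| <= M) ->
  (forall k, ln n%:R - ln (K k)%:R <= t) ->
  entropy_factor R n K <= expR ((q%:R + 1) * M + q%:R / 2 * t).
Proof.
move=> hM ht; rewrite /entropy_factor ler_expR.
have h1 := le_trans (ler_norm _) (hM n).
have h2 : - \sum_k stirling_rem R (K k) <= q%:R * M.
  rewrite -sumrN; apply: (@le_trans _ _ (\sum_(k < q) M)).
    by apply: ler_sum => k _; rewrite (le_trans (ler_norm _))// normrN.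
  by rewrite sumr_const card_ord mulr_natl.
have h3 : \sum_k (ln n%:R - ln (K k)%:R) <= q%:R * t.
  apply: (@le_trans _ _ (\sum_(k < q) t)); first by apply: ler_sum.
  by rewrite sumr_const card_ord mulr_natl.
lra.
Qed.

(** All the counts tend to infinity, since their frequencies have positive
limits. *)
Lemma cvg_entropy_factor (l : R) (K : nat -> 'I_q -> nat) (x : 'rV[R]_q) :
  stirling_rem R n @[n --> \oo] --> l -> (forall k, 0 < x 0 k) ->
  (forall k, (K n k)%:R / n%:R @[n --> \oo] --> x 0 k) ->
  entropy_factor R n (K n) @[n --> \oo] -->
  expR (l - \sum_(k < q) l + 2^-1 * \sum_k - ln (x 0 k)).
Proof.
move=> hl x0 hK.
pose u n : R := stirling_rem R n - \sum_k stirling_rem R (K n k) +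
    2^-1 * \sum_k (ln n%:R - ln (K n k)%:R).
apply: (@cvg_comp _ _ _ u expR); last exact: continuous_expR.
have Kx k : \forall n \near \oo, x 0 k / 2 * n%:R <= (K n k)%:R :> R.
  have x2 : 0 < x 0 k / 2 by rewrite divr_gt0.
  move/cvgrPdist_le : (hK k) => /(_ _ x2); apply: filterS2 (nbhs_infty_gt 0) => n n0 hn.
  by rewrite -ler_pdivlMr ?ltr0n//; move: hn; rewrite ler_norml => /andP[]; lra.
apply: cvgD; first apply: cvgB => //.
- apply: cvg_big => [|k _]; first exact: add_continuous.
  apply: (@cvg_comp _ _ _ (fun n => K n k) (stirling_rem R) _ \oo); last exact: hl.
  apply/cvgnyPge => A; near=> n.
  have : x 0 k / 2 * n%:R <= (K n k)%:R :> R by near: n; exact: Kx.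
  have : A%:R / (x 0 k / 2) <= n%:R :> R.
    near: n; have /cvgryPge : n%:R @[n --> \oo] --> (+oo : set_system R) by exact: cvgr_idn.
    by apply.
  rewrite ler_pdivrMr ?divr_gt0// mulrC => h1 h2.
  by rewrite -(ler_nat R) (le_trans h1).
- apply: cvgMr; apply: cvg_big => [|k _]; first exact: add_continuous.
  have h : ln ((K n k)%:R / n%:R) @[n --> \oo] --> ln (x 0 k).
    exact: (@cvg_comp _ _ _ (fun n => (K n k)%:R / n%:R) (@ln R) _ _ _ (hK k) (continuous_ln (x0 k))).
  apply: cvg_trans (cvgN h); apply: near_eq_cvg; near=> n => /=.
  have n0 : (0 < n%:R :> R) by rewrite ltr0n; near: n; exact: nbhs_infty_gt.
  have K0 : (0 < (K n k)%:R :> R).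
    apply: (@lt_le_trans _ _ (x 0 k / 2 * n%:R)); first by rewrite mulr_gt0// divr_gt0.
    by near: n; exact: Kx.
  by rewrite [LHS](_ : _ = - ln ((K n k)%:R / n%:R))// ln_div ?posrE// opprB.
Unshelve. all: by end_near. Qed.

End entropy_factor_asymptotics.

Section local_limit.
Variables (R : realType) (q : nat).
Notation V := 'rV[R]_q.
Variables (beta_ h_ : nat -> R) (beta h : R).
Notation fe n := (free_energy (beta_ n) (h_ n)).
Hypotheses (hbeta_ : beta_ n @[n --> \oo] --> beta) (hh_ : h_ n @[n --> \oo] --> h).
Hypothesis q0 : (0 < q)%N.
Variables (x : V) (eps : R).
Hypotheses (hx : global_minimizer beta h x) (heps : 0 < eps).
Hypothesis huniq : forall y, global_minimizer beta h y -> enorm (y - x) <= eps -> y = x.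
Variable d : nat -> V.
Hypothesis hd : forall n, (1 <= n)%N -> smallest_shift (beta_ n) (h_ n) x (d n).
Variable k : R.
Hypothesis k0 : 0 < k.
Hypothesis hk : forall v, zero_sum v -> k * \sum_i v 0 i ^+ 2 <= hess beta x v.
Variables (g : V -> R) (M : R).
Hypotheses (cg : continuous g) (gM : forall w, `|g w| <= M).

Definition ball_event n : set (configuration q n) :=
  [set s | eball x eps (n%:R^-1 *: empirical R s)].

Definition window_mass n (w : V) : R :=
  cell_mass (beta_ n) (h_ n) (ball_event (n:=n)) (x + d n) g w.

Lemma ln_nat_le (t : R) n : 0 < t -> (0 < n)%N -> ln n%:R <= t * n%:R - 1 - ln t.
Proof.
move=> t0 n0; have N0 : 0 < n%:R :> R by rewrite ltr0n.
have := @ln_le R (t * n%:R); rewrite mulr_gt0// lnM ?posrE// => /(_ isT); lra.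
Qed.

(** For frequencies close to x the entropy factor is bounded. For the others it is
at most of order n^(q/2), while half of the Gaussian decay of the weight is
exponentially small in n. *)
Lemma window_mass_bound : exists2 c, 0 < c & exists2 C, 0 <= C &
  \forall n \near \oo, forall w, lattice n (x + d n) w ->
    `|window_mass n w| <= C * expR (- (c * \sum_i w 0 i ^+ 2)).
Proof.
have [c1 c10 hc1] := free_energy_lower_bound hbeta_ hh_ q0 hx heps huniq hd k0 hk.
have [mu mu0 hmu] := min_coord_gt0 hx.
have [M1 M10 hM1] := stirling_rem_bounded R.
have Q0 : 0 < q%:R :> R by rewrite ltr0n.
pose c := c1 / 2; have c0 : 0 < c by rewrite divr_gt0.
(* Chosen such that (q / 2) t n is the exponential gain c n mu^2 / 16 in the
   case of frequencies far from x; ln n <= t n + t2 by concavity. *)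
pose t := c * mu ^+ 2 / (8 * q%:R); have t0 : 0 < t by rewrite divr_gt0 ?mulr_gt0// exprn_gt0.
pose t1 := - ln (mu / 2); pose t2 := - 1 - ln t.
pose E1 := expR ((q%:R + 1) * M1 + q%:R / 2 * t1).
pose E2 := expR ((q%:R + 1) * M1 + q%:R / 2 * t2).
have M0 : 0 <= M by exact: le_trans (gM 0).
exists c => //; exists ((E1 + E2) * M); first by rewrite mulr_ge0// addr_ge0// expR_ge0.
have mu4 : 0 < mu / 4 by rewrite divr_gt0.
near=> n.
have n0 : (1 <= n)%N by near: n; exact: nbhs_infty_ge.
have N0 : 0 < n%:R :> R by rewrite ltr0n.
have low : forall y : V, simplex y -> eball x eps y ->
    c1 * \sum_i (y 0 i - (x + d n) 0 i) ^+ 2 <=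
    fe n y - fe n (x + d n).
  by near: n; exact: hc1.
have px : forall i, `|(x + d n) 0 i - x 0 i| <= mu / 4.
  by near: n; exact: (near_shift_coord hbeta_ hh_ hx heps huniq hd).
move=> w Lw; rewrite /window_mass.
have pos : 0 <= (E1 + E2) * M * expR (- (c * \sum_i w 0 i ^+ 2)).
  by rewrite !mulr_ge0 ?addr_ge0 ?expR_ge0.
have [[K KS wK]|nK] := pselect (exists2 K : 'I_q -> nat, (\sum_i K i = n)%N &
    w = rescale n (x + d n) (n%:R *: profile R n K)); last first.
  by rewrite cell_mass_empty ?normr0// => K KS wK; apply: nK; exists K.
rewrite wK cell_mass_profile// -wK.
have sy := profile_simplex R n0 KS; set y := profile R n K in sy wK *.
have [yeps|_] := asboolP (eball x eps y); last by rewrite mul0r normr0.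
rewrite mul1r; set p := x + d n in low px wK *.
have wE : \sum_i w 0 i ^+ 2 = n%:R * \sum_i (y 0 i - p 0 i) ^+ 2.
  rewrite wK rescale_profile// mulr_sumr; apply: eq_bigr => i _.
  by rewrite !mxE exprMn sqr_sqrtr ?ltW.
set S := \sum_i w 0 i ^+ 2 in wE *.
have S0 : 0 <= S by apply: sumr_ge0 => i _; exact: sqr_ge0.
have low' : c1 * S <= n%:R * (fe n y - fe n p).
  by rewrite wE mulrCA ler_pM2l//; exact: low.
set D := n%:R * _ in low' *.
have ef0 : 0 < entropy_factor R n K by exact: expR_gt0.
rewrite normrM normrM (gtr0_norm ef0) (gtr0_norm (expR_gt0 _)).
rewrite [leRHS]mulrAC; apply: ler_pM => //; first by rewrite mulr_ge0 ?expR_ge0// ltW.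
have cS : c1 * S = c * S + c * S by rewrite /c; field.
have [yx|yx] := pselect (forall i, `|y 0 i - x 0 i| <= mu / 2).
  apply: (@le_trans _ _ (E1 * expR (- (c * S)))); last first.
    by rewrite ler_pM2r ?expR_gt0// lerDl expR_ge0.
  apply: ler_pM; rewrite ?expR_ge0//; last first.
    rewrite ler_expR lerN2; have := mulr_ge0 (ltW c0) S0; lra.
  apply: entropy_factor_le => // i.
  have yi : mu / 2 <= (K i)%:R / n%:R.
    have -> : (K i)%:R / n%:R = y 0 i by rewrite mxE.
    by have := yx i; rewrite ler_norml => /andP[]; have := hmu i; lra.
  have Ki : 0 < (K i)%:R :> R.
    by rewrite -(pmulr_lgt0 _ (_ : 0 < n%:R^-1 :> R)) ?invr_gt0// (lt_le_trans _ yi)// divr_gt0.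
  rewrite /t1 -opprB lerN2 -ln_div ?posrE// ler_ln ?posrE ?divr_gt0//.
have {yx}[i yx] : exists i, mu / 2 < `|y 0 i - x 0 i|.
  apply: contrapT => /forallNP nr; apply: yx => i; rewrite leNgt; exact/negP/nr.
have Sn : n%:R * (mu ^+ 2 / 16) <= S.
  rewrite wE ler_pM2l// (bigD1 i)//=.
  apply: (@le_trans _ _ ((y 0 i - p 0 i) ^+ 2)); last by rewrite lerDl sumr_ge0// => j _; exact: sqr_ge0.
  have : mu / 4 <= `|y 0 i - p 0 i|.
    have := ler_distD (p 0 i) (y 0 i) (x 0 i); have := px i; lra.
  rewrite -(ler_pXn2r (n := 2))// ?nnegrE ?(ltW mu4)// real_normK ?num_real//; lra.
apply: (@le_trans _ _ (E2 * expR (- (c * S)))); last first.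
  by rewrite ler_pM2r ?expR_gt0// lerDr expR_ge0.
have ef : entropy_factor R n K <= expR ((q%:R + 1) * M1 + q%:R / 2 * (t * n%:R + t2)).
  apply: entropy_factor_le => // j; have := ln_nat_le t0 n0; have := ln_nat_ge0 R (K j); rewrite /t2; lra.
apply: (@le_trans _ _ (expR ((q%:R + 1) * M1 + q%:R / 2 * (t * n%:R + t2)) * expR (- D))).
  by rewrite ler_pM2r ?expR_gt0.
rewrite -!expRD ler_expR.
have E : q%:R / 2 * (t * n%:R) = c * (n%:R * (mu ^+ 2 / 16)) by rewrite /t; field; rewrite gt_eqF.
have := ler_wpM2l (ltW c0) Sn.
rewrite mulrDr E; lra.
Unshelve. all: by end_near. Qed.

Definition mass_limit (l : R) : R := expR (l - \sum_(i < q) l + 2^-1 * \sum_i - ln (x 0 i)).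

(** Near x, the entropy factor converges and the exponent has the limit given by
[cvg_scaled_excess]. *)
Lemma window_mass_cvg (l : R) (v_ : nat -> V) (v : V) :
  stirling_rem R n @[n --> \oo] --> l ->
  (\forall n \near \oo, lattice n (x + d n) (v_ n)) ->
  (forall i, v_ n 0 i @[n --> \oo] --> v 0 i) ->
  window_mass n (v_ n) @[n --> \oo] --> mass_limit l * expR (- (hess beta x v / 2)) * g v.
Proof.
move=> hl hL hv.
have a8 := @cvg_sqrt_nat R.
have wz : \forall n \near \oo, zero_sum (v_ n).
  apply: filterS2 (nbhs_infty_ge 1) hL => n n1 Ln.
  by apply: lattice_zero_sum Ln; have [_ []] := hd n1.
pose y n := x + d n + (Num.sqrt n%:R)^-1 *: v_ n.
have hr : 0 < eps / (2 * q%:R) by rewrite divr_gt0// mulr_gt0// ltr0n.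
have near_y (r : R) : 0 < r -> \forall n \near \oo, simplex (y n) /\ forall i, `|y n 0 i - x 0 i| <= r.
  by move=> r0; exact: (near_simplex hbeta_ hh_ hx heps huniq hd r0 a8 hv wz).
have hK : forall n, exists K : 'I_q -> nat,
    [/\ (1 <= n)%N, lattice n (x + d n) (v_ n) & simplex (y n)] -> (\sum_i K i = n)%N /\ profile R n K = y n.
  move=> n; have [[n1 Ln sy]|no] := pselect [/\ (1 <= n)%N, lattice n (x + d n) (v_ n) & simplex (y n)].
    by have [K KS Ky] := lattice_profile n1 Ln sy.2; exists K.
  by exists (fun=> 0%N) => /no.
have [K {}hK] := choice hK.
have KE : \forall n \near \oo, (\sum_i K n i = n)%N /\ profile R n (K n) = y n.
  near=> n; apply: hK; split.
  - by near: n; exact: nbhs_infty_ge.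
  - by near: n.
  - by near: n; apply: filterS (near_y _ ltr01) => n [].
have yx i : y n 0 i @[n --> \oo] --> x 0 i.
  apply/cvgrPdist_le => e e0; apply: filterS (near_y _ e0) => n [_].
  by move=> /(_ i); rewrite distrC.
have ef : entropy_factor R n (K n) @[n --> \oo] --> mass_limit l.
  apply: cvg_entropy_factor => // [i|i]; first exact: (global_min_gt0 i hx).
  apply: cvg_trans (yx i); apply: near_eq_cvg; apply: filterS KE => n [_ <-].
  by rewrite mxE.
have en : expR (- (n%:R * (fe n (y n) - fe n (x + d n))))
    @[n --> \oo] --> expR (- (hess beta x v / 2)).
  have hn := cvg_scaled_excess hbeta_ hh_ q0 hx heps huniq hd a8 hv wz.
  have {}hn : n%:R * (fe n (y n) - fe n (x + d n))
      @[n --> \oo] --> hess beta x v / 2.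
    by apply: cvg_trans hn; apply: near_eq_cvg; apply: nearW => n /=; rewrite sqr_sqrtr.
  apply: (@cvg_comp _ _ _ (fun n => - (n%:R * (fe n (y n) - fe n (x + d n)))) expR _ _ _ _ (@continuous_expR R _)).
  exact: cvgN.
have gv : g (v_ n) @[n --> \oo] --> g v.
  apply: (@cvg_comp _ _ _ v_ g _ _ _ _ (cg (x := v))).
  apply/(@cvg_ballP R V) => e e0.
  have : \forall n \near \oo, forall i, ball (v 0 i) e (v_ n 0 i).
    by apply: filter_forall => i; move/cvg_ballP : (hv i); exact.
  by apply: filterS => n hn; split => // i j; rewrite ord1; exact: hn.
apply: cvg_trans (cvgM (cvgM ef en) gv); apply: near_eq_cvg; near=> n.
have n0 : (1 <= n)%N by near: n; exact: nbhs_infty_ge.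
have N0 : 0 < n%:R :> R by rewrite ltr0n.
have [KS Ky] : (\sum_i K n i = n)%N /\ profile R n (K n) = y n by near: n.
have vE : v_ n = rescale n (x + d n) (n%:R *: profile R n (K n)).
  rewrite rescale_profile// Ky /y [x + d n + _]addrC addrK scalerA divff ?scale1r//.
  by rewrite gt_eqF// sqrtr_gt0.
have yb : forall i, `|y n 0 i - x 0 i| <= eps / (2 * q%:R).
  by near: n; apply: filterS (near_y _ hr) => n [].
have -> : window_mass n (v_ n) = window_mass n (rescale n (x + d n) (n%:R *: profile R n (K n))) by rewrite -vE.
rewrite /window_mass cell_mass_profile// -vE Ky mulrA.
have -> : `[< eball x eps (y n) >].
  apply/asboolP; rewrite /eball/= /enorm.
  rewrite -(ltr_pXn2r (n := 2)) ?nnegrE ?sqrtr_ge0// ?ltW//.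
  rewrite sqr_sqrtr; last by apply: sumr_ge0 => i _; exact: sqr_ge0.
  apply: (@le_lt_trans _ _ (\sum_(i < q) (eps / (2 * q%:R)) ^+ 2)).
    apply: ler_sum => i _; rewrite -real_normK ?num_real// ler_sqr ?nnegrE//; last exact: ltW.
    by have := yb i; rewrite !mxE.
  rewrite sumr_const card_ord -[_ *+ q]mulr_natl.
  have Q1 : 1 <= q%:R :> R by rewrite ler1n.
  have Q0 : 0 < q%:R :> R by rewrite ltr0n.
  have -> : q%:R * (eps / (2 * q%:R)) ^+ 2 = eps ^+ 2 / (4 * q%:R) by field; rewrite gt_eqF.
  rewrite ltr_pdivrMr ?mulr_gt0// ltr_pMr ?exprn_gt0//; lra.
by rewrite !mul1r.
Unshelve. all: by end_near. Qed.

End local_limit.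

(** * The conditional limit law *)

Section lattice_points.
Variables (R : realType) (q : nat).
Notation V := 'rV[R]_q.
Implicit Types (p v : V).

(** Round n p down in all coordinates but i0: the base points of the iterated
integrals can be taken close to 0. *)
Lemma lattice_point n p (i0 : 'I_q) : (0 < n)%N -> simplex p -> exists2 v : V, lattice n p v &
  forall i, `|v 0 i| <= q%:R / Num.sqrt n%:R.
Proof.
move=> n0 sp; have s0 : 0 < Num.sqrt n%:R :> R by rewrite sqrtr_gt0 ltr0n.
pose N i : int := if i == i0 then n%:Z - \sum_(j | j != i0) Num.floor (n%:R * p 0 j)
  else Num.floor (n%:R * p 0 i).
have NS : \sum_i N i = n%:Z.
  rewrite (bigD1 i0)//= {1}/N eqxx [X in _ + X](eq_bigr (fun j => Num.floor (n%:R * p 0 j))).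
    by rewrite subrK.
  by move=> j /negPf; rewrite /N => ->.
pose v : V := rescale n p (\row_i (N i)%:~R).
have Lv : lattice n p v by exists N.
exists v => //.
have v1 i : i != i0 -> `|v 0 i| <= 1 / Num.sqrt n%:R.
  move=> ii; rewrite !mxE /N (negPf ii) mulrC normrM [X in _ * X]gtr0_norm ?invr_gt0//.
  rewrite ler_pM2r ?invr_gt0//.
  by have /andP[] := floor_itv (n%:R * p 0 i); rewrite ler_norml intrD => *; apply/andP; split; lra.
have vi i : i != i0 -> `|v 0 i| <= (Num.sqrt n%:R)^-1 by move=> /v1; rewrite mul1r.
have q0 : (0 < q)%N by case: (i0) => j; exact: leq_trans.
move=> i; have [->|ii] := eqVneq i i0; last first.
  by rewrite (le_trans (vi _ ii))// ler_peMl ?invr_ge0 ?(ltW s0)// ler1n.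
have := lattice_zero_sum sp Lv; rewrite /zero_sum/= (bigD1 i0)//= => /eqP; rewrite addr_eq0 => /eqP ->.
rewrite normrN (le_trans (ler_norm_sum _ _ _))//.
apply: (@le_trans _ _ (\sum_(j < q) (Num.sqrt n%:R)^-1)).
  rewrite [leRHS](bigD1 i0)//= ler_wpDl ?invr_ge0 ?(ltW s0)//.
  exact: ler_sum.
by rewrite sumr_const card_ord mulr_natl.
Qed.

Lemma reach_lattice n p (i0 : 'I_q) s v w : (0 < n)%N -> simplex p -> (forall i, (i \in s) = (i != i0)) ->
  lattice n p v -> lattice n p w -> reach i0 (Num.sqrt n%:R) s v w.
Proof.
move=> n0 sp si Lv Lw; split.
- by move=> i; rewrite si => /negPf ->.
- move=> j _; have [N [_ ->]] := Lv; have [N' [_ ->]] := Lw.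
  by exists (N' j - N j); rewrite !mxE rmorphB /=; ring.
- by rewrite (lattice_zero_sum sp Lv) (lattice_zero_sum sp Lw).
Qed.

Lemma wgt_sqr c s v : uniq s -> 0 <= c -> expR (- (c * \sum_i v 0 i ^+ 2)) <= wgt c s v.
Proof.
move=> us c0; have -> : wgt c s v = expR (- (c * \sum_(i <- s) v 0 i ^+ 2)).
  rewrite /wgt; elim: (s) => [|j t IH]; first by rewrite !big_nil mulr0 oppr0 expR0.
  by rewrite !big_cons IH /gw -expRD mulrDr opprD.
rewrite ler_expR lerN2 ler_wpM2l// big_uniq//=.
rewrite [leRHS](bigID (mem s))/= lerDl; apply: sumr_ge0 => i _; exact: sqr_ge0.
Qed.

Lemma empirical_lattice n p (c : configuration q n) : lattice n p (rescale n p (empirical R c)).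
Proof.
exists (fun i => (occ c i)%:Z); split.
  by rewrite -[in RHS](occ_sum c) -[RHS]natz natr_sum; apply: eq_bigr => i _; rewrite natz.
by congr rescale; apply/rowP => i; rewrite empiricalE mxE.
Qed.

End lattice_points.

Section conditional_limit.
Variables (R : realType) (q : nat).
Notation V := 'rV[R]_q.
Notation BV := (borel_rV R q).
Variables (beta_ h_ : nat -> R) (beta h : R).
Hypotheses (hbeta_ : beta_ n @[n --> \oo] --> beta) (hh_ : h_ n @[n --> \oo] --> h).
Hypothesis q0 : (0 < q)%N.
Variables (x : V) (eps : R).
Hypotheses (hx : global_minimizer beta h x) (heps : 0 < eps).
Hypothesis huniq : forall y, global_minimizer beta h y -> enorm (y - x) <= eps -> y = x.
Variable d : nat -> V.
Hypothesis hd : forall n, (1 <= n)%N -> smallest_shift (beta_ n) (h_ n) x (d n).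
Variable k : R.
Hypothesis k0 : 0 < k.
Hypothesis hk : forall v, zero_sum v -> k * \sum_i v 0 i ^+ 2 <= hess beta x v.
Variables (i0 : 'I_q) (A B : R) (s : seq 'I_q).
Hypothesis hQ : forall w, hess beta x w = qform i0 A B [::] w.
Hypotheses (B0 : 0 < B) (us : uniq s) (si : forall i, (i \in s) = (i != i0)).
Hypothesis ss : size s = q.-1.
Hypothesis Dk : forall m, (m <= size s)%N -> 0 < prec A B m.

Definition scaled_sum n (g : V -> R) : R :=
  expR (n%:R * free_energy (beta_ n) (h_ n) (x + d n) + beta_ n / 2) *
  \sum_(c : configuration q n) `[< ball_event x eps c >]%:R * gibbs_weight (beta_ n) (h_ n) c *
    g (rescale n (x + d n) (empirical R c)).

Lemma pivot_notin : i0 \notin s. Proof. by rewrite si eqxx. Qed.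

Lemma iter_window g n v : (0 < n)%N -> lattice n (x + d n) v ->
  iter_int i0 (grid (Num.sqrt n%:R)) s (window_mass beta_ h_ x eps d g n) v = scaled_sum n g.
Proof.
move=> n0 Lv; have s0 : 0 < Num.sqrt n%:R :> R by rewrite sqrtr_gt0 ltr0n.
have [_ [sp _] _] := hd n0.
rewrite [LHS](iter_int_point_masses _ _ _ s0 us pivot_notin) /scaled_sum mulr_sumr [in RHS]mulr_sumr.
apply: eq_bigr => c _; rewrite asboolT ?mulr1; last first.
  by apply: (reach_lattice (n := n) (p := x + d n)) => //; exact: empirical_lattice.
rewrite /config_mass ss !mulrA; congr (_ * _ * _ * _); rewrite exprVn.
by rewrite mulVf ?mul1r// expf_neq0// gt_eqF.
Qed.

(** [scaled_sum] is an iterated integral of [window_mass] on the grid. Indices are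
shifted by N0 because the bound on the masses holds for large n only. *)
Lemma scaled_sum_cvg (l : R) (g : V -> R) M : stirling_rem R n @[n --> \oo] --> l ->
  continuous g -> (forall w, 0 <= g w) -> (forall w, g w <= M) ->
  scaled_sum n g @[n --> \oo] --> mass_limit x l * gmass A B (size s) * gexp i0 A B s g 0.
Proof.
move=> hl cg g0 gM; have gM' w : `|g w| <= M by rewrite ger0_norm.
have [c c0 [C C0 [N1 _ hN1]]] := window_mass_bound hbeta_ hh_ q0 hx heps huniq hd k0 hk gM'.
pose N0 := N1.+1.
pose u n := (n + N0)%N.
have u1 n : (1 <= u n)%N by rewrite /u /N0; lia.
have v0 n : exists v : V, lattice (u n) (x + d (u n)) v /\ forall i, `|v 0 i| <= q%:R / Num.sqrt (u n)%:R.
  have [_ [sp _] _] := hd (u1 n).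
  by have [v Lv hv] := lattice_point i0 (u1 n) sp; exists v.
have [v_ {}hv] := choice v0.
pose g' w := mass_limit x l * g w.
have ml0 : 0 < mass_limit x l by exact: expR_gt0.
have cg' : continuous g'.
  move=> w; apply: (@continuous_comp _ _ _ g (fun t => mass_limit x l * t)); first exact: cg.
  by apply: cvgMr; exact: cvg_id.
have g'0 w : 0 <= g' w by rewrite mulr_ge0// ltW.
have g'M w : g' w <= mass_limit x l * M by rewrite ler_pM2l.
pose F w := g' w * expR (- (qform i0 A B [::] w / 2)).
have au : Num.sqrt (u n)%:R @[n --> \oo] --> (+oo : set_system R).
  by rewrite (cvg_shiftn N0 (fun n => Num.sqrt n%:R : R)); exact: cvg_sqrt_nat.
have a1 n : 1 <= Num.sqrt (u n)%:R :> R by rewrite -[leLHS]sqrtr1 ler_wsqrtr// ler1n.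
have Fb n w : lattice (u n) (x + d (u n)) w ->
    `|window_mass beta_ h_ x eps d g (u n) w| <= C * wgt c s w.
  move=> Lw; apply: (le_trans (hN1 (u n) _ w Lw)); first by rewrite /u /N0 /=; lia.
  by rewrite ler_wpM2l// wgt_sqr// ltW.
have Fc (w_ : nat -> V) (w : V) : (forall n, lattice (u n) (x + d (u n)) (w_ n)) ->
    (forall i, w_ n 0 i @[n --> \oo] --> w 0 i) ->
    window_mass beta_ h_ x eps d g (u n) (w_ n) @[n --> \oo] --> F w.
  move=> Lw hw; pose w' m := w_ (m - N0)%N.
  have w'E n : w' (n + N0)%N = w_ n by rewrite /w' addnK.
  have := @window_mass_cvg R q beta_ h_ beta h hbeta_ hh_ q0 x eps hx heps huniq d hd g cg l w' w hl.
  have L' : \forall n \near \oo, lattice n (x + d n) (w' n).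
    near=> n; have nN : (N0 <= n)%N by near: n; exact: nbhs_infty_ge.
    by have := Lw (n - N0)%N; rewrite /u subnK.
  have c' i : w' n 0 i @[n --> \oo] --> w 0 i.
    rewrite -(cvg_shiftn N0 (fun n => w' n 0 i)).
    rewrite (_ : (fun n => _) = (fun n => w_ n 0 i)); first exact: hw.
    by apply/funext => n; rewrite w'E.
  move=> /(_ L' c'); rewrite -(cvg_shiftn N0 (fun n => window_mass beta_ h_ x eps d g n (w' n))).
  rewrite (_ : (fun n => _) = (fun n => window_mass beta_ h_ x eps d g (u n) (w_ n))); last first.
    by apply/funext => n; rewrite w'E.
  by rewrite /F /g' hQ mulrAC.
have z0 i : v_ n 0 i @[n --> \oo] --> (0 : V) 0 i.
  rewrite mxE; apply/cvgr0Pnorm_le => e e0; near=> n.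
  rewrite (le_trans ((hv n).2 i))// ler_pdivrMr ?(lt_le_trans _ (a1 n))// mulrC -ler_pdivrMr//.
  by near: n; move/cvgryPge : au; apply.
have H := iter_int_cvg c0 C0 us pivot_notin a1 au
  (fun n => @grid_closed_lattice R q (u n) (x + d (u n)) i0) Fb Fc (fun n => (hv n).1) z0.
rewrite -(cvg_shiftn N0).
have HE : iter_int i0 id s F 0 = mass_limit x l * gmass A B (size s) * gexp i0 A B s g 0.
  rewrite (iter_int_gaussian B0 cg' g'0 g'M _ us pivot_notin Dk).
  have -> : qform i0 A B s 0 = 0.
    rewrite /qform /tot !big1 ?mxE ?addr0 ?expr0n ?mulr0 ?addr0// => i _; rewrite ?mxE ?expr0n//.
  have -> : cmean i0 A B s 0 = 0.
    apply/rowP => i; rewrite /cmean /tot !mxE big1 ?addr0 ?mulr0 => [|j _]; last by rewrite mxE.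
    by case: ifP => // _; case: ifP.
  rewrite mul0r oppr0 expR0 mulr1 [in RHS](mulrC (mass_limit _ _)) -mulrA; congr (_ * _).
  apply: EFin_inj; rewrite (gexpE i0 A B cg' g'0 g'M) EFinM (gexpE i0 A B cg g0 gM).
  have mg : measurable_fun [set: BV] (fun y : BV => (g (0 + y))%:E) by exact: (measurable_addl cg).
  have pg (y : BV) : [set: BV] y -> (0 <= (g (0 + y))%:E)%E by rewrite lee_fin.
  by rewrite -(ge0_integralZl_EFin _ measurableT pg mg (ltW ml0)).
rewrite -HE; apply: cvg_trans H; apply: near_eq_cvg; apply: nearW => n.
by rewrite iter_window//; exact: (hv n).1.
Unshelve. all: by end_near. Qed.

(** The partition function and the normalization of [scaled_sum] cancel. *)
Lemma gibbs_cond_expectationE n g :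
  gibbs_cond_expectation n (beta_ n) (h_ n) [set c | eball x eps (n%:R^-1 *: empirical R c)]
    (fun c => g (fluctuation n x (d n) c)) = scaled_sum n g / scaled_sum n (fun=> 1).
Proof.
pose Z : R := @partition_function R q n (beta_ n) (h_ n).
have Z0 : Z != 0.
  rewrite gt_eqF// /Z /partition_function (bigD1 [ffun=> i0])//=.
  by rewrite ltr_pwDl ?expR_gt0// sumr_ge0// => c _; exact: expR_ge0.
pose X (f : configuration q n -> R) : R := \sum_(c : configuration q n)
  `[< ball_event x eps c >]%:R * gibbs_weight (beta_ n) (h_ n) c * f c.
have E (f : configuration q n -> R) : \sum_(c | c \in [set c | eball x eps (n%:R^-1 *: empirical R c)])
    gibbs (beta_ n) (h_ n) c * f c = Z^-1 * X f.
  rewrite big_mkcond mulr_sumr; apply: eq_bigr => c _.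
  have -> : `[< ball_event x eps c >] = (c \in [set c | eball x eps (n%:R^-1 *: empirical R c)]).
    by apply/asboolP/idP; rewrite in_setE.
  case: ifP => _; last by rewrite !mul0r mulr0.
  by rewrite /gibbs -/Z mul1r mulrA [Z^-1 * _]mulrC.
rewrite /gibbs_cond_expectation E.
have -> : \sum_(c : configuration q n | c \in [set c | eball x eps (n%:R^-1 *: empirical R c)])
    gibbs (beta_ n) (h_ n) c = Z^-1 * X (fun=> 1) :> R.
  by rewrite -E; apply: eq_bigr => c _; rewrite mulr1.
rewrite -mulf_div divff ?invr_neq0// mul1r /scaled_sum -mulf_div divff ?mul1r ?gt_eqF ?expR_gt0//.
by congr (_ / _); apply: eq_bigr => c _; rewrite fluctuation_rescale.
Qed.

(** A signed bounded g is reduced to the nonnegative g + M by linearity. *)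
Lemma gibbs_cond_cvg : cvg_in_law
  (fun n g => gibbs_cond_expectation n (beta_ n) (h_ n)
     [set c | eball x eps (n%:R^-1 *: empirical R c)] (fun c => g (fluctuation n x (d n) c)))
  (gaussian_sum (gvecs i0 A B s)).
Proof.
move=> g cg [M gM]; set P := gaussian_sum _.
have [l hl] := cvg_stirling_rem R.
have M0 : 0 <= M by exact: le_trans (gM 0).
have PT : P setT = 1%E by exact: probability_setT.
pose gm w := g w + M.
have cgm : continuous gm.
  move=> w; apply: (@continuous_comp _ _ _ g (fun t => t + M)); first exact: cg.
  by apply: cvgD; [exact: cvg_id|exact: cvg_cst].
have gm0 w : 0 <= gm w by have := gM w; rewrite ler_norml /gm => /andP[]; lra.
have gmM w : gm w <= M + M by have := gM w; rewrite ler_norml /gm => /andP[]; lra.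
have c1 : continuous ((fun=> 1) : V -> R) by exact: cst_continuous.
have L1 := scaled_sum_cvg hl c1 (fun=> ler01) (fun=> lexx _).
have Lg := scaled_sum_cvg hl cgm gm0 gmM.
have G1 : gexp i0 A B s (fun=> 1) 0 = 1.
  apply: EFin_inj; rewrite (gexpE i0 A B c1 (fun=> ler01) (fun=> lexx _)).
  by rewrite integral_cst//= mul1e.
have mg : measurable_fun [set: BV] (g : BV -> R) by exact: continuous_measurable_rV.
have ig : P.-integrable setT (EFin \o (g : BV -> R)).
  apply: measurable_bounded_integrable => //; first by rewrite [X in (X < _)%E]PT ltry.
  exists M; split; first exact: num_real.
  by move=> y My w _ /=; apply: le_trans (gM w) (ltW My).
have Gg : expectation P (g : BV -> R) = (gexp i0 A B s gm 0 - M)%:E.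
  rewrite EFinB (gexpE i0 A B cgm gm0 gmM) unlock.
  under [in RHS]eq_integral do rewrite add0r EFinD.
  rewrite integralD//=; last exact: finite_measure_integrable_cst.
  rewrite integral_cst//= PT mule1 addeK//.
rewrite Gg; apply: cvg_EFin; first exact: nearW.
pose K := mass_limit x l * gmass A B (size s).
have K0 : K != 0 by rewrite gt_eqF// mulr_gt0 ?expR_gt0// gmass_gt0.
have E n : gibbs_cond_expectation n (beta_ n) (h_ n)
    [set c | eball x eps (n%:R^-1 *: empirical R c)] (fun c => g (fluctuation n x (d n) c)) =
    (scaled_sum n gm - M * scaled_sum n (fun=> 1)) / scaled_sum n (fun=> 1).
  rewrite gibbs_cond_expectationE; congr (_ / _).
  rewrite /scaled_sum [M * _]mulrCA -mulrBr; congr (_ * _).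
  by rewrite mulr_sumr -sumrB; apply: eq_bigr => c _; rewrite /gm; ring.
have -> : gexp i0 A B s gm 0 - M = (K * gexp i0 A B s gm 0 - M * (K * gexp i0 A B s (fun=> 1) 0))
   / (K * gexp i0 A B s (fun=> 1) 0).
  by rewrite G1; field.
rewrite (_ : _ \o _ = fun n => (scaled_sum n gm - M * scaled_sum n (fun=> 1)) / scaled_sum n (fun=> 1)).
  by apply: cvgM; [apply: cvgB => //; exact: cvgMr|apply: cvgV => //; rewrite G1 mulr1].
by apply/funext => n /=; rewrite E.
Qed.

End conditional_limit.

Theorem theorem3p4 (R : realType) (q : nat) (hq : (2 <= q)%N)
    (beta_ h_ : nat -> R) (beta h : R)
    (hbeta_ : beta_ n @[n --> \oo] --> beta) (hh_ : h_ n @[n --> \oo] --> h)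
    (hbeta : 0 <= beta) (hh : 0 <= h)
    (x : 'rV[R]_q) (hx : global_minimizer beta h x)
    (hmult : exists x' : 'rV[R]_q, global_minimizer beta h x' /\ x' <> x)
    (eps : R) (heps : 0 < eps)
    (hdist : forall y z : 'rV[R]_q, global_minimizer beta h y ->
      global_minimizer beta h z -> y <> z -> eps < enorm (y - z))
    (d : nat -> 'rV[R]_q)
    (hd : forall n : nat, (1 <= n)%N -> smallest_shift (beta_ n) (h_ n) x (d n)) :
  exists2 P : probability (borel_rV R q) R,
    centered_gaussian (covariance_matrix beta x) P &
    cvg_in_law
      (fun (n : nat) (g : 'rV[R]_q -> R) =>
        gibbs_cond_expectation n (beta_ n) (h_ n)
          [set s | eball x eps (n%:R^-1 *: empirical R s)]
          (fun s => g (fluctuation n x (d n) s)))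
      P.
Proof.
have q0 : (0 < q)%N by exact: ltnW.
have [i0 [a [b [[b0 ba a1 ab] xi0 xi [B0 S0]]]]] := minimizer_structure hq hh hx hmult.
set A := a^-1 - beta in S0; set B := b^-1 - beta in B0 S0.
pose s : seq 'I_q := [seq i <- enum 'I_q | i != i0].
have us : uniq s by rewrite filter_uniq// enum_uniq.
have si i : (i \in s) = (i != i0) by rewrite mem_filter mem_enum andbT.
have ss : size s = q.-1.
  rewrite -(card_uniqP us) -(card_neq i0); apply: eq_card => i.
  by rewrite si inE.
have Dk m : (m <= size s)%N -> 0 < prec A B m.
  rewrite ss => mq; rewrite /prec; have [A0|A0] := leP 0 A.
    by rewrite ltr_wpDr// mulr_ge0.
  apply: (lt_le_trans S0); rewrite /prec lerD2l ler_nM2r// ler_nat//.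
have huniq y : global_minimizer beta h y -> enorm (y - x) <= eps -> y = x.
  move=> gy yx; apply: contrapT => ne.
  by have := hdist y x gy hx ne; rewrite ltNge yx.
have [k k0 hk] := hess_coercive hq xi0 xi B0 S0.
have hQ w : hess beta x w = qform i0 A B [::] w by apply: hess_qform => //; rewrite gt_eqF.
exists (gaussian_sum (gvecs i0 A B s)); last first.
  exact: (gibbs_cond_cvg hbeta_ hh_ q0 hx heps huniq hd k0 hk hQ B0 us si ss Dk).
apply: gaussian_sum_centered => i j.
rewrite (gvecs_cov _ _ B0 us _ Dk); last by rewrite si eqxx.
exact: (covariance_matrixE b0 ba a1 xi0 xi ab i j hq si ss B0 S0).
Qed.
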